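(* Let $0<q<1$, $|t|<1$, and $a,b,c,d,a',b',c',d'$ complex with $\max(|a|,|b|,|c|,|d|)<1$, $\max(|a'|,|b'|,|c'|,|d'|)<1$, $|a't/b|<1$, $ab=a'b'$ and $cd=c'd'$. Then with $x=\cos\theta$, $y=\cos\phi$, $$\sum_{j=0}^\infty H_j\,p_j(x;a,b,c,d|q)\,p_j(y;a',b',c',d'|q)\,t^j$$ $$=\frac{(bte^{i\phi},bte^{-i\phi},cte^{-i\phi},dte^{-i\phi},b'te^{i\theta},b'te^{-i\theta},c'te^{-i\theta},d'te^{-i\theta};q)_\infty}{(bb't,\ te^{i(\theta-\phi)},\ te^{i(\phi-\theta)},\ te^{-i(\theta+\phi)},\ cdte^{-i(\theta+\phi)};q)_\infty}$$ $$\times{}_8W_7(bb't/q;\,be^{i\theta},be^{-i\theta},b'e^{i\phi},b'e^{-i\phi},bt/a';\,q,a't/b)$$ $$\times{}_8W_7(cdte^{-i(\theta+\phi)}/q;\,ce^{-i\theta},de^{-i\theta},c'e^{-i\phi},d'e^{-i\phi},te^{-i(\theta+\phi)};\,q,te^{i(\theta+\phi)}),$$ where $$H_j=\frac{(bc'q^jt,\ b'cq^jt,\ bd'q^jt,\ b'dq^jt;q)_\infty}{(bb'cdq^{2j}t;q)_\infty\,(q,ab,cd,abcdq^{j-1};q)_j}\,{}_8W_7(bb'cdq^{2j-1}t;\,bcq^j,bdq^j,b'c'q^j,b'd'q^j,bt/a';\,q,a't/b).$$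
   Context: $q$-shifted factorials: $(a;q)_n=\prod_{i=0}^{n-1}(1-aq^i)$, $(a_1,\dots,a_m;q)_n=\prod_i(a_i;q)_n$, including $n=\infty$. Askey–Wilson polynomials: $p_n(x;a,b,c,d|q)=a^{-n}(ab,ac,ad;q)_n\,{}_4\varphi_3\!\left({q^{-n},\ abcdq^{n-1},\ ae^{i\theta},\ ae^{-i\theta}\atop ab,\ ac,\ ad};q,q\right)$, $x=\cos\theta$, with ${}_r\varphi_s$ the basic hypergeometric series (Gasper–Rahman notation). ${}_8W_7(a;b,c,d,e,f;q,z)=\sum_{n\ge0}\frac{(a,qa^{1/2},-qa^{1/2},b,c,d,e,f;q)_n}{(q,a^{1/2},-a^{1/2},aq/b,aq/c,aq/d,aq/e,aq/f;q)_n}z^n$. *)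

(* Defs.v *)
(* Complex numbers are R[i] (complex R)
   for R : realType, viewed as a numClosedFieldType so that the normed/topological
   structure of MathComp-Analysis (limits of sequences) applies. *)
From mathcomp Require Import all_boot all_order all_algebra.
From mathcomp Require Import complex.
From mathcomp Require Import all_classical all_reals all_analysis.
Import Order.TTheory GRing.Theory Num.Theory.
Import numFieldTopology.Exports numFieldNormedType.Exports.
Set Implicit Arguments. Unset Strict Implicit. Unset Printing Implicit Defensive.
Local Open Scope ring_scope.
Local Open Scope classical_set_scope.
Local Open Scope complex_scope.

Definition Cx (R : realType) : numClosedFieldType := R[i].

Section Defs.
Variable R : realType.
Local Notation C := (Cx R).

Definition eI (th : R) : C := (cos th)%:C + 'i * (sin th)%:C.

Definition qpoch (a q : C) (n : nat) : C := \prod_(i < n) (1 - a * q ^+ i).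

Definition qpochInf (a q : C) : C := limn (qpoch a q).

Definition psum (u : nat -> C) (N : nat) : C := \sum_(n < N) u n.

Definition seriesVal (u : nat -> C) : C := limn (psum u).

(* very-well-poised 8W7(a; b,c,d,e,f; q, z) (Gasper--Rahman), with a^{1/2} = sqrtC a
   (the series does not depend on the choice of square root) *)
Definition W87_term (a b c d e f q z : C) (n : nat) : C :=
  let s := sqrtC a in
  (qpoch a q n * qpoch (q * s) q n * qpoch (- (q * s)) q n
     * qpoch b q n * qpoch c q n * qpoch d q n * qpoch e q n * qpoch f q n)
  / (qpoch q q n * qpoch s q n * qpoch (- s) q n
     * qpoch (a * q / b) q n * qpoch (a * q / c) q n * qpoch (a * q / d) q n
     * qpoch (a * q / e) q n * qpoch (a * q / f) q n)
  * z ^+ n.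

Definition W87 (a b c d e f q z : C) : C := seriesVal (W87_term a b c d e f q z).

(* Askey--Wilson polynomial p_n(cos th; a,b,c,d | q)
   = a^{-n} (ab,ac,ad;q)_n 4phi3(q^{-n}, abcdq^{n-1}, a e^{i th}, a e^{-i th};
                                 ab, ac, ad; q, q).
   The 4phi3 terminates: (q^{-n};q)_k = 0 for k > n, so summing k = 0..n is exact. *)
Definition AW (n : nat) (th : R) (a b c d q : C) : C :=
  a ^- n * (qpoch (a * b) q n * qpoch (a * c) q n * qpoch (a * d) q n)
  * \sum_(k < n.+1)
      (qpoch (q ^- n) q k * qpoch (a * b * c * d * q ^+ n / q) q k
         * qpoch (a * eI th) q k * qpoch (a * eI (- th)) q k)
      / (qpoch q q k * qpoch (a * b) q k * qpoch (a * c) q k * qpoch (a * d) q k)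
      * q ^+ k.

End Defs.

(* Main.v *)
(* With u = e^{i theta} and s^2 = cd, the Askey-Wilson polynomial p_j(x;a,b,c,d) is, up to
   a factor, a convolution in j of Al-Salam-Chihara polynomials with parameters (a,b) and
   (su,s/u).  On products of two such polynomials of total degree N, the raising and lowering
   operators of a q-oscillator pair satisfy a q-commutation relation; the descendants of the
   vectors killed by the lowering operator form an orthogonal basis of each degree, in which
   the product of two polynomials has as coordinates an Askey-Wilson polynomial times one
   Al-Salam-Chihara polynomial with parameters (asq^j,bsq^j).  Parseval's identity in this
   basis writes a product of two Poisson kernels of Al-Salam-Chihara polynomials as a sum over
   j of Askey-Wilson polynomials times Poisson kernels with shifted parameters.
   Each Poisson kernel is an infinite product times an 8W7: coefficientwise in t both sides
   are Laurent polynomials in u, so it is enough to check bu = q^-m, where Sears' and Watson's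
   transformations apply.  This proves the theorem as an identity of formal power series in t;
   bounds that are uniform in j allow to evaluate it at |t| < 1. *)

Require Import Defs.
From HB Require Import structures.
From mathcomp Require Import all_boot all_order all_algebra.
From mathcomp Require Import complex.
From mathcomp Require Import all_classical all_reals all_analysis.
From mathcomp Require Import ring lra zify.
Import Order.TTheory GRing.Theory Num.Theory.
Import numFieldTopology.Exports numFieldNormedType.Exports.
Set Implicit Arguments. Unset Strict Implicit. Unset Printing Implicit Defensive.
Local Open Scope ring_scope.

(** * Terminating q-hypergeometric sums *)

Definition qprod (F : fieldType) (q x y : F) (n : nat) : F :=
  \prod_(i < n) (x - y * q ^+ i).

Section QProd.
Variables (F : fieldType) (q : F).
Implicit Types (a b c d e x y g h X : F) (n m k i : nat).
Local Notation H := (qprod q).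
Local Notation P := (qprod q 1).

Lemma qprod0 x y : H x y 0 = 1.
Proof. by rewrite /qprod big_ord0. Qed.

Lemma qprodSr x y n : H x y n.+1 = H x y n * (x - y * q ^+ n).
Proof. by rewrite /qprod big_ord_recr. Qed.

Lemma qprodS x y n : H x y n.+1 = (x - y) * H x (y * q) n.
Proof.
rewrite /qprod big_ord_recl expr0 mulr1; congr (_ * _).
by apply: eq_bigr => i _; rewrite lift0 exprS mulrA.
Qed.

Lemma qprodD x y m n : H x y (m + n) = H x y m * H x (y * q ^+ m) n.
Proof.
elim: n => [|n IH]; first by rewrite addn0 qprod0 mulr1.
by rewrite addnS !qprodSr IH exprD !mulrA.
Qed.

Lemma qprodZ z x y n : H (z * x) (z * y) n = z ^+ n * H x y n.
Proof.
elim: n => [|n IH]; first by rewrite !qprod0 mul1r.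
rewrite !qprodSr IH exprS; ring.
Qed.

Lemma qprod_neq0 x y n :
  (forall i, (i < n)%N -> x - y * q ^+ i != 0) -> H x y n != 0.
Proof. by move=> h; apply/prodf_neq0 => i _; apply: h. Qed.

Lemma qprod_x0 x n : H x 0 n = x ^+ n.
Proof.
elim: n => [|n IH]; first by rewrite qprod0.
by rewrite qprodSr IH mul0r subr0 exprSr.
Qed.

Lemma qprod_1V m n : q != 0 -> (m < n)%N -> P (q ^- m) n = 0.
Proof.
move=> q0 mn; rewrite /qprod (bigD1 (Ordinal mn)) //= mulVf ?subrr ?mul0r //.
exact: expf_neq0.
Qed.

Hypothesis hq : forall n, 1 - q ^+ n.+1 != 0.

Lemma qfact_neq0 n : P q n != 0.
Proof. by apply: qprod_neq0 => i _; rewrite -exprS. Qed.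

Lemma qfactS n : P q n.+1 = P q n * (1 - q ^+ n.+1).
Proof. by rewrite qprodSr exprS. Qed.

Lemma qprod_neq0W x y : (forall n, H x y n != 0) -> forall i, x - y * q ^+ i != 0.
Proof.
by move=> h i; apply: contraNneq (h i.+1) => e; rewrite qprodSr e mulr0.
Qed.

(* Homogeneous form of the q-Pfaff-Saalschuetz sum: the usual one is h = 1, and
   the two q-Chu-Vandermonde sums are g = 0 and h = 0. *)
Lemma saalschutz X y g h n : (forall i, P (X * y) i != 0) ->
  \sum_(i < n.+1) H g (X * h) i * P y i * H h g (n - i)
                    / (P q i * P (X * y) i * P q (n - i))
  = P X n * H h (y * g) n / (P q n * P (X * y) n).
Proof.
move=> hXy; have hXy' := qprod_neq0W hXy.
pose T n i := H g (X * h) i * P y i * H h g (n - i)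
                    / (P q i * P (X * y) i * P q (n - i)).
rewrite -[LHS]/(\sum_(i < n.+1) T n i).
elim: n => [|n IH].
  by rewrite big_ord1 /T subnn !qprod0 !mulr1.
pose c1 := (1 - q ^+ n.+1) * (1 - X * y * q ^+ n).
pose c2 := (1 - X * q ^+ n) * (h - y * g * q ^+ n).
have key i : (i <= n)%N -> \sum_(j < i.+1) (c1 * T n.+1 j - c2 * T n j)
    = - q ^+ (n - i) * T n i * (g - X * h * q ^+ i) * (1 - y * q ^+ i).
  elim: i => [_|i IHi lin].
    rewrite big_ord1 /T !subn0 !qprod0 !qprodSr /c1 /c2.
    have := hq n; have := hXy' n; have := qfact_neq0 n.
    rewrite exprS expr0.
    set Q := P q n; set x := q ^+ n => h1 h2 h3.
    by field; rewrite h1 h3.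
  rewrite big_ord_recr /= IHi ?(ltnW lin) //.
  have [r en] : exists r, n = (i.+1 + r)%N by exists (n - i.+1)%N; rewrite subnKC.
  have e1 : ((i.+1 + r).+1 - i.+1 = r.+1)%N by lia.
  have e2 : ((i.+1 + r) - i = r.+1)%N by lia.
  have e3 : ((i.+1 + r) - i.+1 = r)%N by lia.
  rewrite /T /c1 /c2 en e1 e2 e3 addSn !qprodSr !exprS !exprD.
  have := hq i; have := hXy' i; have := qfact_neq0 i; have := hXy i.
  have := hq r; have := qfact_neq0 r.
  rewrite !exprS.
  set Q := P q i; set x := q ^+ i; set z := q ^+ r; set Q' := P q r.
  set W := P (X * y) i => h1 h2 h3 h4 h5 h6.
  by field; rewrite ?h1 ?h2 ?h3 ?h4 ?h5 ?h6.
have h1 : c1 != 0 by rewrite mulf_neq0.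
have := key n (leqnn _); rewrite big_split /= subnn expr0.
rewrite sumrN -!mulr_sumr IH => E.
have {}E : c1 * (\sum_(i < n.+2) T n.+1 i) = c2 * (P X n * H h (y * g) n / (P q n * P (X * y) n)).
  rewrite big_ord_recr /= mulrDr.
  move/eqP: E; rewrite subr_eq => /eqP ->.
  rewrite /T !subnn !qprod0 !qprodSr /c1 /c2 exprS.
  have := hq n; have := hXy' n; have := qfact_neq0 n; have := hXy n.
  rewrite exprS.
  by move=> h2 h3 h4 h5; field; rewrite h2 h3 h4 h5.
apply: (mulfI h1); rewrite E /c1 /c2 !qprodSr exprS.
have := hq n; have := hXy' n; have := qfact_neq0 n; have := hXy n.
rewrite exprS.
by move=> h2 h3 h4 h5; field; rewrite h2 h3 h4 h5.
Qed.

End QProd.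

Lemma bin2S n : 'C(n.+1, 2) = ('C(n, 2) + n)%N.
Proof. by rewrite binS bin1. Qed.

Lemma bin2D m n : 'C(m + n, 2) = ('C(m, 2) + 'C(n, 2) + m * n)%N.
Proof.
elim: n => [|n IH]; first by rewrite !addn0 muln0 addn0.
rewrite addnS !bin2S IH; lia.
Qed.

Lemma bin2_sqr n : (n * n = 'C(n, 2) + 'C(n, 2) + n)%N.
Proof. elim: n => [|n IH] //; rewrite bin2S; lia. Qed.

Lemma sum_triangle (V : nmodType) (f : nat -> nat -> V) n :
  \sum_(k < n.+1) \sum_(i < k.+1) f k i
  = \sum_(i < n.+1) \sum_(l < (n - i).+1) f (i + l)%N i.
Proof.
elim: n => [|n IH]; first by rewrite !big_ord1.
rewrite big_ord_recr IH [RHS]big_ord_recr /= subnn big_ord1 addn0.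
rewrite [X in _ + X]big_ord_recr /= addrA -big_split /=; congr (_ + _).
apply: eq_bigr => -[i /=]; rewrite ltnS => lin _.
by rewrite subSn // [RHS]big_ord_recr /= addnS subnKC.
Qed.

Lemma bin2_compl k r :
  ('C((r + k).+1, 2) + 'C(r, 2) = (r + k) * r + 'C(k, 2) + k)%N.
Proof. by have := bin2_sqr r; rewrite bin2S bin2D mulnDl [(k * r)%N]mulnC; lia. Qed.

Lemma bin2_compl_sqr k r :
  ((r + k) * (r + k) + 'C(r.+1, 2)
   = 'C((r + k).+1, 2) + 'C(k, 2) + (r + k) * r)%N.
Proof.
have := bin2_compl k r; have := bin2_sqr r; have := bin2_sqr k.
by rewrite (bin2S r) mulnDr !mulnDl [(k * r)%N]mulnC; lia.
Qed.

Section Transformations.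
Variables (F : fieldType) (q : F).
Hypothesis hq : forall n, 1 - q ^+ n.+1 != 0.
Hypothesis q0 : q != 0.
Implicit Types (a b c d e x y z g h X : F) (n m k i : nat).
Local Notation H := (qprod q).
Local Notation P := (qprod q 1).

Lemma qprod_rev x y n :
  H (x * q ^+ n) (y * q) n = (-1) ^+ n * q ^+ 'C(n.+1, 2) * H y x n.
Proof.
elim: n x => [|n IH] x; first by rewrite !qprod0 !mulr1.
rewrite qprodSr exprS mulrA IH qprodS (bin2S n.+1) exprD !exprS; ring.
Qed.

Lemma qfact_rev n i : (i <= n)%N ->
  P (q ^- n) i * P q (n - i) * q ^+ (n * i) = (-1) ^+ i * q ^+ 'C(i, 2) * P q n.
Proof.
elim: i => [_|i IH lin].
  by rewrite qprod0 subn0 muln0 !mul1r mulr1.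
have := IH (ltnW lin).
have e : (n - i = (n - i.+1).+1)%N by lia.
rewrite e !qprodSr -exprS -e mulnS exprD bin2S exprD !exprS => E.
have h1 : 1 - q ^+ (n - i) != 0 by rewrite e hq.
apply: (mulfI h1).
transitivity (P (q ^- n) i * (P q (n - i.+1) * (1 - q ^+ (n - i))) * q ^+ (n * i)
              * ((1 - q ^- n * q ^+ i) * q ^+ n)); first by ring.
rewrite E.
have -> : (1 - q ^- n * q ^+ i) * q ^+ n = - (q ^+ i * (1 - q ^+ (n - i))).
  have -> : q ^+ n = q ^+ i * q ^+ (n - i) by rewrite -exprD subnKC // ltnW.
  by field; rewrite !expf_neq0.
ring.
Qed.

Lemma qprod_split x y n i : (i <= n)%N ->
  H x y n = H x y i * H x (y * q ^+ i) (n - i).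
Proof. by move=> lin; rewrite -{1}(subnKC lin) qprodD. Qed.

Lemma qprod_shift_neq0 x y i :
  (forall n, H x y n != 0) -> forall n, H x (y * q ^+ i) n != 0.
Proof.
by move=> h n; apply: contraNneq (h (i + n)%N) => e; rewrite qprodD e mulr0.
Qed.

Lemma saalschutz_balanced a b c d n :
  a != 0 -> c != 0 -> (forall i, P c i != 0) -> P d n != 0 ->
  c * d * q ^+ n = a * b * q ->
  \sum_(i < n.+1) P (q ^- n) i * P a i * P b i * q ^+ i
                  / (P q i * P c i * P d i)
  = a ^+ n * P (c / a) n * P (d / a) n / (P c n * P d n).
Proof.
move=> a0 c0 hc hdn E.
have hd i : (i <= n)%N -> P d i != 0.
  by move=> lin; apply: contraNneq hdn => e; rewrite (qprod_split _ _ lin) e mul0r.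
have hXy : forall i, P (c / a * a) i != 0 by move=> i; rewrite divfK.
have := saalschutz hq (X := c / a) (y := a) c (a * b) n hXy.
rewrite !divfK //.
have r m z : H (a * b * z) (c * z) m = z ^+ m * H (a * b) c m.
  by rewrite ![_ * z]mulrC qprodZ.
have r1 i : (i <= n)%N -> H (a * b) c (n - i) * P d i * q ^+ (n - i)
    = (- 1) ^+ (n - i) * c ^+ (n - i) * q ^+ 'C((n - i).+1, 2) * P d n.
  move=> lin; rewrite (qprod_split _ _ lin).
  have := r (n - i)%N q; rewrite -E.
  have -> : c * d * q ^+ n = c * d * q ^+ i * q ^+ (n - i).
    by rewrite -[RHS]mulrA -exprD subnKC.
  rewrite qprod_rev => E1.
  transitivity ((q ^+ (n - i) * H (a * b) c (n - i)) * P d i); first by ring.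
  rewrite -E1.
  have -> : H c (c * d * q ^+ i) (n - i) = c ^+ (n - i) * P (d * q ^+ i) (n - i).
    by rewrite -qprodZ mulr1 mulrA.
  ring.
have r2 : H (a * b) (a * c) n * q ^+ n
    = (- 1) ^+ n * a ^+ n * c ^+ n * q ^+ 'C(n.+1, 2) * P (d / a) n.
  have e : a * b * q = (a * (c * (d / a))) * q ^+ n.
    by rewrite -E; field.
  rewrite mulrC -qprodZ ![q * _]mulrC e qprod_rev.
  by rewrite qprodZ -[X in H X _]mulr1 qprodZ; ring.
move=> S.
pose K := (-1) ^+ n * c ^+ n * q ^+ 'C(n.+1, 2) * P d n / (q ^+ n * P q n).
have K0 : K != 0.
  by rewrite /K !mulf_neq0 ?invr_eq0 ?mulf_neq0 ?expf_neq0 ?qfact_neq0 ?oppr_eq0 ?oner_neq0.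
apply: (mulfI K0); rewrite mulr_sumr.
transitivity (P (c / a) n * H (a * b) (a * c) n / (P q n * P c n)); last first.
  apply: (mulIf (expf_neq0 n q0)).
  transitivity (P (c / a) n * (H (a * b) (a * c) n * q ^+ n) / (P q n * P c n)).
    by ring.
  rewrite r2 /K; field; rewrite ?qfact_neq0 ?hc ?hd ?expf_neq0 //.
rewrite -S; apply: eq_bigr => -[i /=]; rewrite ltnS => lin _.
have e1 : H c (c / a * (a * b)) i = c ^+ i * P b i.
  by rewrite -qprodZ mulr1; congr (H _ _ _); field.
have e2 := qfact_rev lin; have e3 := r1 i lin.
have h1 := qfact_neq0 hq (n - i).
have h2 : P (q ^- n) i = (-1) ^+ i * q ^+ 'C(i, 2) * P q n / (P q (n - i) * q ^+ (n * i)).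
  by rewrite -e2; field; rewrite h1 expf_neq0.
have h3 : H (a * b) c (n - i) = (- 1) ^+ (n - i) * c ^+ (n - i) * q ^+ 'C((n - i).+1, 2) * P d n
    / (P d i * q ^+ (n - i)).
  by rewrite -e3; field; rewrite hd // expf_neq0.
rewrite h2 h3 e1 /K.
have -> : c ^+ n = c ^+ i * c ^+ (n - i) by rewrite -exprD subnKC.
have -> : (-1) ^+ n = (-1) ^+ i * (-1) ^+ (n - i) :> F by rewrite -exprD subnKC.
have -> : (-1) ^+ i * (-1) ^+ (n - i) * (c ^+ i * c ^+ (n - i))
  = ((-1) ^+ i)^-1 * (-1) ^+ (n - i) * (c ^+ i * c ^+ (n - i)) by rewrite -exprVn invrN1.
have sgn0 : (-1) ^+ i != 0 :> F by rewrite expf_neq0 // oppr_eq0 oner_neq0.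
have -> : q ^+ 'C(n.+1, 2) = q ^+ 'C((n - i).+1, 2) * q ^+ (n * i) * q ^+ n * q ^+ i
   / (q ^+ (n - i) * q ^+ 'C(i, 2) * (q ^+ i * q ^+ i)).
  have e4 : ('C(n.+1, 2) + ((n - i) + 'C(i, 2) + (i + i))
     = 'C((n - i).+1, 2) + n * i + n + i)%N.
    move: (n - i)%N (subnK lin) => m <-.
    by have := bin2_sqr i; rewrite -addSn bin2D mulnDl; nia.
  have := congr1 (fun k => q ^+ k) e4; rewrite !exprD => e5.
  by rewrite -e5; field; rewrite !expf_neq0.
field; rewrite ?h1 ?hc ?hd ?qfact_neq0 ?expf_neq0 ?sgn0 ?oppr_eq0 ?oner_neq0 //.
Qed.

Lemma sears a b c d e g n :
  a != 0 -> b != 0 -> d != 0 -> e != 0 ->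
  (forall i, P d i != 0) -> (forall i, P e i != 0) -> P g n != 0 ->
  d * e * g * q ^+ n = a * b * c * q ->
  \sum_(k < n.+1) P (q ^- n) k * P a k * P b k * P c k * q ^+ k
                  / (P q k * P d k * P e k * P g k)
  = P q n * a ^+ n / (P e n * P g n)
    * \sum_(i < n.+1) (-1) ^+ i / (a ^+ i * q ^+ 'C(i, 2))
        * H (b * c / d) b i * P (d / b) i * P a i
        * P (e / a) (n - i) * P (g / a) (n - i)
        / (P q i * P d i * P q (n - i)).
Proof.
move=> a0 b0 d0 e0 hd he hgn E.
have hg i : (i <= n)%N -> P g i != 0.
  by move=> lin; apply: contraNneq hgn => e1; rewrite (qprod_split _ _ lin) e1 mul0r.
pose f k i := P (q ^- n) k * P a k * q ^+ k / (P e k * P g k)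
  * (H (b * c / d) b i * P (d / b) i * P (b * c / d) (k - i)
    / (P q i * P d i * P q (k - i))).
transitivity (\sum_(k < n.+1) \sum_(i < k.+1) f k i).
  apply: eq_bigr => -[k /=]; rewrite ltnS => lkn _; rewrite -mulr_sumr.
  have hbd : forall i, P (b * (d / b)) i != 0 by move=> i; rewrite mulrC divfK.
  have := saalschutz hq (X := b) (y := d / b) (b * c / d) 1 k hbd.
  rewrite !mulr1.
  have -> : b * (d / b) = d by field.
  have -> : d / b * (b * c / d) = c by field; rewrite d0 b0.
  move=> ->; field.
  by rewrite hd he hg // qfact_neq0.
rewrite sum_triangle mulr_sumr; apply: eq_bigr => -[i /=]; rewrite ltnS => lin _.
have qi0 : q ^+ i != 0 by rewrite expf_neq0.
have E' : e * q ^+ i * (g * q ^+ i) * q ^+ (n - i) = a * q ^+ i * (b * c / d) * q.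
  apply: (mulfI d0); transitivity (d * e * g * (q ^+ i * q ^+ (n - i)) * q ^+ i).
    by ring.
  by rewrite -exprD subnKC // E; field.
have hgi : P (g * q ^+ i) (n - i) != 0.
  by apply: contraNneq hgn => e1; rewrite (qprod_split _ _ lin) e1 mulr0.
have := saalschutz_balanced (mulf_neq0 a0 qi0) (mulf_neq0 e0 qi0)
  (qprod_shift_neq0 i he) hgi E'.
set S := \sum_(_ < _) _ => ES.
transitivity (P (q ^- n) i * P a i * q ^+ i / (P e i * P g i)
  * (H (b * c / d) b i * P (d / b) i / (P q i * P d i)) * S).
  rewrite mulr_sumr; apply: eq_bigr => -[l /=]; rewrite ltnS => ll _.
  rewrite /f addKn !(qprodD _ _ _ i l) exprD.
  have -> : q ^- n * q ^+ i = q ^- (n - i).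
    have -> : q ^+ n = q ^+ i * q ^+ (n - i) by rewrite -exprD subnKC.
    by rewrite invfM mulrC mulVKf.
  have := hd i; have := he i; have := hg i lin; have := qfact_neq0 hq i.
  have := qfact_neq0 hq l; have := qprod_shift_neq0 i he l.
  have : P (g * q ^+ i) l != 0.
    by apply: contraNneq hgi => e1; rewrite (qprod_split _ _ ll) e1 mul0r.
  by move=> h1 h2 h3 h4 h5 h6 h7; field; rewrite h1 h2 h3 h4 h5 h6 h7.
have e2 := qfact_rev lin.
have h1 := qfact_neq0 hq (n - i).
have h2 : P (q ^- n) i = (-1) ^+ i * q ^+ 'C(i, 2) * P q n / (P q (n - i) * q ^+ (n * i)).
  by rewrite -e2; field; rewrite h1 expf_neq0.
rewrite ES h2 [P e n](qprod_split _ _ lin) [P g n](qprod_split _ _ lin).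
have -> : e * q ^+ i / (a * q ^+ i) = e / a by field; rewrite a0 qi0.
have -> : g * q ^+ i / (a * q ^+ i) = g / a by field; rewrite a0 qi0.
have -> : a ^+ n = a ^+ i * a ^+ (n - i) by rewrite -exprD subnKC.
have -> : q ^+ (n * i) = q ^+ 'C(i, 2) * q ^+ 'C(i, 2) * q ^+ i * q ^+ i ^+ (n - i).
  by rewrite -!exprM -!exprD -bin2_sqr -mulnDr subnKC // mulnC.
rewrite exprMn.
have := hd i; have := he i; have := hg i lin; have := qfact_neq0 hq i.
have := qprod_shift_neq0 i he (n - i); have := hgi.
have := expf_neq0 (n - i) qi0; have := expf_neq0 (n - i) a0.
set A := a ^+ (n - i); set Q := (q ^+ i) ^+ (n - i).
move=> A0 Q0 h3 h4 h5 h6 h7 h8; field.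
by rewrite ?A0 ?Q0 ?h1 ?h3 ?h4 ?h5 ?h6 ?h7 ?h8 ?expf_neq0.
Qed.

Section Bailey.
Variable A : F.
Hypothesis A1 : 1 - A != 0.
Hypothesis hA : forall i, P (A * q) i != 0.

Let unitA r : F := P A r * (1 - A * q ^+ (r + r)) / (1 - A)
  * ((-1) ^+ r * q ^+ 'C(r, 2)) / P q r.

Lemma unit_bailey_pair n :
  \sum_(r < n.+1) unitA r / (P q (n - r) * P (A * q) (n + r)) = (n == 0%N)%:R.
Proof.
case: n => [|n].
  by rewrite big_ord1 /unitA subnn !qprod0 bin0n !expr0 !mulr1 mul1r mulfV // !invr1 !mulr1.
pose U r := unitA r / (P q (n.+1 - r) * P (A * q) (n.+1 + r)).
have key i : (i <= n.+1)%N -> \sum_(r < i.+1) U r =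
  (-1) ^+ i * q ^+ 'C(i.+1, 2) * P (A * q) i * (1 - q ^+ (n.+1 - i))
  / (P q i * P q (n.+1 - i) * P (A * q) (n.+1 + i) * (1 - q ^+ n.+1)).
  elim: i => [_|i IHi lin].
    rewrite big_ord1 /U /unitA !subn0 addn0 !qprod0 /= addn0 !bin_small // !expr0.
    rewrite mulr1 mul1r mulfV // !mulr1.
    have := hq n; have := hA n.+1; have := qfact_neq0 hq n.+1.
    by set w := q ^+ n.+1 => h1 h2 h3; field; rewrite h1 h2 h3 oner_neq0.
  rewrite big_ord_recr /= IHi ?(ltnW lin) // /U /unitA.
  have [s en] : exists s, n = (i + s)%N by exists (n - i)%N; rewrite subnKC.
  have e1 : ((i + s).+1 - i = s.+1)%N by lia.
  have e2 : ((i + s).+1 - i.+1 = s)%N by lia.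
  have e3 : ((i + s).+1 + i.+1 = (i + s + i.+1).+1)%N by lia.
  have e4 : ((i + s).+1 + i = (i + s + i.+1))%N by lia.
  have := hA i; have := hA (i + s + i.+1)%N; have := hA (i + s + i.+1).+1.
  have := qfact_neq0 hq i; have := qfact_neq0 hq s.
  have := qprod_neq0W hA i; have := qprod_neq0W hA (i + s + i.+1).
  have := hq i; have := hq s; have := hq (i + s).
  rewrite en e1 e2 e3 e4 (bin2S i.+1) (bin2S i) (qprodS _ 1 A) !qprodSr.
  rewrite !(exprD, exprS).
  set x := q ^+ i; set z := q ^+ s; set w := q ^+ 'C(i, 2); set B := P _ i.
  set D := P _ (i + s + i.+1).
  move=> h1 h2 h3 h4 h5 h6 h7 h8 h9 h10.
  field.
  by rewrite ?h1 ?h2 ?h3 ?h4 ?h5 ?h6 ?h7 ?h9 ?h10 ?A1.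
rewrite -[LHS]/(\sum_(r < n.+2) U r) key // subnn expr0 subrr mulr0.
by rewrite mul0r.
Qed.

Lemma bailey_lemma (alpha beta : nat -> F) d e g :
  d * e * g = A * q ->
  (forall i, P (d * g) i != 0) -> (forall i, P (e * g) i != 0) ->
  (forall n, beta n = \sum_(r < n.+1) alpha r / (P q (n - r) * P (A * q) (n + r))) ->
  forall n, \sum_(k < n.+1) P d k * P e k * P g (n - k) * g ^+ k
               / (P q (n - k) * P (d * g) n * P (e * g) n) * beta k
   = \sum_(r < n.+1) P d r * P e r * g ^+ r / (P (d * g) r * P (e * g) r)
       * alpha r / (P q (n - r) * P (A * q) (n + r)).
Proof.
move=> E hd he hb n.
pose f k r := P d k * P e k * P g (n - k) * g ^+ k
  / (P q (n - k) * P (d * g) n * P (e * g) n)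
  * (alpha r / (P q (k - r) * P (A * q) (k + r))).
transitivity (\sum_(k < n.+1) \sum_(r < k.+1) f k r).
  by apply: eq_bigr => k _; rewrite hb mulr_sumr.
rewrite sum_triangle; apply: eq_bigr => -[r /=]; rewrite ltnS => lrn _.
have E' : (d * q ^+ r * g) * (e * q ^+ r) = A * q * q ^+ (r + r).
  by rewrite -E exprD; ring.
have hX : forall i, P ((d * q ^+ r * g) * (e * q ^+ r)) i != 0.
  by rewrite E'; apply: qprod_shift_neq0.
have := saalschutz hq g 1 (n - r) hX.
rewrite !mulr1 E'; set S := \sum_(_ < _) _ => ES.
transitivity (P d r * P e r * g ^+ r / (P (d * g) n * P (e * g) n) * alpha r
  / P (A * q) (r + r) * S).
  rewrite mulr_sumr; apply: eq_bigr => l _.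
  rewrite /f addKn subnDA -addnA [(l + r)%N]addnC addnA.
  rewrite [P d _]qprodD [P e _]qprodD [P (A * q) (r + r + l)]qprodD exprD.
  have -> : H g (d * q ^+ r * g) l = g ^+ l * P (d * q ^+ r) l.
    by rewrite -qprodZ mulr1 [g * _]mulrC.
  have := hd n; have := he n; have := hA (r + r); have := qfact_neq0 hq l.
  have := qprod_shift_neq0 (r + r) hA l; have := qfact_neq0 hq (n - r - l).
  by move=> h1 h2 h3 h4 h5 h6; field; rewrite h1 h2 h3 h4 h5 h6.
rewrite ES.
rewrite [P (d * g) n](qprod_split _ _ lrn) [P (e * g) n](qprod_split _ _ lrn).
have -> : (n + r = r + r + (n - r))%N by lia.
rewrite [P (A * q) (_ + (n - r))]qprodD.
have -> : d * g * q ^+ r = d * q ^+ r * g by ring.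
have e1 : e * g * q ^+ r = e * q ^+ r * g by ring.
rewrite e1.
have := qprod_shift_neq0 r hd (n - r); have := qprod_shift_neq0 r he (n - r).
rewrite e1; have -> : d * g * q ^+ r = d * q ^+ r * g by ring.
have := hd r; have := he r; have := hA (r + r); have := qfact_neq0 hq (n - r).
have := qprod_shift_neq0 (r + r) hA (n - r).
move=> h1 h2 h3 h4 h5 h6 h7; field.
by rewrite h1 h2 h3 h4 h5 h6 h7.
Qed.

Lemma watson b c d e g h n :
  b * c * g = A * q -> d * e * h = A * q ->
  (forall i, P (b * g) i != 0) -> (forall i, P (c * g) i != 0) ->
  (forall i, P (d * h) i != 0) -> (forall i, P (e * h) i != 0) ->
  \sum_(r < n.+1) P A r * (1 - A * q ^+ (r + r)) / (1 - A)
    * ((-1) ^+ r * q ^+ 'C(r, 2)) / P q r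
    * (P b r * P c r * g ^+ r / (P (b * g) r * P (c * g) r))
    * (P d r * P e r * h ^+ r / (P (d * h) r * P (e * h) r))
    / (P q (n - r) * P (A * q) (n + r))
  = \sum_(k < n.+1) P d k * P e k * P h (n - k) * h ^+ k
      / (P q (n - k) * P (d * h) n * P (e * h) n)
      * (P g k / (P q k * P (b * g) k * P (c * g) k)).
Proof.
move=> E1 E2 hb hc hd he.
have B1 := @bailey_lemma _ (fun n => (n == 0%N)%:R) b c g E1 hb hc
  (fun n => esym (unit_bailey_pair n)).
have B1' m : P g m / (P q m * P (b * g) m * P (c * g) m)
  = \sum_(r < m.+1) (P b r * P c r * g ^+ r / (P (b * g) r * P (c * g) r)
       * unitA r) / (P q (m - r) * P (A * q) (m + r)).
  rewrite -B1 big_ord_recl big1 ?addr0 => [|i _]; last by rewrite mulr0.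
  by rewrite !qprod0 subn0 !mul1r !mulr1.
rewrite (@bailey_lemma (fun r => P b r * P c r * g ^+ r
  / (P (b * g) r * P (c * g) r) * unitA r) _ _ _ _ E2 hd he B1').
by apply: eq_bigr => r _; rewrite /unitA; congr (_ / _); ring.
Qed.

End Bailey.

End Transformations.

(** * Formal power series and Al-Salam-Chihara polynomials *)

Definition fps (F : fieldType) : Type := nat -> F.

Section FormalPowerSeries.
Variable F : fieldType.
Implicit Types f g h : fps F.

HB.instance Definition _ := gen_eqMixin (fps F).
HB.instance Definition _ := gen_choiceMixin (fps F).

Let fps_add f g : fps F := fun n => f n + g n.
Let fps_opp f : fps F := fun n => - f n.
Let fps_zero : fps F := fun=> 0.
Let fps_one : fps F := fun n => (n == 0%N)%:R.
Let fps_mul f g : fps F := fun n => \sum_(i < n.+1) f i * g (n - i)%N.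

Let fps_addA : associative fps_add.
Proof. by move=> f g h; apply/funext => n; rewrite /fps_add addrA. Qed.
Let fps_addC : commutative fps_add.
Proof. by move=> f g; apply/funext => n; rewrite /fps_add addrC. Qed.
Let fps_add0 : left_id fps_zero fps_add.
Proof. by move=> f; apply/funext => n; rewrite /fps_add add0r. Qed.
Let fps_addN : left_inverse fps_zero fps_opp fps_add.
Proof. by move=> f; apply/funext => n; rewrite /fps_add addNr. Qed.

HB.instance Definition _ :=
  GRing.isZmodule.Build (fps F) fps_addA fps_addC fps_add0 fps_addN.

Let fps_mulA : associative fps_mul.
Proof.
move=> f g h; apply/funext => n; rewrite /fps_mul; apply/esym.
under eq_bigr do rewrite mulr_suml.
rewrite (sum_triangle (fun k i => f i * g (k - i)%N * h (n - k)%N)).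
apply: eq_bigr => i _; rewrite mulr_sumr; apply: eq_bigr => l _.
by rewrite addKn subnDA mulrA.
Qed.
Let fps_mulC : commutative fps_mul.
Proof.
move=> f g; apply/funext => n; rewrite /fps_mul (reindex_inj rev_ord_inj) /=.
by apply: eq_bigr => i _; rewrite subSS subKn 1?mulrC // -ltnS.
Qed.
Let fps_mul1 : left_id fps_one fps_mul.
Proof.
move=> f; apply/funext => n; rewrite /fps_mul big_ord_recl big1 => [|i _].
  by rewrite mul1r subn0 addr0.
by rewrite mul0r.
Qed.
Let fps_mulDl : left_distributive fps_mul fps_add.
Proof.
move=> f g h; apply/funext => n; rewrite /fps_mul /fps_add -big_split.
by apply: eq_bigr => i _; rewrite mulrDl.
Qed.
Let fps_one_neq0 : fps_one != fps_zero.
Proof. by apply/eqP => /(congr1 (fun f : fps F => f 0%N))/eqP; rewrite oner_eq0. Qed.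

HB.instance Definition _ := GRing.Zmodule_isComNzRing.Build (fps F)
  fps_mulA fps_mulC fps_mul1 fps_mulDl fps_one_neq0.

Lemma fps_coefM f g n : (f * g) n = \sum_(i < n.+1) f i * g (n - i)%N.
Proof. by []. Qed.
Lemma fps_coefM0 f g : (f * g) 0%N = f 0%N * g 0%N.
Proof. by rewrite fps_coefM big_ord1. Qed.
Lemma fps_coef_sum I r (P : pred I) (G : I -> fps F) n :
  (\sum_(i <- r | P i) G i) n = \sum_(i <- r | P i) G i n.
Proof. by elim/big_rec2: _ => // i y x _ <-. Qed.

Definition fpsC (c : F) : fps F := fun n => c *+ (n == 0%N).

Lemma fps_coefCM c f n : (fpsC c * f) n = c * f n.
Proof.
rewrite fps_coefM big_ord_recl big1 => [|i _]; last by rewrite mul0r.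
by rewrite subn0 addr0.
Qed.

Lemma fpsC1 : fpsC 1 = 1. Proof. by []. Qed.

Definition fpsL (a : F) : fps F := fun n => if n is n'.+1 then - a *+ (n' == 0%N) else 1.

Lemma fps_coefLM0 a f : (fpsL a * f) 0%N = f 0%N.
Proof. by rewrite fps_coefM0 mul1r. Qed.

Lemma fps_coefLM a f n : (fpsL a * f) n.+1 = f n.+1 - a * f n.
Proof.
rewrite fps_coefM 2!big_ord_recl big1 => [|i _]; last by rewrite mul0r.
by rewrite /= mul1r subn0 addr0 subSS subn0 mulNr.
Qed.

Definition dil (z : F) f : fps F := fun n => z ^+ n * f n.

Lemma dilM z f g : dil z (f * g) = dil z f * dil z g.
Proof.
apply/funext => n; rewrite fps_coefM /dil mulr_sumr; apply: eq_bigr => i _.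
have -> : z ^+ n = z ^+ i * z ^+ (n - i) by rewrite -exprD subnKC // -ltnS.
ring.
Qed.

Definition tsum (G : nat -> fps F) : fps F :=
  fun n => \sum_(k < n.+1) G k (n - k)%N.

Lemma tsumMl f G : f * tsum G = tsum (fun k => f * G k).
Proof.
apply/funext => n; rewrite fps_coefM /tsum.
transitivity (\sum_(i < n.+1) \sum_(k < n.+1 | (k <= n - i)%N) f i * G k (n - i - k)%N).
  apply: eq_bigr => -[i /=]; rewrite ltnS => lin _.
  rewrite mulr_sumr (big_ord_widen_cond n.+1 predT
    (fun k => f i * G k (n - i - k)%N)) ?ltnS ?leq_subr //.
rewrite (exchange_big_dep predT) //=; apply: eq_bigr => -[k /=].
rewrite ltnS => lkn _; rewrite fps_coefM.
rewrite (big_ord_widen_cond n.+1 predT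
    (fun i => f i * G k (n - k - i)%N)) ?ltnS ?leq_subr //=.
apply: eq_big => [[i /= lin]|i _]; first by lia.
by rewrite -!subnDA addnC.
Qed.

End FormalPowerSeries.

Section QExponential.
Variables (F : fieldType) (q : F).
Hypothesis hq : forall n, 1 - q ^+ n.+1 != 0.
Implicit Types (a b u z : F) (f g : fps F).
Local Notation P := (qprod q 1).

(* Expansions in t of (a t; q)_oo and of 1 / (a t; q)_oo. *)
Definition qE a : fps F := fun n => (-1) ^+ n * q ^+ 'C(n, 2) * a ^+ n / P q n.
Definition qI a : fps F := fun n => a ^+ n / P q n.

Lemma qE0 a : qE a 0%N = 1.
Proof. by rewrite /qE qprod0 !expr0 invr1 !mulr1. Qed.
Lemma qI0 a : qI a 0%N = 1.
Proof. by rewrite /qI qprod0 invr1 mulr1. Qed.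

Lemma dil_qE z a : dil z (qE a) = qE (z * a).
Proof. by apply/funext => n; rewrite /dil /qE exprMn; ring. Qed.
Lemma dil_qI z a : dil z (qI a) = qI (z * a).
Proof. by apply/funext => n; rewrite /dil /qI exprMn; ring. Qed.

Lemma qE_rec a : qE a = fpsL a * qE (q * a).
Proof.
apply/funext => -[|n]; first by rewrite fps_coefLM0 !qE0.
rewrite fps_coefLM /qE qfactS bin2S exprD !exprMn !exprS.
have := hq n; have := qfact_neq0 hq n; rewrite exprS => h1 h2.
by field; rewrite h1 h2.
Qed.

Lemma qI_rec a : qI (q * a) = fpsL a * qI a.
Proof.
apply/funext => -[|n]; first by rewrite fps_coefLM0 !qI0.
rewrite fps_coefLM /qI qfactS !exprMn !exprS.
have := hq n; have := qfact_neq0 hq n; rewrite exprS => h1 h2.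
by field; rewrite h1 h2.
Qed.

Lemma dil_fixed f : dil q f = f -> f = fpsC (f 0%N).
Proof.
move=> E; apply/funext => -[|n] //.
have /(congr1 (fun g : fps F => g n.+1)) := E; rewrite /dil /fpsC mulr0n => e.
apply: (mulfI (hq n)); rewrite mulr0 mulrBl mul1r e; exact: subrr.
Qed.

Lemma qEI a : qE a * qI a = 1.
Proof.
rewrite (@dil_fixed (qE a * qI a)) ?fps_coefM0 ?qE0 ?qI0 ?mulr1 //.
by rewrite dilM dil_qE dil_qI qI_rec (qE_rec a); ring.
Qed.

(* [asc u a b n] is the Al-Salam-Chihara polynomial Q_n((u + 1/u)/2; a, b | q). *)
Definition ascG u a b : fps F := qE a * qE b * (qI u * qI u^-1).
Definition asc u a b n : F := P q n * ascG u a b n.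

Lemma ascE u a b n : asc u a b n / P q n = ascG u a b n.
Proof. by rewrite /asc mulrC mulKf // qfact_neq0. Qed.

Lemma asc0 u a b : asc u a b 0 = 1.
Proof. by rewrite /asc /ascG !fps_coefM0 !qE0 !qI0 qprod0 !mulr1. Qed.

Let ascG_rec u a b : fpsL u * (fpsL u^-1 * ascG u a b)
   = fpsL a * (fpsL b * dil q (ascG u a b)).
Proof.
rewrite /ascG !dilM !dil_qE !dil_qI !qI_rec.
by rewrite (qE_rec a) (qE_rec b); ring.
Qed.

Lemma asc1 u a b : asc u a b 1 = u + u^-1 - (a + b).
Proof.
have /(congr1 (fun g : fps F => g 1%N)) := ascG_rec u a b.
rewrite !fps_coefLM !fps_coefLM0 /dil.
have e0 : ascG u a b 0%N = 1 by rewrite /ascG !fps_coefM0 !qE0 !qI0 !mulr1.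
rewrite e0 expr1 expr0 !mulr1 => e.
rewrite /asc qfactS qprod0 mul1r expr1.
set f := ascG u a b 1%N in e *.
have -> : (1 - q) * f = (f - u^-1 - u) - (q * f - b - a) + (u + u^-1 - (a + b)) by ring.
by rewrite e subrr add0r.
Qed.

Lemma ascSS u a b n : u != 0 -> asc u a b n.+2 =
  (u + u^-1 - (a + b) * q ^+ n.+1) * asc u a b n.+1
  - (1 - q ^+ n.+1) * (1 - a * b * q ^+ n) * asc u a b n.
Proof.
move=> u0.
have /(congr1 (fun g : fps F => g n.+2)) := ascG_rec u a b.
rewrite !fps_coefLM /dil /asc !qfactS !exprS.
set f := ascG u a b n.+2; set g := ascG u a b n.+1; set h := ascG u a b n.
set w := q ^+ n; set p := P q n => e.
have -> : p * (1 - q * w) * (1 - q * (q * w)) * f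
  = p * (1 - q * w) * ((f - u^-1 * g - u * (g - u^-1 * h))
     - (q * (q * w) * f - b * (q * w * g) - a * (q * w * g - b * (w * h)))
   + (u + u^-1 - (a + b) * (q * w)) * g - (u * u^-1 - a * b * w) * h) by ring.
by rewrite e mulfV //; ring.
Qed.

Hypothesis q0 : q != 0.

Lemma asc_rec u a b n : u != 0 -> (u + u^-1) * asc u a b n =
  asc u a b n.+1 + (a + b) * q ^+ n * asc u a b n
  + (1 - q ^+ n) * (1 - a * b * q ^+ n / q) * asc u a b n.-1.
Proof.
case: n => [|n] u0; first by rewrite asc1 asc0 expr0; ring.
by rewrite ascSS // exprS /=; field; rewrite ?q0 ?u0.
Qed.

Lemma asc_3phi2 u a b n : u != 0 -> b != 0 -> (forall i, P (a * b) i != 0) ->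
  asc u a b n = P (a * b) n / b ^+ n
   * \sum_(k < n.+1) P (q ^- n) k * P (b * u) k * P (b / u) k * q ^+ k
        / (P q k * P (a * b) k).
Proof.
move=> u0 b0 hab.
pose D n k := P (a * b) n / b ^+ n * (P (q ^- n) k * q ^+ k / (P q k * P (a * b) k)).
pose phi k := P (b * u) k * P (b / u) k.
pose Z m n := \sum_(k < m) D n k * phi k.
have ZE m n1 : (n1 < m)%N -> Z m n1 = Z n1.+1 n1.
  move=> h; rewrite /Z -(subnKC h) big_split_ord /= [X in _ + X]big1 ?addr0 // => i _.
  rewrite /D qprod_1V //; last by rewrite addSn ltnS leq_addr.
  by rewrite !mul0r mulr0 mul0r.
suff : asc u a b n = Z n.+1 n.
  move=> ->; rewrite /Z mulr_sumr; apply: eq_bigr => k _.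
  by rewrite /D /phi; ring.
have phiS k : phi k.+1 = phi k * (1 - b * q ^+ k * (u + u^-1) + b ^+ 2 * q ^+ k ^+ 2).
  by rewrite /phi !qprodSr; field.
have hq' i : q ^+ i != 0 by rewrite expf_neq0.
have rec k : (u + u^-1) * phi k
   = (b * q ^+ k + (b * q ^+ k)^-1) * phi k - phi k.+1 / (b * q ^+ k).
  by rewrite phiS; field; rewrite u0 b0 hq'.
have Zrec m n1 : (n1.+2 < m)%N -> Z m n1.+2
  = (u + u^-1 - (a + b) * q ^+ n1.+1) * Z m n1.+1
    - (1 - q ^+ n1.+1) * (1 - a * b * q ^+ n1) * Z m n1.
  case: m => // m h.
  have -> : (u + u^-1 - (a + b) * q ^+ n1.+1) * Z m.+1 n1.+1
    = \sum_(k < m.+1) D n1.+1 k * ((u + u^-1) * phi k)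
      - (a + b) * q ^+ n1.+1 * Z m.+1 n1.+1.
    rewrite mulrBl /Z mulr_sumr; congr (_ - _); apply: eq_bigr => k _; ring.
  have -> : \sum_(k < m.+1) D n1.+1 k * ((u + u^-1) * phi k)
    = \sum_(k < m.+1) D n1.+1 k * (b * q ^+ k + (b * q ^+ k)^-1) * phi k
      - \sum_(k < m) D n1.+1 k / (b * q ^+ k) * phi k.+1.
    transitivity (\sum_(k < m.+1) D n1.+1 k * (b * q ^+ k + (b * q ^+ k)^-1) * phi k
      - \sum_(k < m.+1) D n1.+1 k / (b * q ^+ k) * phi k.+1).
      rewrite -sumrB; apply: eq_bigr => k _; rewrite rec; ring.
    congr (_ - _); rewrite big_ord_recr /= /D qprod_1V ?mul0r ?mulr0 ?mul0r ?addr0 //.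
  rewrite /Z 4!big_ord_recl.
  set s1 := \sum_(_ < _) _; set s2 := \sum_(_ < _) _; set s3 := \sum_(_ < _) _.
  set s4 := \sum_(_ < _) _; set s5 := \sum_(_ < _) _.
  have e0 : D n1.+2 0%N * phi 0%N =
     D n1.+1 0%N * (b * q ^+ 0 + (b * q ^+ 0)^-1) * phi 0%N
     - (a + b) * q ^+ n1.+1 * (D n1.+1 0%N * phi 0%N)
     - (1 - q ^+ n1.+1) * (1 - a * b * q ^+ n1) * (D n1 0%N * phi 0%N).
    rewrite /D !qprod0 !expr0 !qprodSr !exprS !(mulr1, invr1).
    by field; rewrite b0 expf_neq0.
  have e1 : s1 = s2 - s3 - (a + b) * q ^+ n1.+1 * s4
     - (1 - q ^+ n1.+1) * (1 - a * b * q ^+ n1) * s5.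
    rewrite /s1 /s2 /s3 /s4 /s5 !mulr_sumr -!sumrB; apply: eq_bigr => k _.
    rewrite lift0 /=; set w := phi k.+1.
    suff -> : D n1.+2 k.+1 = D n1.+1 k.+1 * (b * q ^+ k.+1 + (b * q ^+ k.+1)^-1)
       - D n1.+1 k / (b * q ^+ k) - (a + b) * q ^+ n1.+1 * D n1.+1 k.+1
       - (1 - q ^+ n1.+1) * (1 - a * b * q ^+ n1) * D n1 k.+1 by ring.
    rewrite /D.
    have hv : 1 - q ^- n1.+1 != 0.
      have -> : 1 - q ^- n1.+1 = - q ^- n1.+1 * (1 - q ^+ n1.+1).
        by rewrite mulrBr mulr1 mulNr mulVf // opprK addrC.
      by rewrite mulf_neq0 // oppr_eq0 invr_eq0.
    have qV m1 : q ^- m1.+1 * q = q ^- m1 by rewrite exprS; field; rewrite q0 hq'.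
    have E1 : P (q ^- n1.+2) k.+1 = (1 - q ^- n1.+2) * P (q ^- n1.+1) k.
      by rewrite qprodS qV.
    have E2 : P (q ^- n1) k.+1 = P (q ^- n1.+1) k * (1 - q ^- n1.+1 * q ^+ k)
        * (1 - q ^- n1 * q ^+ k) / (1 - q ^- n1.+1).
      apply: (mulfI hv); rewrite [RHS]mulrC divfK // -{1}(qV n1) -qprodS !qprodSr.
      by congr (_ * (1 - _)); rewrite -(qV n1) (exprS q k) mulrA.
    rewrite E1 E2 [P (q ^- n1.+1) k.+1]qprodSr !(qprodSr _ _ (a * b)) [P q k.+1]qfactS.
    have := hq k; have := qprod_neq0W hab k; have := hab k; have := qfact_neq0 hq k.
    have := hq' k; have := hq' n1; have := expf_neq0 n1 b0; have := hq n1.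
    rewrite !exprS; set x := q ^+ k; set y := q ^+ n1; set B := b ^+ n1.
    move=> h1 h2 h3 h4 h5 h6 h7 h8.
    have h9 : q * y - 1 != 0 by rewrite -opprB oppr_eq0.
    by field; rewrite ?h1 ?h2 ?h3 ?h4 ?h5 ?h6 ?h7 ?h8 ?h9 ?b0 ?q0.
  rewrite /= e0 e1; ring.
have Z0 : Z 1%N 0%N = 1.
  by rewrite /Z big_ord1 /D /phi /= !qprod0 !expr0 !(mulr1, invr1).
have Z1 : Z 2%N 1%N = u + u^-1 - (a + b).
  rewrite /Z big_ord_recr big_ord1 /D /phi /= !qprodSr !qprod0 !expr0 !expr1 !mul1r !mulr1.
  have := hq 0%N; have := qprod_neq0W hab 0; rewrite expr0 expr1 mulr1 => h1 h2.
  by field; rewrite ?h1 ?h2 ?u0 ?b0 ?q0 ?oner_neq0.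
suff : asc u a b n = Z n.+1 n /\ asc u a b n.+1 = Z n.+2 n.+1 by case.
elim: n => [|n [IH1 IH2]]; first by rewrite asc0 asc1 Z0 Z1.
by split=> //; rewrite ascSS // IH1 IH2 Zrec // (ZE n.+3 n.+1) // (ZE n.+3 n) //; lia.
Qed.

End QExponential.

Section Convolution.
Variables (F : fieldType) (q : F).
Hypothesis hq : forall n, 1 - q ^+ n.+1 != 0.
Hypothesis q0 : q != 0.
Implicit Types (a b c d e s u v x y z : F).
Local Notation H := (qprod q).
Local Notation P := (qprod q 1).

Definition phi21 x y c z : fps F :=
  fun n => P x n * P y n * z ^+ n / (P q n * P c n).

Let P01 i : P 0 i = 1.
Proof. by rewrite qprod_x0 expr1n. Qed.

Lemma asc_2phi1 u a b : u != 0 -> a != 0 -> b != 0 -> (forall i, P (a * b) i != 0) ->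
  (fun n => asc q u a b n / (P q n * P (a * b) n)) = qI q u * phi21 (a * u) (b * u) (a * b) u^-1.
Proof.
move=> u0 a0 b0 hab; apply/funext => n.
rewrite [qI q u * _]mulrC fps_coefM (asc_3phi2 hq q0) //.
pose f k i := u ^+ (n - k) * u ^- k / P q (n - k) * P (b * u) k / P q k * (u / b) ^+ k
  * (P (q ^- k) i * P (b / u) i * q ^+ i / (P q i * P (a * b) i)).
transitivity (\sum_(k < n.+1) \sum_(i < k.+1) f k i); last first.
  apply: eq_bigr => k _; rewrite -mulr_sumr /phi21 /qI.
  have ab0 : a * b != 0 by rewrite mulf_neq0.
  have bu0 : b / u != 0 by rewrite mulf_neq0 // invr_eq0.
  have h01 : forall i, P 0 i != 0 by move=> i; rewrite P01 oner_neq0.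
  have := @saalschutz_balanced _ q hq q0 (b / u) 0 (a * b) 0 k bu0 ab0 hab (h01 k).
  rewrite !mulr0 !mul0r => /(_ erefl) E.
  have {}E : \sum_(i < k.+1) P (q ^- k) i * P (b / u) i * q ^+ i / (P q i * P (a * b) i)
     = (b / u) ^+ k * P (a * u) k / P (a * b) k.
    have <- : a * b / (b / u) = a * u by field; rewrite u0 b0.
    rewrite -[RHS]mulr1 -[X in _ = _ * X](P01 k).
    rewrite P01 mulr1.
    move: E; rewrite !P01 !mulr1 => <-.
    by apply: eq_bigr => i _; rewrite !P01 !mulr1.
  rewrite E !exprMn !exprVn.
  by field; rewrite ?hab ?(qfact_neq0 hq) ?expf_neq0 ?invr_eq0.
rewrite sum_triangle mulr_sumr mulr_suml; apply: eq_bigr => -[i /=]; rewrite ltnS => lin _.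
pose x := b * u * q ^+ i.
have x0 : x != 0 by rewrite !mulf_neq0 ?expf_neq0.
have h0 : forall i, P (0 * 0) i != 0 by move=> j; rewrite mul0r P01 oner_neq0.
have S := saalschutz hq x 1 (n - i) h0.
have {}S : \sum_(l < (n - i).+1) P x l * x ^- l / (P q l * P q (n - i - l)) = x ^- (n - i) / P q (n - i).
  apply: (mulfI (expf_neq0 (n - i) x0)); rewrite mulr_sumr (reindex_inj rev_ord_inj) /=.
  move: S; rewrite !mul0r !P01 !mul1r mulr1 mulrA mulfV ?expf_neq0 // mul1r => <-.
  apply: eq_bigr => -[l /=]; rewrite ltnS => ll _.
  rewrite subSS subKn // qprod_x0 P01 !mulr1.
  have -> : x ^+ (n - i) = x ^+ l * x ^+ (n - i - l) by rewrite -exprD subnKC.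
  by field; rewrite ?expf_neq0 ?qfact_neq0.
transitivity (u ^+ n / u ^+ i / b ^+ i * P (b * u) i * ((-1) ^+ i * q ^+ 'C(i, 2) / q ^+ (i * i))
  * P (b / u) i * q ^+ i / (P q i * P (a * b) i) * (x ^- (n - i) / P q (n - i))).
  have e2 := qfact_rev hq q0 lin.
  have h1 := qfact_neq0 hq (n - i).
  have -> : P (q ^- n) i = (-1) ^+ i * q ^+ 'C(i, 2) * P q n / (P q (n - i) * q ^+ (n * i)).
    by rewrite -e2; field; rewrite h1 expf_neq0.
  rewrite /x !exprMn -exprM.
  have -> : b ^+ n = b ^+ i * b ^+ (n - i) by rewrite -exprD subnKC.
  have -> : u ^+ n = u ^+ i * u ^+ (n - i) by rewrite -exprD subnKC.
  have -> : q ^+ (n * i) = q ^+ (i * i) * q ^+ (i * (n - i)).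
    by rewrite -exprD -mulnDr subnKC // mulnC.
  have hbn := expf_neq0 (n - i) b0; have hun := expf_neq0 (n - i) u0.
  move: (b ^+ (n - i)) (u ^+ (n - i)) hbn hun => B U B0 U0.
  by field; rewrite ?expf_neq0 ?B0 ?U0 ?h1 ?hab ?qfact_neq0.
rewrite -S mulr_sumr; apply: eq_bigr => -[l /=]; rewrite ltnS => ll _.
rewrite /f subnDA qprodD -/x.
have e2 := qfact_rev hq q0 (leq_addr l i); rewrite addKn in e2.
have h1 := qfact_neq0 hq l; have h2 := qfact_neq0 hq (n - i - l).
have -> : P (q ^- (i + l)) i
   = (-1) ^+ i * q ^+ 'C(i, 2) * P q (i + l) / (P q l * q ^+ ((i + l) * i)).
  by rewrite -e2; field; rewrite h1 expf_neq0.
have -> : u ^+ n = u ^+ (n - i - l) * (u ^+ i * u ^+ l) by rewrite -!exprD; congr (_ ^+ _); lia.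
rewrite /x !exprMn -exprM mulnDl !exprD mulnC !exprVn.
have hun := expf_neq0 (n - i - l) u0.
move: (u ^+ (n - i - l)) hun => U U0.
have h3 := qfact_neq0 hq (i + l).
by field; rewrite ?expf_neq0 ?U0 ?h1 ?h2 ?h3 ?hab ?qfact_neq0.
Qed.

Lemma asc_dual u a b z : u != 0 -> b != 0 -> (forall i, P (a * b) i != 0) ->
  (fun n => (- z * b) ^+ n * q ^+ 'C(n, 2) * asc q u a b n / (P q n * P (a * b) n))
  = qE q z * phi21 (b * u) (b / u) (a * b) z.
Proof.
move=> u0 b0 hab; apply/funext => n.
rewrite [qE q z * _]mulrC fps_coefM (asc_3phi2 hq q0) // !mulr_sumr mulr_suml.
apply: eq_bigr => -[k /=]; rewrite ltnS => lin _.
have e2 := qfact_rev hq q0 lin.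
have h1 := qfact_neq0 hq (n - k).
have -> : P (q ^- n) k = (-1) ^+ k * q ^+ 'C(k, 2) * P q n / (P q (n - k) * q ^+ (n * k)).
  by rewrite -e2; field; rewrite h1 expf_neq0.
rewrite /phi21 /qE [(- z * b) ^+ n]exprMn [(- z) ^+ n]exprNn.
have -> : z ^+ n = z ^+ k * z ^+ (n - k) by rewrite -exprD subnKC.
have -> : (-1) ^+ n = (-1) ^+ k * (-1) ^+ (n - k) :> F by rewrite -exprD subnKC.
have -> : q ^+ 'C(n, 2) = q ^+ 'C(n - k, 2) * q ^+ (n * k) / (q ^+ 'C(k, 2) * q ^+ k).
  apply: (canRL (mulfK _)); first by rewrite mulf_neq0 ?expf_neq0.
  rewrite -!exprD; congr (_ ^+ _); move: (n - k)%N (subnK lin) => m <-.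
  by have := bin2_sqr k; rewrite bin2D; nia.
have -> : (-1) ^+ k * (-1) ^+ (n - k) = ((-1) ^+ k)^-1 * (-1) ^+ (n - k) :> F.
  by rewrite -exprVn invrN1.
have sgn0 : (-1) ^+ k != 0 :> F by rewrite expf_neq0 // oppr_eq0 oner_neq0.
have hb := expf_neq0 n b0.
move: ((-1) ^+ (n - k)) (z ^+ (n - k)) (q ^+ 'C(n - k, 2)) => X Y Z.
by field; rewrite ?sgn0 ?h1 ?hb ?hab ?(qfact_neq0 hq) ?expf_neq0 ?oppr_eq0 ?oner_neq0.
Qed.

Lemma asc_convolution u a b s w : u != 0 -> a != 0 -> b != 0 -> s != 0 -> w != 0 ->
  (forall i, P (a * b) i != 0) -> (forall i, P (s ^+ 2) i != 0) ->
  ((fun n => asc q u a b n / (P q n * P (a * b) n)) : fps F)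
  * (fun n => (- s) ^+ n * q ^+ 'C(n, 2) * asc q w (s * u) (s / u) n / (P q n * P (s ^+ 2) n))
  = phi21 (a * u) (b * u) (a * b) u^-1
    * phi21 (s * w / u) (s / w / u) (s ^+ 2) u.
Proof.
move=> u0 a0 b0 s0 w0 hab hs.
have e : s * u * (s / u) = s ^+ 2 by field.
have := @asc_dual w (s * u) (s / u) u w0.
rewrite e => /(_ _ hs) D.
have -> : (fun n => (- s) ^+ n * q ^+ 'C(n, 2) * asc q w (s * u) (s / u) n / (P q n * P (s ^+ 2) n))
  = qE q u * phi21 (s * w / u) (s / w / u) (s ^+ 2) u.
  have -> : s * w / u = s / u * w by ring.
  have -> : s / w / u = s / u / w by ring.
  rewrite -D; last by rewrite mulf_neq0 ?invr_eq0.
  by have -> : - u * (s / u) = - s by field.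
by rewrite asc_2phi1 // mulrACA [qI q u * _]mulrC (qEI hq) mul1r.
Qed.

Lemma askey_wilson_phi21 u a b c d n :
  u != 0 -> a != 0 -> b != 0 -> c != 0 -> d != 0 ->
  (forall i, P (a * b) i != 0) -> (forall i, P (a * c) i != 0) ->
  (forall i, P (a * d) i != 0) -> (forall i, P (c * d) i != 0) ->
  a ^- n * (P (a * b) n * P (a * c) n * P (a * d) n)
  * \sum_(k < n.+1)
      (P (q ^- n) k * P (a * b * c * d * q ^+ n / q) k * P (a * u) k * P (a / u) k)
      / (P q k * P (a * b) k * P (a * c) k * P (a * d) k) * q ^+ k
  = P q n * P (a * b) n * P (c * d) n
    * (phi21 (a * u) (b * u) (a * b) u^-1 * phi21 (c / u) (d / u) (c * d) u) n.
Proof.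
move=> u0 a0 b0 c0 d0 hab hac had hcd.
have au0 : a * u != 0 by rewrite mulf_neq0.
have a_u0 : a / u != 0 by rewrite mulf_neq0 ?invr_eq0.
have ab0 : a * b != 0 by rewrite mulf_neq0.
have ac0 : a * c != 0 by rewrite mulf_neq0.
have E : a * b * (a * c) * (a * d) * q ^+ n = a * u * (a / u) * (a * b * c * d * q ^+ n / q) * q.
  by field; rewrite q0 u0.
have S := sears hq q0 au0 a_u0 ab0 ac0 hab hac (had n) E.
transitivity (a ^- n * (P (a * b) n * P (a * c) n * P (a * d) n) *
   (P q n * (a * u) ^+ n / (P (a * c) n * P (a * d) n)
    * \sum_(i < n.+1) (-1) ^+ i / ((a * u) ^+ i * q ^+ 'C(i, 2))
        * H (a / u * (a * b * c * d * q ^+ n / q) / (a * b)) (a / u) i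
        * P (a * b / (a / u)) i * P (a * u) i
        * P (a * c / (a * u)) (n - i) * P (a * d / (a * u)) (n - i)
        / (P q i * P (a * b) i * P q (n - i)))).
  rewrite -S; congr (_ * _); apply: eq_bigr => k _.
  by field; rewrite ?hab ?hac ?had ?(qfact_neq0 hq).
have -> : a * b / (a / u) = b * u by field; rewrite a0 u0.
have -> : a * c / (a * u) = c / u by field; rewrite a0 u0.
have -> : a * d / (a * u) = d / u by field; rewrite a0 u0.
rewrite fps_coefM !mulr_sumr; apply: eq_bigr => -[i /=]; rewrite ltnS => lin _.
have -> : H (a / u * (a * b * c * d * q ^+ n / q) / (a * b)) (a / u) i
  = (a / u) ^+ i * ((-1) ^+ i * q ^+ 'C(i, 2) * (P (c * d) n / P (c * d) (n - i))).
  apply: (mulfI (expf_neq0 i q0)).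
  rewrite -qprodZ.
  have -> : q * (a / u * (a * b * c * d * q ^+ n / q) / (a * b))
    = (a / u * (c * d * q ^+ (n - i))) * q ^+ i.
    have -> : q ^+ n = q ^+ (n - i) * q ^+ i by rewrite -exprD subnK.
    by field; rewrite q0 u0 a0 b0.
  rewrite [q * (a / u)]mulrC qprod_rev.
  rewrite -{1}[a / u]mulr1 qprodZ (qprod_split _ 1 (c * d) (leq_subr i n)) subKn //.
  by rewrite bin2S exprD; field; rewrite ?hcd ?u0.
rewrite /phi21 !exprMn !exprVn.
have -> : a ^+ n = a ^+ i * a ^+ (n - i) by rewrite -exprD subnKC.
have -> : u ^+ n = u ^+ i * u ^+ (n - i) by rewrite -exprD subnKC.
have -> : (-1) ^+ i = ((-1) ^+ i)^-1 :> F by rewrite -exprVn invrN1.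
have sgn0 : (-1) ^+ i != 0 :> F by rewrite expf_neq0 // oppr_eq0 oner_neq0.
have := expf_neq0 (n - i) a0; move: (a ^+ (n - i)) (u ^+ (n - i)) => X Y X0.
have sgn2 : ((-1) ^+ i)^-1 = (-1) ^+ i :> F by rewrite -exprVn invrN1.
have sgn3 : (-1) ^+ i * (-1) ^+ i = 1 :> F by rewrite -{1}sgn2 mulVf.
move: ((-1) ^+ i) sgn2 sgn3 sgn0 => sg sgn2 sgn3 sgn0; rewrite sgn2.
transitivity ((sg * sg) * (P q n * P (a * b) n * P (c * d) n *
  (P (a * u) i * P (b * u) i / u ^+ i / (P q i * P (a * b) i) *
   (P (c / u) (n - i) * P (d / u) (n - i) * Y / (P q (n - i) * P (c * d) (n - i))))));
   last by rewrite sgn3 mul1r.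
by field; rewrite ?X0 ?hab ?hac ?had ?hcd ?(qfact_neq0 hq) ?expf_neq0.
Qed.

End Convolution.

(** * Products of two Al-Salam-Chihara polynomials *)

Section Coupling.
Variables (F : fieldType) (q s p : F).
Hypothesis hq : forall n, 1 - q ^+ n.+1 != 0.
Hypothesis q0 : q != 0.
Hypothesis s0 : s != 0.
Hypothesis p0 : p != 0.
Local Notation H := (qprod q).
Local Notation P := (qprod q 1).
Hypothesis hp : forall i, P p i != 0.
Hypothesis hs : forall i, P (s ^+ 2) i != 0.
Hypothesis hk : forall i, P (p * s ^+ 2) i != 0.
Implicit Types (f g : nat -> nat -> F) (k l j n m N : nat).

(* [f k l] is the coordinate on the product of polynomials of degrees k and l; the subscript T
   below marks the adjoints for [pairing]. *)
Definition raise f k l : F :=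
  (if l is l'.+1 then f k l' else 0) + s * q ^+ l * (if k is k'.+1 then f k' l else 0).

Definition lower f k l : F :=
  s * q ^+ l * (1 - q ^+ k.+1) * (1 - p * q ^+ k) * f k.+1 l
  + (1 - q ^+ l.+1) * (1 - s ^+ 2 * q ^+ l) * f k l.+1.

Definition raiseT f k l : F := f k l.+1 + s * q ^+ l * f k.+1 l.

Definition lowerT f k l : F :=
  s * q ^+ l * (1 - q ^+ k) * (1 - p * q ^+ k / q) * f k.-1 l
  + (1 - q ^+ l) * (1 - s ^+ 2 * q ^+ l / q) * f k l.-1.

Definition pairing f g N : F := \sum_(k < N.+1) f k (N - k)%N * g k (N - k)%N.

Lemma pairing_raise f g N : pairing f (raise g) N.+1 = pairing (raiseT f) g N.
Proof.
rewrite /pairing /raise /raiseT.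
under eq_bigr do rewrite mulrDr.
rewrite big_split /= big_ord_recr /= subnn mulr0 addr0.
rewrite [X in _ + X]big_ord_recl /= !mulr0 add0r -big_split.
apply: eq_bigr => -[k /=]; rewrite ltnS => kN _.
by rewrite subSS subSn //; ring.
Qed.

Lemma pairing_lower f g N : pairing f (lower g) N = pairing (lowerT f) g N.+1.
Proof.
rewrite /pairing /lower /lowerT; apply/esym.
under eq_bigr do rewrite mulrDl.
rewrite big_split /= big_ord_recl /= expr0 subrr !(mulr0, mul0r) add0r.
rewrite [X in _ + X]big_ord_recr /= subnn expr0 subrr !mul0r addr0 -big_split.
apply: eq_bigr => -[k /=]; rewrite ltnS => kN _.
rewrite /bump /= add1n subSS subSn //= !exprS.
by field.
Qed.

Lemma pairing_lower0 f g : pairing (lowerT f) g 0 = 0.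
Proof. by rewrite /pairing big_ord1 /lowerT /= !expr0; ring. Qed.

Lemma lower_raise f k l : lower (raise f) k l = q * raise (lower f) k l
  + (1 - q) * (1 - p * s ^+ 2 * q ^+ (k + l) ^+ 2) * f k l.
Proof.
by case: k l => [|k] [|l]; rewrite /lower /raise ?expr0 ?addn0 ?add0n
  ?exprD !exprS; ring.
Qed.

Lemma raise_lin c f k l : raise (fun k l => c * f k l) k l = c * raise f k l.
Proof. by rewrite /raise; case: k => [|k]; case: l => [|l]; ring. Qed.

(* The highest weight vector of degree j, killed by [lower] *)
Definition hwt j k l : F := if (k + l == j)%N then
  (- s) ^+ l * q ^+ 'C(l, 2) / (P q k * P p k * P q l * P (s ^+ 2) l) else 0.

Definition psi j n := iter n raise (hwt j).

Lemma lower_hwt j k l : lower (hwt j) k l = 0.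
Proof.
rewrite /lower /hwt addnS addSn; case: ifP => _; last by rewrite !mulr0 addr0.
rewrite bin2S exprD !qfactS !qprodSr.
have := hq k; have := hq l; have := qprod_neq0W hp k; have := qprod_neq0W hs l.
have := hp k; have := hs l; have := qfact_neq0 hq k; have := qfact_neq0 hq l.
move=> h1 h2 h3 h4 h5 h6 h7 h8.
rewrite !(exprS q) in h7 h8 *; rewrite (exprS (- s)).
by field; rewrite ?h1 ?h2 ?h3 ?h4 ?h5 ?h6 ?h7 ?h8.
Qed.

Lemma psi_supp j n k l : (k + l != j + n)%N -> psi j n k l = 0.
Proof.
elim: n k l => [|n IH] k l h; rewrite /psi /=.
  by rewrite /hwt; rewrite addn0 in h; rewrite (negbTE h).
rewrite -[iter _ _ _]/(psi j n) /raise.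
case: k l h => [|k] [|l] h; rewrite ?IH ?mulr0 ?addr0 //; lia.
Qed.

Definition lcoef j n : F := (1 - q ^+ n) * (1 - p * s ^+ 2 * q ^+ (2 * j) * q ^+ n / q).

Lemma lower_psi j n k l : lower (psi j n) k l = lcoef j n * psi j n.-1 k l.
Proof.
elim: n k l => [|n IH] k l; first by rewrite lower_hwt /lcoef expr0 subrr !mul0r.
rewrite -[psi j n.+1]/(raise (psi j n)) lower_raise.
have [e|e] := eqVneq (k + l)%N (j + n)%N; last first.
  have -> : psi j n k l = 0 by apply: psi_supp.
  rewrite /= ?psi_supp // !mulr0 addr0.
  have -> : lower (psi j n) = fun k l => lcoef j n * psi j n.-1 k l.
    by apply/funext => k1; apply/funext => l1.
  rewrite raise_lin; case: n e {IH} => [|n] e.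
    by rewrite /lcoef expr0 subrr !(mul0r, mulr0).
  by rewrite -[raise _ _ _]/(psi j n.+1 k l) psi_supp ?mulr0.
have -> : lower (psi j n) = fun k l => lcoef j n * psi j n.-1 k l.
  by apply/funext => k1; apply/funext => l1.
rewrite raise_lin e /=.
have -> : lcoef j n * raise (psi j n.-1) k l = lcoef j n * psi j n k l.
  by case: n {IH e} => [|n] //=; rewrite /lcoef expr0 subrr !mul0r.
rewrite /lcoef mul2n -addnn !exprD !exprS; field.
by rewrite q0.
Qed.

Definition hnorm k l : F := P q k * P p k * P q l * P (s ^+ 2) l.

Definition ip f g N : F := pairing (fun k l => hnorm k l * f k l) g N.

Lemma hnorm_neq0 k l : hnorm k l != 0.
Proof. by rewrite /hnorm !mulf_neq0 ?hp ?hs ?(qfact_neq0 hq). Qed.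

Lemma ipC f g N : ip f g N = ip g f N.
Proof. by apply: eq_bigr => k _; ring. Qed.

Lemma ip_raise f g N : ip f (raise g) N.+1 = ip (lower f) g N.
Proof.
rewrite /ip pairing_raise; apply: eq_bigr => k _; congr (_ * _).
by rewrite /raiseT /lower /hnorm !qfactS !qprodSr; ring.
Qed.

Lemma ip_lin c f g N : ip (fun k l => c * f k l) g N = c * ip f g N.
Proof. by rewrite /ip /pairing mulr_sumr; apply: eq_bigr => k _; ring. Qed.

Lemma ip_psiS j n i m N :
  ip (psi j n) (psi i m.+1) N.+1 = lcoef j n * ip (psi j n.-1) (psi i m) N.
Proof.
rewrite -[psi i m.+1]/(raise (psi i m)) ip_raise -ip_lin.
by apply: eq_bigr => k _; rewrite lower_psi.
Qed.

Lemma ip_psi_ortho j n i m : (j + n = i + m)%N -> j <> i ->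
  ip (psi j n) (psi i m) (j + n) = 0.
Proof.
elim: m n => [|m IH] [|n] e ne.
- by case: ne; lia.
- rewrite ipC addnS ip_psiS /lcoef expr0 subrr !mul0r //.
- by rewrite e addnS ip_psiS /lcoef expr0 subrr !mul0r.
by rewrite addnS ip_psiS IH ?mulr0 //; lia.
Qed.

Lemma ip_hwt j : ip (hwt j) (hwt j) j =
  P (p * s ^+ 2 * q ^+ j / q) j / (P q j * P p j * P (s ^+ 2) j).
Proof.
rewrite /ip /pairing.
transitivity (\sum_(k < j.+1) s ^+ (2 * k) * q ^+ (2 * 'C(k, 2))
   / (P q k * P (s ^+ 2) k * P q (j - k) * P p (j - k))).
  rewrite (reindex_inj rev_ord_inj) /=; apply: eq_bigr => -[k /=].
  rewrite ltnS => lin _; rewrite subSS subKn // /hwt /hnorm subnK // eqxx.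
  rewrite !mul2n -!addnn !exprD.
  have -> : s ^+ k = (- 1) ^+ k * (- s) ^+ k by rewrite -exprMn mulN1r opprK.
  have sg : (-1) ^+ k * (-1) ^+ k = 1 :> F by rewrite -exprMn mulrNN mulr1 expr1n.
  have := qfact_neq0 hq k; have := qfact_neq0 hq (j - k); have := hp (j - k).
  have := hs k => h1 h2 h3 h4.
  transitivity ((-1) ^+ k * (-1) ^+ k * ((- s) ^+ k * (- s) ^+ k * (q ^+ 'C(k, 2) * q ^+ 'C(k, 2)) /
  (P q k * P (s ^+ 2) k * P q (j - k) * P p (j - k)))); last by ring.
  rewrite sg mul1r; move: ((- s) ^+ k) => S.
  by field; rewrite h1 h2 h3 h4.
pose X := p * s ^+ 2 * q ^+ j / q.
have hq' i : q ^+ i != 0 by rewrite expf_neq0.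
(* q-Chu-Vandermonde, once (p; q)_(j - k) is written backwards *)
pose y := q / (p * q ^+ j).
have Xy : X * y = s ^+ 2 by rewrite /X /y; field; rewrite p0 q0 hq'.
have hXy i : P (X * y) i != 0 by rewrite Xy.
have := saalschutz hq 0 1 j hXy; rewrite Xy mulr0 !mulr1.
have P01 n : P 0 n = 1 by rewrite qprod_x0 expr1n.
rewrite P01 mulr1 -/X => S.
have -> : P X j / (P q j * P p j * P (s ^+ 2) j)
  = P X j / (P q j * P (s ^+ 2) j) / P p j.
  by field; rewrite ?hp ?hs ?qfact_neq0.
rewrite -S mulr_suml; apply: eq_bigr => -[k /=]; rewrite ltnS => lin _.
rewrite P01 mulr1.
have -> : H 0 X k = (-1) ^+ k * X ^+ k * q ^+ 'C(k, 2).
  elim: k {lin} => [|k IH]; first by rewrite qprod0 !mulr1.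
  by rewrite qprodSr IH bin2S exprD !exprS; ring.
have E : (p * q ^+ j) ^+ k * P y k
    = (-1) ^+ k * q ^+ 'C(k.+1, 2) * P (p * q ^+ (j - k)) k.
  rewrite -qprodZ mulr1; have -> : p * q ^+ j * y = 1 * q by rewrite /y; field; rewrite p0 hq'.
  by rewrite -qprod_rev -mulrA -exprD subnK.
have pk0 : (p * q ^+ j) ^+ k != 0 by rewrite expf_neq0 // mulf_neq0.
have -> : P y k = (-1) ^+ k * q ^+ 'C(k.+1, 2) * P (p * q ^+ (j - k)) k / (p * q ^+ j) ^+ k.
  by rewrite -E [RHS]mulrC mulKf.
rewrite [P p j](qprod_split _ _ _ (leq_subr k j)) subKn //.
have -> : X ^+ k = s ^+ (2 * k) * (p * q ^+ j) ^+ k / q ^+ k.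
  rewrite exprM -!exprMn -exprVn -exprMn; congr (_ ^+ _); rewrite /X; ring.
rewrite bin2S [(2 * 'C(k, 2))%N]mul2n -addnn !(exprD q).
have sg : (-1) ^+ k * (-1) ^+ k = 1 :> F by rewrite -exprMn mulrNN mulr1 expr1n.
have := qfact_neq0 hq k; have := qfact_neq0 hq (j - k); have := hp (j - k).
have := qprod_shift_neq0 (j - k) hp k; have := hs k.
move: ((p * q ^+ j) ^+ k) pk0 => Z Z0 h1 h2 h3 h4 h5.
transitivity ((-1) ^+ k * (-1) ^+ k * (s ^+ (2 * k) * (q ^+ 'C(k, 2) * q ^+ 'C(k, 2))
  / (P q k * P (s ^+ 2) k * P q (j - k) * P p (j - k)))); first by rewrite sg mul1r.
move: (s ^+ (2 * k)) ((-1) ^+ k) => X2 sgn.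
by field; rewrite ?h1 ?h2 ?h3 ?h4 ?h5 ?Z0 ?hq'.
Qed.

Definition psi_norm j n : F :=
  P q n * P (p * s ^+ 2 * q ^+ (2 * j)) n * P (p * s ^+ 2 * q ^+ j / q) j
  / (P q j * P p j * P (s ^+ 2) j).

Lemma psi_norm_neq0 j n : psi_norm j n != 0.
Proof.
rewrite /psi_norm !mulf_neq0 ?invr_eq0 ?mulf_neq0 ?hp ?hs ?(qfact_neq0 hq) //.
  exact: qprod_shift_neq0.
case: j => [|j]; first by rewrite qprod0 oner_neq0.
have -> : p * s ^+ 2 * q ^+ j.+1 / q = p * s ^+ 2 * q ^+ j by rewrite (exprS q j); field.
exact: qprod_shift_neq0.
Qed.

Lemma ip_psi j n : ip (psi j n) (psi j n) (j + n) = psi_norm j n.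
Proof.
elim: n => [|n IH].
  by rewrite addn0 ip_hwt /psi_norm !qprod0 !mul1r.
rewrite addnS ip_psiS IH /psi_norm /lcoef qfactS qprodSr.
have -> : p * s ^+ 2 * q ^+ (2 * j) * q ^+ n.+1 / q = p * s ^+ 2 * q ^+ (2 * j) * q ^+ n.
  by rewrite (exprS q n); field.
ring.
Qed.

Lemma psi_completeness N (f g : nat -> nat -> F) :
  \sum_(k < N.+1) f k (N - k)%N * g k (N - k)%N / hnorm k (N - k)
  = \sum_(j < N.+1) pairing f (psi j (N - j)) N * pairing g (psi j (N - j)) N
       / psi_norm j (N - j).
Proof.
pose A := \matrix_(j < N.+1, k < N.+1)
  ((psi_norm j (N - j))^-1 * psi j (N - j) k (N - k) * hnorm k (N - k)).
pose B := \matrix_(k < N.+1, j < N.+1) psi j (N - j) k (N - k).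
have AB : A *m B = 1%:M.
  apply/matrixP => i j; rewrite !mxE.
  under eq_bigr do rewrite !mxE.
  transitivity ((psi_norm i (N - i))^-1 * ip (psi i (N - i)) (psi j (N - j)) N).
    by rewrite /ip /pairing mulr_sumr; apply: eq_bigr => k _; ring.
  have iN : (i <= N)%N by rewrite -ltnS.
  have jN : (j <= N)%N by rewrite -ltnS.
  have [<-|ne] := eqVneq i j.
    by have := ip_psi i (N - i); rewrite subnKC // => ->; rewrite mulVf ?psi_norm_neq0.
  have := @ip_psi_ortho i (N - i) j (N - j); rewrite !subnKC // => -> //.
    by rewrite mulr0.
  by move=> e; case/eqP: ne; apply: val_inj.
have {AB} BA := mulmx1C AB.
transitivity (\sum_(k < N.+1) \sum_(l < N.+1)
   f k (N - k)%N * g l (N - l)%N / hnorm l (N - l) * (k == l)%:R).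
  apply: eq_bigr => k _; rewrite (bigD1 k) //= eqxx mulr1 big1 ?addr0 // => l ne.
  by rewrite eq_sym (negbTE ne) mulr0.
transitivity (\sum_(k < N.+1) \sum_(l < N.+1) \sum_(j < N.+1)
   f k (N - k)%N * psi j (N - j) k (N - k) * (g l (N - l)%N * psi j (N - j) l (N - l))
     / psi_norm j (N - j)).
  apply: eq_bigr => k _; apply: eq_bigr => l _.
  have := congr1 (fun M : 'M[F]_N.+1 => M k l) BA; rewrite !mxE => <-.
  rewrite mulr_sumr; apply: eq_bigr => j _; rewrite !mxE.
  by field; rewrite hnorm_neq0 psi_norm_neq0.
rewrite exchange_big /=.
under eq_bigr do rewrite exchange_big /=.
rewrite exchange_big /=; apply: eq_bigr => j _.
rewrite /pairing mulr_suml mulr_suml exchange_big /=.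
by apply: eq_bigr => k _; rewrite mulr_sumr mulr_suml.
Qed.

Section Eigenvector.
Variables (a b u w : F).
Hypothesis u0 : u != 0.
Hypothesis w0 : w != 0.
Hypothesis ab : a * b = p.

Definition ascF k l : F := asc q u a b k * asc q w (s * u) (s / u) l.

Lemma ascF_eigen k l : (w + w^-1) * ascF k l
  = raiseT ascF k l + s * (a + b) * q ^+ (k + l) * ascF k l + lowerT ascF k l.
Proof.
rewrite /ascF mulrCA (asc_rec hq q0) // mulrDr mulrDr.
have e : s * u * (s / u) = s ^+ 2 by field.
rewrite e /raiseT /lowerT.
have E : asc q u a b k.+1 = (u + u^-1) * asc q u a b k - (a + b) * q ^+ k * asc q u a b k
  - (1 - q ^+ k) * (1 - p * q ^+ k / q) * asc q u a b k.-1.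
  by rewrite (asc_rec hq q0) // ab; ring.
by rewrite E exprD; ring.
Qed.

Lemma pairing_eigen f N : (w + w^-1) * pairing ascF f N
  = pairing ascF (raise f) N.+1 + s * (a + b) * q ^+ N * pairing ascF f N
    + pairing (lowerT ascF) f N.
Proof.
rewrite pairing_raise /pairing !mulr_sumr -!big_split.
apply: eq_bigr => -[k /=]; rewrite ltnS => kN _.
by rewrite mulrA ascF_eigen subnKC //; ring.
Qed.

Lemma pairing_psi j n : pairing ascF (psi j n) (j + n)
  = asc q w (a * s * q ^+ j) (b * s * q ^+ j) n * pairing ascF (hwt j) j.
Proof.
have rec m : pairing ascF (psi j m.+1) (j + m.+1) =
  (w + w^-1 - s * (a + b) * q ^+ (j + m)) * pairing ascF (psi j m) (j + m)
  - lcoef j m * pairing ascF (psi j m.-1) (j + m.-1).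
  have := pairing_eigen (psi j m) (j + m); rewrite -addnS -[raise _]/(psi j m.+1) => E.
  have -> : lcoef j m * pairing ascF (psi j m.-1) (j + m.-1)
     = pairing (lowerT ascF) (psi j m) (j + m).
    case: m {E} => [|m].
      rewrite /lcoef expr0 subrr !mul0r addn0; case: j => [|i].
        by rewrite pairing_lower0.
      rewrite -pairing_lower /pairing big1 // => k _.
      by rewrite lower_psi /lcoef expr0 subrr !mul0r mulr0.
    rewrite addnS -pairing_lower /pairing mulr_sumr; apply: eq_bigr => k _.
    by rewrite lower_psi /=; ring.
  rewrite mulrBl E; ring.
pose A m := asc q w (a * s * q ^+ j) (b * s * q ^+ j) m.
suff : pairing ascF (psi j n) (j + n) = A n * pairing ascF (hwt j) j /\ pairing ascF (psi j n.+1) (j + n.+1) = A n.+1 * pairing ascF (hwt j) j by case.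
elim: n => [|n [IH1 IH2]].
  rewrite rec addn0 /lcoef expr0 subrr !mul0r subr0 /A asc0 (asc1 hq) mul1r.
  by split=> //; congr (_ * _); ring.
split=> //; rewrite rec IH1 IH2 /A [asc _ _ _ _ n.+2](ascSS hq) // /lcoef.
rewrite mul2n -addnn !exprD !exprS /= -ab; field.
by rewrite w0 q0.
Qed.

Lemma pairing_hwt j : pairing ascF (hwt j) j =
  (((fun n => asc q u a b n / (P q n * P p n)) : fps F)
  * (fun n => (- s) ^+ n * q ^+ 'C(n, 2) * asc q w (s * u) (s / u) n
        / (P q n * P (s ^+ 2) n))) j.
Proof.
rewrite fps_coefM; apply: eq_bigr => -[k /=]; rewrite ltnS => kj _.
rewrite /hwt subnKC // eqxx /ascF.
by field; rewrite ?hp ?hs ?(qfact_neq0 hq).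
Qed.

End Eigenvector.

End Coupling.

Section BilinearSum.
Variables (F : fieldType) (q : F).
Hypothesis hq : forall n, 1 - q ^+ n.+1 != 0.
Hypothesis q0 : q != 0.
Local Notation P := (qprod q 1).

(* Non-symmetric Poisson kernel of the Al-Salam-Chihara polynomials, as a power series in t *)
Definition asc_kernel (u v a b a' b' : F) : fps F :=
  fun n => asc q u a b n * asc q v a' b' n / (P q n * P (a * b) n).

Definition aw_conv (u a b c d : F) : fps F :=
  phi21 q (a * u) (b * u) (a * b) u^-1 * phi21 q (c / u) (d / u) (c * d) u.

Definition aw_weight (p r : F) j : F :=
  P q j * P p j * P r j / P (p * r * q ^+ j / q) j.

Lemma kernel_product (u v s w w' a b a' b' : F) :
  u != 0 -> v != 0 -> s != 0 -> w != 0 -> w' != 0 ->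
  a != 0 -> b != 0 -> a' != 0 -> b' != 0 -> a * b = a' * b' ->
  (forall i, P (a * b) i != 0) -> (forall i, P (s ^+ 2) i != 0) ->
  (forall i, P (a * b * s ^+ 2) i != 0) ->
  asc_kernel u v a b a' b' * asc_kernel w w' (s * u) (s / u) (s * v) (s / v)
  = tsum (fun j => fpsC (aw_weight (a * b) (s ^+ 2) j
        * aw_conv u a b (s * w) (s / w) j * aw_conv v a' b' (s * w') (s / w') j)
      * asc_kernel w w' (a * s * q ^+ j) (b * s * q ^+ j) (a' * s * q ^+ j) (b' * s * q ^+ j)).
Proof.
move=> u0 v0 s0 w0 w'0 a0 b0 a'0 b'0 e hab hs hk; apply/funext => N.
have ab0 : a * b != 0 by rewrite mulf_neq0.
have ess : s * u * (s / u) = s ^+ 2 by field.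
rewrite fps_coefM /tsum.
transitivity (\sum_(k < N.+1) ascF q s a b u w k (N - k) * ascF q s a' b' v w' k (N - k)
   / hnorm q s (a * b) k (N - k)).
  apply: eq_bigr => k _; rewrite /ascF /hnorm /asc_kernel ess.
  by field; rewrite ?hab ?hs ?(qfact_neq0 hq).
rewrite (psi_completeness hq q0 s0 ab0 hab hs hk N (ascF q s a b u w) (ascF q s a' b' v w')).
apply: eq_bigr => -[j /=]; rewrite ltnS => jN _.
have hw (u1 w1 a1 b1 : F) : u1 != 0 -> w1 != 0 -> a1 != 0 -> b1 != 0 -> a1 * b1 = a * b ->
   pairing (ascF q s a1 b1 u1 w1) (psi q s (a * b) j (N - j)) N
   = asc q w1 (a1 * s * q ^+ j) (b1 * s * q ^+ j) (N - j)
     * aw_conv u1 a1 b1 (s * w1) (s / w1) j.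
  move=> u10 w10 a10 b10 e1.
  have := @pairing_psi _ q s (a * b) hq q0 s0 ab0 hab hs a1 b1 u1 w1 u10 w10 e1 j (N - j).
  rewrite subnKC // => ->; rewrite pairing_hwt // -e1 asc_convolution //.
    rewrite /aw_conv; have -> // : s * w1 * (s / w1) = s ^+ 2 by field.
  by rewrite e1.
rewrite !hw // fps_coefCM /asc_kernel /psi_norm /aw_weight.
have -> : a * s * q ^+ j * (b * s * q ^+ j) = a * b * s ^+ 2 * q ^+ (2 * j).
  by rewrite mul2n -addnn exprD; ring.
have h1 := qprod_shift_neq0 (2 * j) hk (N - j).
have h2 : P (a * b * s ^+ 2 * q ^+ j / q) j != 0.
  case: (j) => [|i]; first by rewrite qprod0 oner_neq0.
  have -> : a * b * s ^+ 2 * q ^+ i.+1 / q = a * b * s ^+ 2 * q ^+ i by rewrite (exprS q i); field.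
  exact: qprod_shift_neq0.
by field; rewrite ?h1 ?h2 ?hab ?hs ?(qfact_neq0 hq).
Qed.

End BilinearSum.

(** * The Poisson kernel *)

Section PoissonPolynomial.
Variables (F : fieldType) (q : F).
Hypothesis hq : forall n, 1 - q ^+ n.+1 != 0.
Hypothesis q0 : q != 0.
Local Notation H := (qprod q).
Local Notation P := (qprod q 1).

Definition kap (a b u : F) m i : F :=
  P q m * P (a * u) i * P (b / u) (m - i)
  / (P q i * P q (m - i) * P (a * b) m * (u ^+ i * u ^+ i * q ^+ (m * i))).

Section AtNode.
Variables (a b a' b' u v t : F) (m : nat).
Hypotheses (a0 : a != 0) (b0 : b != 0) (a'0 : a' != 0) (b'0 : b' != 0) (v0 : v != 0) (t0 : t != 0).
Hypothesis u0 : u != 0.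
Hypothesis bu : b * u * q ^+ m = 1.
Hypothesis e : a * b = a' * b'.
Hypothesis hab : forall i, P (a * b) i != 0.
Hypothesis hu2 : P (q * u ^+ 2) m != 0.
Hypothesis h1 : forall i, P (b' * u * t) i != 0.
Hypothesis h2 : forall i, P (a' * u * t) i != 0.
Hypothesis h3 : forall i, P (b * v * t) i != 0.
Hypothesis h4 : forall i, P (b / v * t) i != 0.
Hypothesis h5 : forall i, P (b * b' * t) i != 0.
Hypothesis h6 : 1 - b * b' * t / q != 0.

Let mid := P q m * P (b' * u * t) m * \sum_(k < m.+1)
  P (b' * v) k * P (b' / v) k * P (a * u) k * P (b * t / b') (m - k) * (b * t / b') ^+ k
  / (P q (m - k) * P q k * P (a * b) k * P (b' * u * t) k).

Lemma node_watson : \sum_(k < m.+1)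
   P (b * u) k * P (b / u) k * P (b' * v) k * P (b' / v) k / (P q k * P (a * b) k)
   * (a' / b) ^+ k * t ^+ k
   * (P (b' * u * q ^+ k * t) (m - k) * P (b * v * q ^+ k * t) (m - k)
      * P (b / v * q ^+ k * t) (m - k) * P (b / a' * t) k)
   * (P (b * b' * t / q) k * (1 - b * b' * t / q * q ^+ (k + k)) / (1 - b * b' * t / q)
      / P (b * b' * t) (m + k)) = mid.
Proof.
pose A := b * b' * t / q.
have Aq : A * q = b * b' * t by rewrite /A divfK.
have hA i : P (A * q) i != 0 by rewrite Aq.
have eb' : b' = a * b / a' by rewrite e; field.
have E1 : b / u * (b / a' * t) * (a * u) = A * q.
  by rewrite Aq eb'; field; rewrite u0 a'0.
have E2 : b' * v * (b' / v) * (b * t / b') = A * q.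
  by rewrite Aq; field; rewrite v0 b'0.
have bg : b / u * (a * u) = a * b by field.
have cg : b / a' * t * (a * u) = b' * u * t.
  by rewrite eb'; field.
have dh : b' * v * (b * t / b') = b * v * t by field.
have eh : b' / v * (b * t / b') = b / v * t by field; rewrite v0 b'0.
have := @watson _ q hq q0 A h6 hA (b / u) (b / a' * t) (b' * v) (b' / v) (a * u) (b * t / b') m E1 E2.
rewrite bg cg dh eh => /(_ hab h1 h3 h4) W.
transitivity (P q m * P (b' * u * t) m * (P (b * v * t) m * P (b / v * t) m) *
  \sum_(r < m.+1)
      P A r * (1 - A * q ^+ (r + r)) / (1 - A) * ((-1) ^+ r * q ^+ 'C(r, 2)) / P q r *
      (P (b / u) r * P (b / a' * t) r * (a * u) ^+ r / (P (a * b) r * P (b' * u * t) r)) *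
      (P (b' * v) r * P (b' / v) r * (b * t / b') ^+ r /
       (P (b * v * t) r * P (b / v * t) r)) / (P q (m - r) * P (A * q) (m + r))); last first.
  rewrite W /mid -!mulrA; congr (_ * (_ * _)); rewrite !mulr_sumr.
  apply: eq_bigr => k _.
  by field; rewrite !mulrA ?hab ?h1 ?h3 ?h4 ?qfact_neq0 ?b'0.
rewrite mulr_sumr; apply: eq_bigr => -[k /=]; rewrite ltnS => lin _.
have r2 := qfact_rev hq q0 lin.
have bu' : b * u = q ^- m.
  by apply: (mulIf (expf_neq0 m q0)); rewrite bu mulVf ?expf_neq0.
have -> : P (b * u) k = (-1) ^+ k * q ^+ 'C(k, 2) * P q m / (P q (m - k) * q ^+ (m * k)).
  by rewrite bu' -r2; field; rewrite qfact_neq0 // expf_neq0.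
rewrite (qprod_split _ _ (b' * u * t) lin) (qprod_split _ _ (b * v * t) lin).
rewrite (qprod_split _ _ (b / v * t) lin) ![_ * t * q ^+ k]mulrAC Aq -/A.
have -> : (a' / b) ^+ k = q ^+ (m * k) * ((a * u) ^+ k * (b * t / b') ^+ k) / t ^+ k.
  rewrite exprM -exprVn -!exprMn; congr (_ ^+ _).
  have -> : q ^+ m = (b * u)^-1 by rewrite bu' invrK.
  have -> : a' = a * b / b' by rewrite e; field.
  by field; rewrite b0 u0 b'0 t0.
have n1 := qfact_neq0 hq k; have n2 := qfact_neq0 hq (m - k).
have n3 := expf_neq0 (m * k) q0; have n4 := expf_neq0 k t0.
have n5 := h5 (m + k); have n6 : 1 - A != 0 by [].
have n7 := h1 k; have n8 := h3 k; have n9 := h4 k; have n10 := hab k.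
by field; rewrite ?n1 ?n2 ?n3 ?n4 ?n5 ?n6 ?n7 ?n8 ?n9 ?n10.
Qed.

Lemma node_sears : \sum_(i < m.+1) kap a b u m i
   * (P (u * v * t) i * P (u / v * t) i
      * P (a' * u * q ^+ i * t) (m - i) * P (b' * u * q ^+ i * t) (m - i)) = mid.
Proof.
have au0 : a * u != 0 by rewrite mulf_neq0.
have uvt0 : u * v * t != 0 by rewrite !mulf_neq0.
have but0 : b' * u * t != 0 by rewrite !mulf_neq0.
have aut0 : a' * u * t != 0 by rewrite !mulf_neq0.
have E : b' * u * t * (a' * u * t) * (q * u ^+ 2) * q ^+ m
   = a * u * (u * v * t) * (u / v * t) * q.
  have -> : b' * u * t * (a' * u * t) * (q * u ^+ 2) * q ^+ m
    = a' * b' * (u ^+ 2 * t ^+ 2 * q * u) * (u * q ^+ m) by ring.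
  have -> : u * q ^+ m = b^-1 by rewrite -[RHS]mul1r -bu; field.
  by rewrite -e; field; rewrite v0 b0.
have S := sears hq q0 au0 uvt0 but0 aut0 h1 h2 hu2 E.
have bu' : b * u = q ^- m.
  by apply: (mulIf (expf_neq0 m q0)); rewrite bu mulVf ?expf_neq0.
have qm0 := expf_neq0 m q0.
pose K := (-1) ^+ m * P (q * u ^+ 2) m * P (a' * u * t) m * P (b' * u * t) m
   / (P (a * b) m * u ^+ m * u ^+ m * q ^+ 'C(m.+1, 2)).
transitivity (K * \sum_(k < m.+1)
       P (q ^- m) k * P (a * u) k * P (u * v * t) k * P (u / v * t) k * q ^+ k /
       (P q k * P (b' * u * t) k * P (a' * u * t) k * P (q * u ^+ 2) k)).
  rewrite mulr_sumr; apply: eq_bigr => -[k /=]; rewrite ltnS => lin _.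
  have r2 := qfact_rev hq q0 lin.
  have -> : P (q ^- m) k = (-1) ^+ k * q ^+ 'C(k, 2) * P q m / (P q (m - k) * q ^+ (m * k)).
    by rewrite -r2; field; rewrite qfact_neq0 // expf_neq0.
  have r3 : P (b / u) (m - k) * (u ^+ (m - k) * u ^+ (m - k)) * q ^+ (m * (m - k))
    = (-1) ^+ (m - k) * q ^+ 'C(m - k, 2) * P (q * u ^+ 2 * q ^+ k) (m - k).
    have -> : P (b / u) (m - k) * (u ^+ (m - k) * u ^+ (m - k)) * q ^+ (m * (m - k))
      = H (u ^+ 2 * q ^+ m) 1 (m - k).
      transitivity ((u ^+ 2 * q ^+ m) ^+ (m - k) * P (b / u) (m - k)).
        by rewrite exprMn expr2 exprMn -exprM; ring.
      rewrite -qprodZ mulr1; congr (qprod _ _ _ _).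
      have -> : b / u = (b * u * q ^+ m) / (u ^+ 2 * q ^+ m).
        by field; rewrite u0 expf_neq0.
      by rewrite bu mul1r mulfV // mulf_neq0 ?expf_neq0.
    apply: (mulfI (expf_neq0 (m - k) q0)); rewrite -qprodZ mulr1.
    have -> : q * (u ^+ 2 * q ^+ m) = q * u ^+ 2 * q ^+ k * q ^+ (m - k).
      by rewrite -[q ^+ m](congr1 (fun n => q ^+ n) (subnKC lin)) exprD; ring.
    transitivity (H (q * u ^+ 2 * q ^+ k * q ^+ (m - k)) (1 * q) (m - k)); first by rewrite mul1r.
    by rewrite qprod_rev bin2S exprD; ring.
  rewrite /kap /K.
  have -> : P (b / u) (m - k) = (-1) ^+ (m - k) * q ^+ 'C(m - k, 2) * P (q * u ^+ 2 * q ^+ k) (m - k)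
     / (u ^+ (m - k) * u ^+ (m - k) * q ^+ (m * (m - k))).
    by rewrite -r3; field; rewrite !expf_neq0.
  rewrite (qprod_split _ _ (b' * u * t) lin) (qprod_split _ _ (a' * u * t) lin).
  rewrite (qprod_split _ _ (q * u ^+ 2) lin) ![_ * t * q ^+ k]mulrAC.
  have -> : (-1) ^+ m = ((-1) ^+ k)^-1 * (-1) ^+ (m - k) :> F.
    by rewrite -exprVn invrN1 -exprD subnKC.
  have sgn0 : (-1) ^+ k != 0 :> F by rewrite expf_neq0 // oppr_eq0 oner_neq0.
  have -> : u ^+ m = u ^+ k * u ^+ (m - k) by rewrite -exprD subnKC.
  have -> : q ^+ 'C(m.+1, 2) = q ^+ (m * (m - k)) * q ^+ 'C(k, 2) * q ^+ k / q ^+ 'C(m - k, 2).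
    apply: (canRL (mulfK _)); first by rewrite expf_neq0.
    rewrite -!exprD; congr (_ ^+ _); rewrite -{1 3}(subnK lin).
    exact: bin2_compl.
  have n1 := qfact_neq0 hq k; have n2 := qfact_neq0 hq (m - k).
  have n3 := expf_neq0 (m * k) q0; have n4 := expf_neq0 k q0.
  have n5 := h1 k; have n6 := h2 k; have n7 := hab m.
  have n8 := expf_neq0 k u0; have n9 := expf_neq0 (m - k) u0.
  have n10 := expf_neq0 (m * (m - k)) q0; have n11 := expf_neq0 'C(k, 2) q0.
  have n12 := expf_neq0 'C(m - k, 2) q0.
  have n13 : P (q * u ^+ 2) k != 0.
    by apply: contraNneq hu2 => e1; rewrite (qprod_split _ _ _ lin) e1 mul0r.
  move: (P (q * u ^+ 2) k) n13 => X13 n13.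
  move: (P (b' * u * t) k) n5 (P (a' * u * t) k) n6 => X5 n5 X6 n6.
  move: ((-1) ^+ k) sgn0 ((-1) ^+ (m - k)) (u ^+ (m - k)) n9 (q ^+ (m * (m - k))) n10
    (q ^+ 'C(m - k, 2)) n12 => X7 n14 X9 X15 n9 X10 n10 X12 n12.
  field.
  by rewrite ?n1 ?n2 ?n3 ?n4 ?n5 ?n6 ?n7 ?n8 ?n9 ?n10 ?n11 ?n12 ?n13 ?n14.
rewrite S /mid /K !mulr_sumr; apply: eq_bigr => -[k /=]; rewrite ltnS => lin _.
have -> : u * v * t * (u / v * t) / (b' * u * t) = u * t / b'.
  by field; rewrite b'0 u0 t0 v0.
have -> : b' * u * t / (u * v * t) = b' / v by field; rewrite u0 t0 v0.
have -> : a' * u * t / (a * u) = b * t / b'.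
  by have -> : a' = a * b / b' by [rewrite e; field]; field; rewrite a0 u0 b'0.
have -> : H (u * t / b') (u * v * t) k = (u * t / b') ^+ k * P (b' * v) k.
  by rewrite -qprodZ mulr1; congr (qprod _ _ _ _); field.
have r4 : P (q * u ^+ 2 / (a * u)) (m - k) * ((a * b) ^+ (m - k) * q ^+ (m * (m - k)))
  = (-1) ^+ (m - k) * q ^+ 'C((m - k).+1, 2) * P (a * b * q ^+ k) (m - k).
  rewrite exprM -exprMn mulrC -qprodZ mulr1.
  have -> : a * b * q ^+ m = a * b * q ^+ k * q ^+ (m - k).
    by rewrite -[RHS]mulrA -exprD subnKC.
  have -> : a * b * q ^+ k * q ^+ (m - k) * (q * u ^+ 2 / (a * u)) = 1 * q.
    rewrite -[_ * q ^+ (m - k)]mulrA -exprD subnKC //.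
    transitivity (b * u * q ^+ m * q); first by field; rewrite a0 u0.
    by rewrite bu.
  by rewrite qprod_rev.
have -> : P (q * u ^+ 2 / (a * u)) (m - k) =
  (-1) ^+ (m - k) * q ^+ 'C((m - k).+1, 2) * (P (a * b) m / P (a * b) k)
   / ((a * b) ^+ (m - k) * q ^+ (m * (m - k))).
  rewrite (qprod_split _ _ (a * b) lin) [P _ k * _]mulrC mulfK //.
  by rewrite -r4 mulfK // !mulf_neq0 ?expf_neq0 ?mulf_neq0.
have -> : (-1) ^+ m = (-1) ^+ k * (-1) ^+ (m - k) :> F by rewrite -exprD subnKC.
have sg : (-1) ^+ k * (-1) ^+ k = 1 :> F by rewrite -exprMn mulrNN mulr1 expr1n.
have sg' : (-1) ^+ (m - k) * (-1) ^+ (m - k) = 1 :> F by rewrite -exprMn mulrNN mulr1 expr1n.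
have -> : (b * t / b') ^+ k = (u * t / b') ^+ k * b ^+ k / u ^+ k.
  by rewrite -exprVn -!exprMn; congr (_ ^+ _); field; rewrite b'0 u0.
rewrite !exprMn.
have -> : a ^+ m = a ^+ k * a ^+ (m - k) by rewrite -exprD subnKC.
have -> : b ^+ (m - k) = b ^+ m / b ^+ k.
  by rewrite -[in b ^+ m](subnKC lin) exprD mulrC mulKf // expf_neq0.
have ub : u = (b * q ^+ m)^-1.
  by rewrite -[RHS]mul1r -bu; field; rewrite b0 expf_neq0.
have -> : u ^+ m = (b ^+ m)^-1 / q ^+ (m * m) by rewrite {1}ub exprVn exprMn -exprM invfM.
have qe : q ^+ 'C(m.+1, 2) = q ^+ (m * m) * q ^+ 'C((m - k).+1, 2)
   / (q ^+ 'C(k, 2) * q ^+ (m * (m - k))).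
  apply: (canRL (mulfK _)); first by rewrite mulf_neq0 ?expf_neq0.
  by rewrite mulrA -!exprD; have := bin2_compl_sqr k (m - k); rewrite subnK // => ->.
rewrite qe.
transitivity ((-1) ^+ k * (-1) ^+ k * ((-1) ^+ (m - k) * (-1) ^+ (m - k)) *
  (P q m * P (b' * u * t) m *
  (P (b' * v) k * P (b' / v) k * P (a * u) k * P (b * t / b') (m - k) *
   (u ^+ k * t ^+ k * b'^-1 ^+ k * b ^+ k / u ^+ k) /
   (P q (m - k) * P q k * P (a * b) k * P (b' * u * t) k)))); last by rewrite sg sg' !mul1r.
have n1 := qfact_neq0 hq k; have n2 := qfact_neq0 hq (m - k).
have n3 := expf_neq0 (m * m) q0; have n4 := expf_neq0 (m * (m - k)) q0.
have n5 := h1 k; have n6 := h2 m; have n7 := hab m; have n7' := hab k.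
have n8 := expf_neq0 k u0; have n9 := expf_neq0 m b0.
have n10 := expf_neq0 'C(k, 2) q0; have n11 := expf_neq0 'C((m - k).+1, 2) q0.
have n12 := expf_neq0 k a0; have n13 := expf_neq0 (m - k) a0; have n14 := expf_neq0 k b0.
move: (P (q * u ^+ 2) m) hu2 (P (b' * u * t) k) n5 (P (a' * u * t) m) n6
  (q ^+ (m * m)) n3 (q ^+ (m * (m - k))) n4 (b ^+ m) n9 (u ^+ k) n8
  (q ^+ 'C(k, 2)) n10 (q ^+ 'C((m - k).+1, 2)) n11 (a ^+ k) n12 (a ^+ (m - k)) n13
  (b ^+ k) n14 (b'^-1 ^+ k) (t ^+ k) ((-1) ^+ k) ((-1) ^+ (m - k)).
move=> Y1 m1 Y2 m2 Y3 m3 Y4 m4 Y5 m5 Y6 m6 Y7 m7 Y8 m8 Y9 m9 Y10 m10 Y11 m11 Y12 m12 *.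
by field; rewrite ?n1 ?n2 ?n7 ?n7' ?m1 ?m2 ?m3 ?m4 ?m5 ?m6 ?m7 ?m8 ?m9 ?m10 ?m11 ?m12.
Qed.

Lemma node_identity : \sum_(i < m.+1) kap a b u m i
   * (P (u * v * t) i * P (u / v * t) i
      * P (a' * u * q ^+ i * t) (m - i) * P (b' * u * q ^+ i * t) (m - i))
  = \sum_(k < m.+1)
   P (b * u) k * P (b / u) k * P (b' * v) k * P (b' / v) k / (P q k * P (a * b) k)
   * (a' / b) ^+ k * t ^+ k
   * (P (b' * u * q ^+ k * t) (m - k) * P (b * v * q ^+ k * t) (m - k)
      * P (b / v * q ^+ k * t) (m - k) * P (b / a' * t) k)
   * (P (b * b' * t / q) k * (1 - b * b' * t / q * q ^+ (k + k)) / (1 - b * b' * t / q)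
      / P (b * b' * t) (m + k)).
Proof. by rewrite node_sears node_watson. Qed.

End AtNode.
End PoissonPolynomial.

Section PolynomialSeries.
Variables (F : fieldType) (q : F).
Hypothesis hq : forall n, 1 - q ^+ n.+1 != 0.
Hypothesis q0 : q != 0.
Local Notation P := (qprod q 1).
Implicit Types (p r : {poly F}) (al : F).

Definition fpsP p : fps F := fun n => p`_n.

Lemma fpsPM p r : fpsP (p * r) = fpsP p * fpsP r.
Proof. by apply/funext => n; rewrite /fpsP coefM. Qed.

Lemma fpsP1 : fpsP 1 = 1.
Proof. by apply/funext => n; rewrite /fpsP coef1. Qed.

Lemma fpsPC c : fpsP c%:P = fpsC c.
Proof. by apply/funext => -[|n]; rewrite /fpsP coefC. Qed.

Lemma fpsP_sum n (f : 'I_n -> {poly F}) : fpsP (\sum_i f i) = \sum_i fpsP (f i).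
Proof. by apply/funext => k; rewrite fps_coef_sum /fpsP coef_sum. Qed.

Lemma fpsL_poly al : fpsL al = fpsP (1 - al *: 'X).
Proof.
apply/funext => -[|[|n]]; rewrite /fpsP coefB coefZ coefX coef1 /=.
- by rewrite mulr0 subr0.
- by rewrite mulr1 sub0r.
- by rewrite mulr0 subr0.
Qed.

Lemma fps_coefXnM k (f : fps F) n :
  (fpsP 'X^k * f) n = if (k <= n)%N then f (n - k)%N else 0.
Proof.
rewrite fps_coefM; case: leqP => kn.
  have kn' : (k < n.+1)%N by [].
  rewrite (bigD1 (Ordinal kn')) //= /fpsP coefXn eqxx mul1r big1 ?addr0 // => i ne.
  rewrite coefXn; case: eqP => [e|]; last by rewrite mul0r.
  by case/eqP: ne; apply: val_inj.
rewrite big1 // => i _; rewrite /fpsP coefXn.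
by case: eqP => [e|]; rewrite ?mul0r //; have := ltn_ord i; rewrite ltnS leqNgt e kn.
Qed.

Lemma tsum_finite m (G : nat -> fps F) : (forall k, (m < k)%N -> G k = 0) ->
  tsum G = \sum_(k < m.+1) fpsP 'X^k * G k.
Proof.
move=> hG; apply/funext => n; rewrite fps_coef_sum /tsum.
pose f k : F := if (k <= n)%N then G k (n - k)%N else 0.
transitivity (\sum_(k < (n + m).+1) f k).
  rewrite (big_ord_widen_cond (n + m).+1 predT (fun k => G k (n - k)%N)) ?ltnS ?leq_addr //.
  rewrite big_mkcond /=; apply: eq_bigr => k _.
  by rewrite /f ltnS.
transitivity (\sum_(k < m.+1) f k); last first.
  by apply: eq_bigr => k _; rewrite fps_coefXnM.
rewrite [RHS](big_ord_widen_cond (n + m).+1 predT f) ?ltnS ?leq_addl //.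
rewrite [RHS]big_mkcond /=; apply: eq_bigr => k _.
by rewrite ltnS; case: leqP => // mk; rewrite /f hG // if_same.
Qed.

Definition qX al n : {poly F} := \prod_(i < n) (1 - (al * q ^+ i) *: 'X).

Lemma qX0 al : qX al 0 = 1.
Proof. by rewrite /qX big_ord0. Qed.

Lemma qX_eval al n t : (qX al n).[t] = P (al * t) n.
Proof.
rewrite /qX horner_prod; apply: eq_bigr => i _.
by rewrite hornerD hornerN hornerZ hornerC hornerX; congr (1 - _); ring.
Qed.

Lemma qXD al m n : qX al (m + n) = qX al m * qX (al * q ^+ m) n.
Proof.
rewrite /qX big_split_ord; congr (_ * _); apply: eq_bigr => i _.
by rewrite exprD mulrA.
Qed.

Lemma qE_split al n : qE q al = fpsP (qX al n) * qE q (al * q ^+ n).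
Proof.
elim: n => [|n IH]; first by rewrite qX0 fpsP1 mul1r mulr1.
rewrite IH (qE_rec hq (al * q ^+ n)) /qX big_ord_recr /= -/(qX al n) fpsPM fpsL_poly.
rewrite -mulrA; congr (_ * (_ * qE q _)).
by rewrite exprS; ring.
Qed.

Lemma qX_cancel al n (f g : fps F) : fpsP (qX al n) * f = fpsP (qX al n) * g -> f = g.
Proof.
move=> h; have e : qI q al * qE q (al * q ^+ n) * fpsP (qX al n) = 1.
  by rewrite -(qEI hq al) (qE_split al n); ring.
by rewrite -[f]mul1r -[g]mul1r -e -!mulrA h.
Qed.

Lemma expq_inj i j : q ^+ i = q ^+ j -> i = j.
Proof.
wlog lij : i j / (i < j)%N => [hw|].
  by case: (ltngtP i j) => // h e; [exact: hw|apply/esym/hw].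
move=> /eqP; rewrite -subr_eq0 -(subnKC lij) addSnnS exprD -{1}[q ^+ i]mulr1 -mulrBr.
by rewrite mulf_eq0 (negbTE (hq _)) expf_eq0 (negbTE q0) andbF.
Qed.

Lemma poly_eq_on (x : nat -> F) p r : injective x ->
  (forall n, p.[x n] = r.[x n]) -> p = r.
Proof.
move=> xinj h; apply/eqP; rewrite -subr_eq0; apply/negPn/negP => ne.
pose d := p - r; pose rs := [seq x i | i <- iota 0 (size d)].
have : (size rs < size d)%N.
  apply: max_poly_roots => //.
    by apply/allP => z /mapP [i _ ->]; rewrite rootE hornerD hornerN h subrr.
  by rewrite map_inj_uniq ?iota_uniq.
by rewrite size_map size_iota ltnn.
Qed.

Lemma eventually_neq al : exists n0, forall n, (n0 <= n)%N -> 1 - al * q ^+ n != 0.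
Proof.
have [[e he]|no] := pselect (exists e, al * q ^+ e = 1).
  exists e.+1 => n en; rewrite subr_eq0 eq_sym; apply/eqP => h.
  have al0 : al != 0 by apply: contra_eq_neq he => ->; rewrite mul0r eq_sym oner_eq0.
  have /expq_inj en' : q ^+ n = q ^+ e by apply: (mulfI al0); rewrite h he.
  by rewrite en' ltnn in en.
by exists 0%N => n _; rewrite subr_eq0 eq_sym; apply/eqP => h; apply: no; exists n.
Qed.

Lemma eventually_all (als : seq F) :
  exists n0, forall n, (n0 <= n)%N -> forall al, al \in als -> 1 - al * q ^+ n != 0.
Proof.
elim: als => [|al als [n1 h1]]; first by exists 0%N.
have [n2 h2] := eventually_neq al.
exists (maxn n1 n2) => n; rewrite geq_max => /andP [l1 l2] be.
by rewrite inE => /orP [/eqP ->|]; [exact: h2|exact: h1].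
Qed.

End PolynomialSeries.

Section PoissonNode.
Variables (F : fieldType) (q : F).
Hypothesis hq : forall n, 1 - q ^+ n.+1 != 0.
Hypothesis q0 : q != 0.
Local Notation H := (qprod q).
Local Notation P := (qprod q 1).

(* (A;q)_k (1 - A q^(2k)) / ((1 - A) (A q;q)_oo) for A = c t / q, as a power series in t *)
Definition vwpS (c : F) k : fps F :=
  if k is k'.+1 then qI q (c * q ^+ k') * fpsL (c * q ^+ (k' + k'.+1)) else qI q c.

Definition poisson_coef (u v a b a' b' : F) k : F :=
  P (b * u) k * P (b / u) k * P (b' * v) k * P (b' / v) k / (P q k * P (a * b) k)
  * (a' / b) ^+ k.

Definition poisson_term (u v a b a' b' : F) k : fps F :=
  fpsC (poisson_coef u v a b a' b' k)
  * (qE q (b * v * q ^+ k) * qE q (b / v * q ^+ k)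
     * qE q (b' * u * q ^+ k) * qE q (b' / u * q ^+ k))
  * (fpsP (qX q (b / a') k) * vwpS (b * b') k).

Lemma kap_sum (a b u : F) m n : u != 0 -> (forall i, P (a * b) i != 0) -> b * u = q ^- m ->
  P q n * (qI q u * phi21 q (a * u) (b * u) (a * b) u^-1) n
  = u ^+ n * \sum_(i < m.+1) kap q a b u m i * q ^+ (n * i).
Proof.
move=> u0 hab bu.
have hq' i : q ^+ i != 0 by rewrite expf_neq0.
pose C k := P (a * u) k * P (b * u) k / (u ^+ k * u ^+ k) / (P q k * P (a * b) k).
pose f k := C k * (P (q ^+ n * q / q ^+ k) k).
transitivity (u ^+ n * \sum_(k < m.+1) f k).
  transitivity (u ^+ n * \sum_(k < n.+1) f k).
    rewrite [qI q u * _]mulrC fps_coefM !mulr_sumr; apply: eq_bigr => -[k /=].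
    rewrite ltnS => kn _; rewrite /phi21 /qI /f /C.
    have -> : P q n = P q (n - k) * P (q ^+ n * q / q ^+ k) k.
      rewrite -{1}(subnK kn) qprodD; congr (_ * qprod _ _ _ _).
      have -> : q ^+ n = q ^+ (n - k) * q ^+ k by rewrite -exprD subnK.
      by move: (q ^+ (n - k)) => Z; field.
    have -> : u ^+ n = u ^+ (n - k) * u ^+ k by rewrite -exprD subnK.
    by rewrite exprVn; field; rewrite ?expf_neq0 ?hab ?(qfact_neq0 hq).
  congr (_ * _).
  have z1 k : (m < k)%N -> f k = 0.
    by move=> mk; rewrite /f /C bu (qprod_1V q0 mk) !(mulr0, mul0r).
  have z2 k : (n < k)%N -> f k = 0.
    move=> nk; rewrite /f.
    have -> : P (q ^+ n * q / q ^+ k) k = 0; last by rewrite mulr0.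
    rewrite (_ : q ^+ n * q / q ^+ k = q ^- (k - n.+1)) ?qprod_1V //; first by lia.
    apply: (mulIf (hq' k)); rewrite mulfVK // -exprSr.
    by rewrite -{2}(subnK nk) exprD mulrA mulVf // mul1r.
  rewrite (big_ord_widen_cond (n + m).+1 predT f) ?ltnS ?leq_addr //.
  rewrite [RHS](big_ord_widen_cond (n + m).+1 predT f) ?ltnS ?leq_addl //.
  rewrite [LHS]big_mkcond [RHS]big_mkcond /=; apply: eq_bigr => k _.
  rewrite !ltnS; case: (leqP k n) => [_|/z2 ->]; case: (leqP k m) => // /z1 -> //.
congr (_ * _).
have P01 i : P 0 i = 1 by rewrite qprod_x0 expr1n.
have H0 X k : H 0 X k = (- X) ^+ k * q ^+ 'C(k, 2).
  elim: k => [|k IH]; first by rewrite qprod0 mulr1.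
  by rewrite qprodSr IH bin2S exprD !exprS; ring.
have fin X k : P X k / P q k
   = \sum_(i < k.+1) (- X) ^+ i * q ^+ 'C(i, 2) / (P q i * P q (k - i)).
  have h00 i : P (X * 0) i != 0 by rewrite mulr0 P01 oner_neq0.
  have := saalschutz hq 0 1 k h00; rewrite !(mulr0, mul0r) !P01 !mulr1 => <-.
  by apply: eq_bigr => i _; rewrite !P01 !mulr1 H0.
pose G k i := C k * P q k * ((- (q ^+ n * q / q ^+ k)) ^+ i * q ^+ 'C(i, 2) / (P q i * P q (k - i))).
transitivity (\sum_(k < m.+1) \sum_(i < k.+1) G k i).
  apply: eq_bigr => k _; rewrite -mulr_sumr -fin /f.
  by field; rewrite qfact_neq0.
rewrite sum_triangle; apply: eq_bigr => -[i /=]; rewrite ltnS => im _.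
have e1 : b / u * (a * u * q ^+ i) = a * b * q ^+ i by field.
have hX j : P (b / u * (a * u * q ^+ i)) j != 0 by rewrite e1; exact: qprod_shift_neq0.
have := saalschutz hq 0 1 (m - i) hX; rewrite e1 mulr0 !mulr1 P01 => V.
have qm : q ^- m / (u * u) = b / u by rewrite -bu; field.
transitivity ((q ^+ (n * i) / (u ^+ i * u ^+ i * q ^+ (m * i))) * P q m * P (a * u) i
   / (P q i * P (a * b) i)
   * (P (b / u) (m - i) * 1 / (P q (m - i) * P (a * b * q ^+ i) (m - i)))); last first.
  rewrite /kap (qprod_split _ _ (a * b) im).
  have n1 := qprod_shift_neq0 i hab (m - i).
  by field; rewrite ?n1 ?hab ?(qfact_neq0 hq) ?hq' ?expf_neq0.
rewrite -V mulr_sumr; apply: eq_bigr => -[l /=]; rewrite ltnS => ll _.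
have il : (i + l <= m)%N by rewrite -(subnKC im) leq_add2l.
have r2 := qfact_rev hq q0 il.
have -> : G (i + l)%N i =
  P (a * u) i * P (a * u * q ^+ i) l
  * ((-1) ^+ (i + l) * q ^+ 'C(i + l, 2) * P q m / (P q (m - i - l) * q ^+ (m * (i + l))))
  / (u ^+ i * u ^+ l * (u ^+ i * u ^+ l))
  / (P (a * b) i * P (a * b * q ^+ i) l)
  * ((-1) ^+ i * q ^+ (n * i) * q ^+ i / q ^+ (i * i + l * i) * q ^+ 'C(i, 2) / (P q i * P q l)).
  rewrite /G /C bu addKn !qprodD -subnDA -[P q i * P (q * _) l]qprodD.
  have -> : P (q ^- m) i * P (q ^- m * q ^+ i) l
    = (-1) ^+ (i + l) * q ^+ 'C(i + l, 2) * P q m / (P q (m - (i + l)) * q ^+ (m * (i + l))).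
    by rewrite -qprodD -r2; field; rewrite qfact_neq0 // expf_neq0.
  have -> : (- (q ^+ n * q / q ^+ (i + l))) ^+ i
     = (-1) ^+ i * q ^+ (n * i) * q ^+ i / q ^+ (i * i + l * i).
    by rewrite [LHS]exprNn !exprMn exprVn -!exprM mulnDl !mulrA.
  rewrite !(exprD u).
  have n0 := qfact_neq0 hq (i + l); have n1 := qprod_shift_neq0 i hab l.
  move: (P q (i + l)) n0 => Z n0.
  have n2 := expf_neq0 (m * (i + l)) q0; have n3 := expf_neq0 (i * i + l * i) q0.
  move: (q ^+ (m * (i + l))) (q ^+ (i * i + l * i)) n2 n3 => Z2 Z3 n2 n3.
  by field; rewrite ?n0 ?n1 ?n2 ?n3 ?hab ?(qfact_neq0 hq) ?expf_neq0.
rewrite H0.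
have -> : (- (b / u)) ^+ l = (-1) ^+ l / q ^+ (m * l) / (u ^+ l * u ^+ l).
  by rewrite [LHS]exprNn -qm exprMn !exprVn -exprM exprMn !invfM; ring.
have -> : q ^+ 'C(i + l, 2) = q ^+ 'C(i, 2) * q ^+ 'C(l, 2) * q ^+ (l * i).
  by rewrite bin2D !exprD mulnC.
have -> : q ^+ (i * i + l * i) = q ^+ 'C(i, 2) * q ^+ 'C(i, 2) * q ^+ i * q ^+ (l * i).
  by rewrite exprD bin2_sqr !exprD.
rewrite mulnDr exprD exprD.
have sg : (-1) ^+ i * (-1) ^+ i = 1 :> F by rewrite -exprMn mulrNN mulr1 expr1n.
have n1 := qprod_shift_neq0 i hab l.
have n2 := expf_neq0 (m * i) q0; have n3 := expf_neq0 (m * l) q0; have n4 := expf_neq0 (l * i) q0.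
have n5 := expf_neq0 'C(i, 2) q0; have n6 := expf_neq0 i q0.
move: (q ^+ (m * i)) (q ^+ (m * l)) (q ^+ (l * i)) (q ^+ 'C(i, 2)) (q ^+ 'C(l, 2)) (q ^+ (n * i)) n2 n3 n4 n5.
move=> Z2 Z3 Z4 Z5 Z6 Z7 n2 n3 n4 n5.
transitivity ((-1) ^+ i * (-1) ^+ i * (Z7 / (u ^+ i * u ^+ i * Z2) * P q m * P (a * u) i / (P q i * P (a * b) i) *
  ((-1) ^+ l / Z3 / (u ^+ l * u ^+ l) * Z6 * P (a * u * q ^+ i) l * P 0 (m - i - l)
   / (P q l * P (a * b * q ^+ i) l * P q (m - i - l))))); last by rewrite sg mul1r.
rewrite P01; move: ((-1) ^+ i) ((-1) ^+ l) => S1 S2.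
by field; rewrite ?n1 ?n2 ?n3 ?n4 ?n5 ?n6 ?hab ?(qfact_neq0 hq) ?expf_neq0.
Qed.

Lemma kernel_node (u v a b a' b' : F) m : u != 0 -> a != 0 -> b != 0 ->
  (forall i, P (a * b) i != 0) -> b * u = q ^- m ->
  asc_kernel q u v a b a' b'
  = \sum_(i < m.+1) fpsC (kap q a b u m i) * dil (u * q ^+ i) (ascG q v a' b').
Proof.
move=> u0 a0 b0 hab bu; apply/funext => n; rewrite fps_coef_sum /asc_kernel.
have e := congr1 (fun f : fps F => f n) (asc_2phi1 hq q0 u0 a0 b0 hab).
transitivity (P q n * (asc q u a b n / (P q n * P (a * b) n)) * ascG q v a' b' n).
  by rewrite -(ascE hq); field; rewrite hab qfact_neq0.
rewrite e (kap_sum n u0 hab bu) -mulrA [X in _ * X]mulr_suml mulr_sumr; apply: eq_bigr => i _.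
by rewrite fps_coefCM /dil exprMn -exprM [(i * n)%N]mulnC; ring.
Qed.

End PoissonNode.

Section PoissonFormal.
Variables (F : fieldType) (q : F).
Hypothesis hq : forall n, 1 - q ^+ n.+1 != 0.
Hypothesis q0 : q != 0.
Local Notation P := (qprod q 1).

Definition vwpP (c : F) m k : {poly F} :=
  if k is k'.+1 then qX q c k' * (1 - (c * q ^+ (k' + k'.+1)) *: 'X) * qX q (c * q ^+ (m + k)) (m - k)
  else qX q (c * q ^+ m) m.

Lemma vwpP_eval c m k t : (k <= m)%N -> (forall i, P (c * t) i != 0) -> 1 - c * t / q != 0 ->
  P (c * t) (m + m) * (P (c * t / q) k * (1 - c * t / q * q ^+ (k + k)) / (1 - c * t / q)
      / P (c * t) (m + k)) = (vwpP c m k).[t].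
Proof.
case: k => [|k] km hc hA.
  rewrite /vwpP qX_eval qprod0 !addn0 expr0 mulr1 mul1r mulfV // mul1r qprodD.
  by rewrite [P _ m * _]mulrC mulfK //; congr (qprod _ _ _ _); ring.
rewrite /vwpP !hornerM !qX_eval hornerD hornerN hornerZ hornerC hornerX qprodS.
have -> : (m + m = (m + k.+1) + (m - k.+1))%N by rewrite -addnA subnKC.
rewrite [P (c * t) (m + k.+1 + _)]qprodD divfK //.
have -> : c * t / q * q ^+ (k.+1 + k.+1) = c * q ^+ (k + k.+1) * t.
  by rewrite addSn exprS; field.
have -> : c * t * q ^+ (m + k.+1) = c * q ^+ (m + k.+1) * t by ring.
have := hc (m + k.+1)%N; move: (P (c * t) (m + k.+1)) (1 - c * t / q) hA => X Y Y0 X0.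
by field; rewrite X0 Y0.
Qed.

Lemma vwpP_series c m k : (k <= m)%N ->
  fpsP (qX q c (m + m)) * (qE q (c * q ^+ (m + k)) * vwpS q c k) = fpsP (vwpP c m k).
Proof.
case: k => [|k] km.
  rewrite addn0 /vwpS /vwpP qXD fpsPM.
  by rewrite -[RHS]mul1r -(qEI hq c) (qE_split hq c m); ring.
rewrite /vwpS /vwpP !fpsPM -fpsL_poly.
have -> : (m + m = k + (m.+1 + (m - k.+1)))%N by lia.
rewrite !qXD !fpsPM -[c * q ^+ k * _]mulrA -exprD.
have -> : (k + m.+1 = m + k.+1)%N by lia.
have e := qE_split hq (c * q ^+ k) m.+1.
rewrite -mulrA -exprD in e; have e1 : (k + m.+1 = m + k.+1)%N by lia.
rewrite e1 in e; have e2 := qEI hq (c * q ^+ k).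
rewrite e in e2.
transitivity (fpsP (qX q c k) * fpsL (c * q ^+ (k + k.+1)) * fpsP (qX q (c * q ^+ (m + k.+1)) (m - k.+1))
   * (fpsP (qX q (c * q ^+ k) m.+1) * qE q (c * q ^+ (m + k.+1)) * qI q (c * q ^+ k))).
  ring.
by rewrite e2 mulr1.
Qed.

Section Node.
Variables (a b a' b' u v : F) (m : nat).
Hypotheses (a0 : a != 0) (b0 : b != 0) (a'0 : a' != 0) (b'0 : b' != 0) (v0 : v != 0).
Hypothesis u0 : u != 0.
Hypothesis bu : b * u * q ^+ m = 1.
Hypothesis e : a * b = a' * b'.
Hypothesis hab : forall i, P (a * b) i != 0.
Hypothesis hu2 : P (q * u ^+ 2) m != 0.

Lemma node_poly : qX q (b * b') (m + m) * (\sum_(i < m.+1) (kap q a b u m i)%:P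
     * (qX q (u * v) i * qX q (u / v) i * qX q (a' * u * q ^+ i) (m - i) * qX q (b' * u * q ^+ i) (m - i)))
  = \sum_(k < m.+1) (poisson_coef q u v a b a' b' k)%:P * 'X^k
     * (qX q (b' * u * q ^+ k) (m - k) * qX q (b * v * q ^+ k) (m - k)
        * qX q (b / v * q ^+ k) (m - k) * qX q (b / a') k) * vwpP (b * b') m k.
Proof.
have [n0 hn0] := eventually_all hq q0 [:: b' * u; a' * u; b * v; b / v; b * b'; b * b' / q].
apply: (@poly_eq_on _ (fun n => q ^+ (n0 + n))) => [i j /(expq_inj hq q0) /addnI //|n].
set t := q ^+ (n0 + n).
have t0 : t != 0 by rewrite expf_neq0.
have nz al : al \in [:: b' * u; a' * u; b * v; b / v; b * b'; b * b' / q] ->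
   forall i, P (al * t) i != 0.
  move=> hal i; apply: qprod_neq0 => j _; rewrite -mulrA -exprD.
  by apply: hn0 => //; rewrite -addnA leq_addr.
have h6 : 1 - b * b' * t / q != 0.
  have := hn0 (n0 + n)%N (leq_addr _ _) (b * b' / q); rewrite !inE eqxx !orbT => /(_ isT).
  by rewrite -/t mulrAC.
have hbb i : P (b * b' * t) i != 0 by apply: nz; rewrite !inE eqxx !orbT.
have := @node_identity _ q hq q0 a b a' b' u v t m a0 b0 a'0 b'0 v0 t0 u0 bu e hab hu2.
move=> /(_ _ _ _ _ hbb h6) I.
rewrite hornerM qX_eval !horner_sum.
transitivity (P (b * b' * t) (m + m) * (\sum_(i < m.+1) kap q a b u m i
   * (P (u * v * t) i * P (u / v * t) i
      * P (a' * u * q ^+ i * t) (m - i) * P (b' * u * q ^+ i * t) (m - i)))).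
  by congr (_ * _); apply: eq_bigr => i _; rewrite !hornerM !qX_eval hornerC.
rewrite I; last first.
- by apply: nz; rewrite !inE eqxx ?orbT.
- by apply: nz; rewrite !inE eqxx ?orbT.
- by apply: nz; rewrite !inE eqxx ?orbT.
- by apply: nz; rewrite !inE eqxx ?orbT.
rewrite mulr_sumr; apply: eq_bigr => -[k /=]; rewrite ltnS => km _.
rewrite !hornerM !qX_eval hornerC hornerXn -(vwpP_eval km hbb h6).
by rewrite /poisson_coef; ring.
Qed.

Lemma poisson_node :
  qE q (u * v) * qE q (u / v) * qE q (v / u) * qE q (u * v)^-1 * asc_kernel q u v a b a' b'
  = qE q (a' / b) * tsum (poisson_term q u v a b a' b').
Proof.
have bu' : b * u = q ^- m.
  by apply: (mulIf (expf_neq0 m q0)); rewrite bu mulVf ?expf_neq0.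
have iu : u^-1 = b * q ^+ m by rewrite -[LHS]mul1r -bu; field.
rewrite (kernel_node hq q0 v a' b' u0 a0 b0 hab bu').
have vu : v / u = b * v * q ^+ m by rewrite iu; ring.
have uv1 : (u * v)^-1 = b / v * q ^+ m by rewrite invfM iu; ring.
pose E0 := qE q (v / u) * qE q (u * v)^-1 * qE q (a' / b) * qE q (b' / b).
have au : a' * u * q ^+ m = a' / b by rewrite -[a' / b]mulr1 -bu; field.
have bu1 : b' * u * q ^+ m = b' / b by rewrite -[b' / b]mulr1 -bu; field.
apply: (@qX_cancel _ q hq (b * b') (m + m)).
rewrite (@tsum_finite _ m); last first.
  move=> k mk; rewrite /poisson_term /poisson_coef bu' (qprod_1V q0 mk) !mul0r.
  by rewrite -mulrA; apply/funext => n; rewrite fps_coefCM mul0r.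
transitivity (E0 * fpsP (qX q (b * b') (m + m) * (\sum_(i < m.+1) (kap q a b u m i)%:P
     * (qX q (u * v) i * qX q (u / v) i * qX q (a' * u * q ^+ i) (m - i) * qX q (b' * u * q ^+ i) (m - i))))).
  rewrite fpsPM fpsP_sum !mulr_sumr; apply: eq_bigr => -[i /=]; rewrite ltnS => im _.
  rewrite !fpsPM fpsPC /ascG !dilM !dil_qE !dil_qI.
  have -> : u * q ^+ i * a' = a' * u * q ^+ i by ring.
  have -> : u * q ^+ i * b' = b' * u * q ^+ i by ring.
  have -> : u * q ^+ i * v = u * v * q ^+ i by ring.
  have -> : u * q ^+ i / v = u / v * q ^+ i by ring.
  have sp c : qE q (c * q ^+ i) = fpsP (qX q (c * q ^+ i) (m - i)) * qE q (c * q ^+ m).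
    by rewrite (qE_split hq _ (m - i)) -mulrA -exprD subnKC.
  rewrite (qE_split hq (u * v) i) (qE_split hq (u / v) i) (sp (a' * u)) (sp (b' * u)) au bu1 /E0.
  have e1 := qEI hq (u * v * q ^+ i); have e2 := qEI hq (u / v * q ^+ i).
  set Z := RHS.
  transitivity (Z * (qE q (u * v * q ^+ i) * qI q (u * v * q ^+ i))
    * (qE q (u / v * q ^+ i) * qI q (u / v * q ^+ i))); last by rewrite e1 e2 !mulr1.
  rewrite /Z; ring.
rewrite node_poly fpsP_sum !mulr_sumr; apply: eq_bigr => -[k /=]; rewrite ltnS => km _.
rewrite !fpsPM fpsPC -(vwpP_series _ km) /poisson_term.
have sp c : qE q (c * q ^+ k) = fpsP (qX q (c * q ^+ k) (m - k)) * qE q (c * q ^+ m).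
  by rewrite (qE_split hq _ (m - k)) -mulrA -exprD subnKC.
rewrite !(sp (b * v), sp (b / v), sp (b' * u)) -vu -uv1 bu1.
have -> : b' / u * q ^+ k = b * b' * q ^+ (m + k) by rewrite iu exprD; ring.
by rewrite /E0; ring.
Qed.

End Node.
End PoissonFormal.

Section Laurent.
Variables (F : fieldType) (q : F).
Hypothesis hq : forall n, 1 - q ^+ n.+1 != 0.
Hypothesis q0 : q != 0.
Local Notation P := (qprod q 1).
Implicit Types (f g : F -> F) (A B : F -> fps F).

Definition laurent f := exists (p : {poly F}) (M : nat),
  forall u, u != 0 -> f u * u ^+ M = p.[u].

Lemma laurent_const c : laurent (fun=> c).
Proof. by exists c%:P, 0%N => u _; rewrite hornerC mulr1. Qed.

Lemma laurent_id : laurent id.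
Proof. by exists 'X, 0%N => u _; rewrite hornerX mulr1. Qed.

Lemma laurent_inv : laurent GRing.inv.
Proof. by exists 1, 1%N => u u0; rewrite hornerC mulVf. Qed.

Lemma laurentD f g : laurent f -> laurent g -> laurent (fun u => f u + g u).
Proof.
move=> [p [M hp]] [r [N hr]]; exists (p * 'X^N + r * 'X^M), (M + N)%N => u u0.
by rewrite hornerD !hornerM !hornerXn -hp // -hr // exprD; ring.
Qed.

Lemma laurentM f g : laurent f -> laurent g -> laurent (fun u => f u * g u).
Proof.
move=> [p [M hp]] [r [N hr]]; exists (p * r), (M + N)%N => u u0.
by rewrite hornerM -hp // -hr // exprD; ring.
Qed.

Lemma laurentX f n : laurent f -> laurent (fun u => f u ^+ n).
Proof.
move=> hf; elim: n => [|n IH]; first exact: laurent_const.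
by have := laurentM hf IH; under eq_fun do rewrite -exprS.
Qed.

Lemma laurent_sum n (G : 'I_n -> F -> F) : (forall i, laurent (G i)) ->
  laurent (fun u => \sum_(i < n) G i u).
Proof.
move=> hG; elim: n G hG => [|n IH] G hG.
  by under eq_fun do rewrite big_ord0; exact: laurent_const.
by under eq_fun do rewrite big_ord_recr /=; apply: laurentD => //; apply: IH => i.
Qed.

Lemma laurent_prod n (G : 'I_n -> F -> F) : (forall i, laurent (G i)) ->
  laurent (fun u => \prod_(i < n) G i u).
Proof.
move=> hG; elim: n G hG => [|n IH] G hG.
  by under eq_fun do rewrite big_ord0; exact: laurent_const.
by under eq_fun do rewrite big_ord_recr /=; apply: laurentM => //; apply: IH => i.
Qed.

Lemma laurent_qprod f n : laurent f -> laurent (fun u => P (f u) n).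
Proof.
move=> hf; apply: laurent_prod => i.
under eq_fun do rewrite -mulNr.
apply: laurentD; first exact: laurent_const.
apply: laurentM; last exact: laurent_const.
by under eq_fun do rewrite -mulN1r; apply: laurentM => //; exact: laurent_const.
Qed.

Lemma laurent_eq f g (x : nat -> F) : laurent f -> laurent g -> injective x ->
  (forall n, x n != 0) -> (forall n, f (x n) = g (x n)) ->
  forall u, u != 0 -> f u = g u.
Proof.
move=> [p [M hp]] [r [N hr]] xinj x0 h u u0.
have e : p * 'X^N = r * 'X^M.
  apply: (poly_eq_on xinj) => n.
  by rewrite !hornerM !hornerXn -hp // -hr // h; ring.
apply: (mulIf (expf_neq0 (M + N) u0)).
have := congr1 (fun p => p.[u]) e; rewrite !hornerM !hornerXn -hp // -hr // exprD.
by rewrite !mulrA => ->; rewrite mulrAC.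
Qed.

Definition laurentS A := forall n, laurent (fun u => A u n).

Lemma laurentS_const s : laurentS (fun=> s).
Proof. by move=> n; exact: laurent_const. Qed.

Lemma laurentSM A B : laurentS A -> laurentS B -> laurentS (fun u => A u * B u).
Proof.
move=> hA hB n; apply: laurent_sum => i; exact: laurentM.
Qed.

Lemma laurentSC f : laurent f -> laurentS (fun u => fpsC (f u)).
Proof. by move=> hf [|n]; [exact: hf|exact: laurent_const]. Qed.

Lemma laurentS_tsum (G : F -> nat -> fps F) : (forall k, laurentS (fun u => G u k)) ->
  laurentS (fun u => tsum (G u)).
Proof. by move=> hG n; apply: laurent_sum => i; exact: hG. Qed.

Lemma laurentS_qE f : laurent f -> laurentS (fun u => qE q (f u)).
Proof.
move=> hf n; apply: laurentM; last exact: laurent_const.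
by apply: laurentM; [exact: laurent_const|exact: laurentX].
Qed.

Lemma laurentS_qI f : laurent f -> laurentS (fun u => qI q (f u)).
Proof.
by move=> hf n; apply: laurentM; [exact: laurentX|exact: laurent_const].
Qed.

Lemma laurent_asc a b n : laurent (fun u => asc q u a b n).
Proof.
apply: laurentM; first exact: laurent_const.
apply: laurentSM; first exact: laurentS_const.
by apply: laurentSM; apply: laurentS_qI; [exact: laurent_id|exact: laurent_inv].
Qed.

Lemma poisson_kernel (a b a' b' v : F) :
  a != 0 -> b != 0 -> a' != 0 -> b' != 0 -> v != 0 -> a * b = a' * b' ->
  (forall i, P (a * b) i != 0) -> (forall i, 1 - b ^+ 2 * q ^+ i != 0) ->
  forall u, u != 0 ->
  qE q (u * v) * qE q (u / v) * qE q (v / u) * qE q (u * v)^-1 * asc_kernel q u v a b a' b'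
  = qE q (a' / b) * tsum (poisson_term q u v a b a' b').
Proof.
move=> a0 b0 a'0 b'0 v0 e hab hb2 u u0; apply/funext => n.
have ci c : laurent (fun u => c / u) by apply: laurentM; [exact: laurent_const|exact: laurent_inv].
have cm c : laurent (fun u => c * u) by apply: laurentM; [exact: laurent_const|exact: laurent_id].
have mc c : laurent (fun u => u * c) by apply: laurentM; [exact: laurent_id|exact: laurent_const].
have xinj : injective (fun m => (b * q ^+ m)^-1).
  by move=> i j /invr_inj /(mulfI b0) /(expq_inj hq q0).
have x0 m : (b * q ^+ m)^-1 != 0 by rewrite invr_eq0 mulf_neq0 ?expf_neq0.
pose f w := (qE q (w * v) * qE q (w / v) * qE q (v / w) * qE q (w * v)^-1
   * asc_kernel q w v a b a' b') n.
pose g w := (qE q (a' / b) * tsum (poisson_term q w v a b a' b')) n.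
rewrite -[LHS]/(f u) -[RHS]/(g u).
apply: (@laurent_eq f g _ _ _ xinj x0 _ u u0) => [||m].
- rewrite /f; apply: laurentSM; last first.
    move=> k; apply: laurentM; last exact: laurent_const.
    by apply: laurentM; [exact: laurent_asc|exact: laurent_const].
  apply: laurentSM; last first.
    by under eq_fun do rewrite invfM mulrC; exact: laurentS_qE.
  apply: laurentSM; last exact: laurentS_qE.
  by apply: laurentSM; exact: laurentS_qE.
- rewrite /g; apply: laurentSM; first exact: laurentS_const.
  apply: laurentS_tsum => k; rewrite /poisson_term /poisson_coef.
  apply: laurentSM; last exact: laurentS_const.
  apply: laurentSM.
    apply: laurentSC; apply: laurentM; last exact: laurent_const.
    apply: laurentM; last exact: laurent_const.
    apply: laurentM; last exact: laurent_const.
    apply: laurentM; last exact: laurent_const.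
    by apply: laurentM; exact: laurent_qprod.
  have lq h c : laurent h -> laurent (fun w => h w * c).
    by move=> hh; apply: laurentM => //; exact: laurent_const.
  apply: laurentSM; last by apply: laurentS_qE; exact: lq.
  apply: laurentSM; last by apply: laurentS_qE; exact: lq.
  exact: laurentS_const.
rewrite /f /g (@poisson_node _ q hq q0 a b a' b' _ v m) //.
  by rewrite mulrAC mulfV // mulf_neq0 ?expf_neq0.
apply: qprod_neq0 => i im.
have qi : q ^+ (m + m) = q ^+ (m + m - i.+1) * (q * q ^+ i) by rewrite -exprS -exprD; congr (_ ^+ _); lia.
have -> : q * (b * q ^+ m)^-1 ^+ 2 * q ^+ i
   = (b ^+ 2 * q ^+ (m + m - i.+1))^-1.
  rewrite exprVn exprMn -exprM muln2 -addnn qi.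
  have := expf_neq0 (m + m - i.+1) q0; move: (q ^+ (m + m - i.+1)) => Z Z0.
  by field; rewrite ?Z0 ?b0 ?q0 ?expf_neq0.
apply: contraNneq (hb2 (m + m - i.+1)%N) => /eqP; rewrite subr_eq0 => /eqP E.
by rewrite -[b ^+ 2 * _]invrK -E invr1 subrr.
Qed.

End Laurent.

Section FormalIdentity.
Variables (F : fieldType) (q : F).
Hypothesis hq : forall n, 1 - q ^+ n.+1 != 0.
Hypothesis q0 : q != 0.
Local Notation P := (qprod q 1).

Lemma formal_identity (u v s w w' a b a' b' : F) :
  u != 0 -> v != 0 -> s != 0 -> w != 0 -> w' != 0 ->
  a != 0 -> b != 0 -> a' != 0 -> b' != 0 -> a * b = a' * b' ->
  (forall i, P (a * b) i != 0) -> (forall i, P (s ^+ 2) i != 0) ->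
  (forall i, P (a * b * s ^+ 2) i != 0) ->
  (forall i, 1 - b ^+ 2 * q ^+ i != 0) -> (forall i, 1 - (s / u) ^+ 2 * q ^+ i != 0) ->
  (forall i, 1 - (b * s) ^+ 2 * q ^+ i != 0) ->
  qE q (u / v) * qE q (v / u) * qE q (u * v)^-1
  * tsum (fun j => fpsC (aw_weight q (a * b) (s ^+ 2) j
        * aw_conv q u a b (s * w) (s / w) j * aw_conv q v a' b' (s * w') (s / w') j)
      * tsum (poisson_term q w w' (a * s * q ^+ j) (b * s * q ^+ j)
                                  (a' * s * q ^+ j) (b' * s * q ^+ j)))
  = tsum (poisson_term q u v a b a' b')
    * tsum (poisson_term q w w' (s * u) (s / u) (s * v) (s / v)).
Proof.
move=> u0 v0 s0 w0 w'0 a0 b0 a'0 b'0 e hab hs hk hb2 hsu hbs.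
have qj0 j : q ^+ j != 0 by rewrite expf_neq0.
have K := kernel_product hq q0 u0 v0 s0 w0 w'0 a0 b0 a'0 b'0 e hab hs hk.
have P1 := poisson_kernel hq q0 a0 b0 a'0 b'0 v0 e hab hb2 u0.
have su0 : s * u != 0 by rewrite mulf_neq0.
have sv0 : s * v != 0 by rewrite mulf_neq0.
have s_u0 : s / u != 0 by rewrite mulf_neq0 ?invr_eq0.
have s_v0 : s / v != 0 by rewrite mulf_neq0 ?invr_eq0.
have ess : s * u * (s / u) = s * v * (s / v) by field; rewrite u0 v0.
have hss i : P (s * u * (s / u)) i != 0 by have -> : s * u * (s / u) = s ^+ 2 by field.
have P2 := poisson_kernel hq q0 su0 s_u0 sv0 s_v0 w'0 ess hss hsu w0.
have P3 j : qE q (w * w') * qE q (w / w') * qE q (w' / w) * qE q (w * w')^-1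
   * asc_kernel q w w' (a * s * q ^+ j) (b * s * q ^+ j) (a' * s * q ^+ j) (b' * s * q ^+ j)
   = qE q (a' / b) * tsum (poisson_term q w w' (a * s * q ^+ j) (b * s * q ^+ j)
                                  (a' * s * q ^+ j) (b' * s * q ^+ j)).
  have -> : a' / b = (a' * s * q ^+ j) / (b * s * q ^+ j) by field; rewrite s0 b0 qj0.
  have e2 : a * s * q ^+ j * (b * s * q ^+ j) = a * b * s ^+ 2 * q ^+ (j + j).
    by rewrite exprD; ring.
  apply: (poisson_kernel hq q0) => //; rewrite ?mulf_neq0 //.
  - transitivity (a * b * (s * s * q ^+ j * q ^+ j)); first by ring.
    by rewrite e; ring.
  - by move=> i; rewrite e2; exact: qprod_shift_neq0.
  move=> i; have -> : (b * s * q ^+ j) ^+ 2 * q ^+ i = (b * s) ^+ 2 * q ^+ (j + j + i).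
    by rewrite !exprD; ring.
  exact: hbs.
have euv : s * v / (s / u) = u * v by field; rewrite s0 u0.
rewrite euv in P2.
set Y1 := tsum (poisson_term q u v a b a' b') in P1 *.
set Y2 := tsum (poisson_term q w w' (s * u) _ _ _) in P2 *.
have cancelE c (f g : fps F) : qE q c * f = qE q c * g -> f = g.
  move=> h; have e1 := qEI hq c.
  by rewrite -[f]mul1r -[g]mul1r -e1 [qE q c * _]mulrC -!mulrA h.
apply: (@cancelE (u * v)); apply: (@cancelE (a' / b)).
transitivity ((qE q (u * v) * qE q (u / v) * qE q (v / u) * qE q (u * v)^-1)
  * (qE q (w * w') * qE q (w / w') * qE q (w' / w) * qE q (w * w')^-1)
  * (asc_kernel q u v a b a' b' * asc_kernel q w w' (s * u) (s / u) (s * v) (s / v))).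
  rewrite K -[RHS]mulrA [in RHS]tsumMl.
  set G := tsum _; set G' := tsum _; have -> : G' = qE q (a' / b) * G; last by ring.
  rewrite /G /G' tsumMl; congr tsum; apply/funext => j.
  by rewrite mulrCA P3; ring.
transitivity ((qE q (u * v) * qE q (u / v) * qE q (v / u) * qE q (u * v)^-1 * asc_kernel q u v a b a' b')
  * (qE q (w * w') * qE q (w / w') * qE q (w' / w) * qE q (w * w')^-1
     * asc_kernel q w w' (s * u) (s / u) (s * v) (s / v))); first by ring.
by rewrite P1 P2; ring.
Qed.

End FormalIdentity.

Local Open Scope classical_set_scope.
Local Open Scope complex_scope.

(** * Evaluation of the power series *)

Section ComplexSeries.
Variable R : realType.
Local Notation C := (Cx R).
Implicit Types (x y z : C) (u : nat -> C).

(* The norm of [Cx R] takes its values in [Cx R] itself. *)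
Definition cnorm x : R := complex.Re `|x|.

Lemma cnormE x : `|x| = (cnorm x)%:C.
Proof. by rewrite /cnorm RRe_real // normr_real. Qed.

Lemma cnormM x y : cnorm (x * y) = cnorm x * cnorm y.
Proof. by apply: (@complexI R); rewrite rmorphM /= -!cnormE normrM. Qed.

Lemma cnorm0 : cnorm 0 = 0.
Proof. by apply: (@complexI R); rewrite -!cnormE normr0. Qed.

Lemma cnorm1 : cnorm 1 = 1.
Proof. by apply: (@complexI R); rewrite -!cnormE normr1. Qed.

Lemma cnormV x : cnorm x^-1 = (cnorm x)^-1.
Proof. by apply: (@complexI R); rewrite fmorphV /= -!cnormE normfV. Qed.

Lemma cnormX x n : cnorm (x ^+ n) = cnorm x ^+ n.
Proof. by apply: (@complexI R); rewrite rmorphXn /= -!cnormE normrX. Qed.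

Lemma cnormN x : cnorm (- x) = cnorm x.
Proof. by apply: (@complexI R); rewrite -!cnormE normrN. Qed.

Lemma cnormD x y : cnorm (x + y) <= cnorm x + cnorm y.
Proof. by rewrite -lecR rmorphD /= -!cnormE ler_normD. Qed.

Lemma cnorm_distC x y : cnorm (x - y) = cnorm (y - x).
Proof. by rewrite -cnormN opprB. Qed.

Lemma cnormB x y : cnorm x - cnorm y <= cnorm (x - y).
Proof. by rewrite lerBlDr; have := cnormD (x - y) y; rewrite subrK. Qed.

Lemma cnorm_ge0 x : 0 <= cnorm x.
Proof. by rewrite -lecR -cnormE normr_ge0. Qed.

Lemma cnorm_real (r : R) : 0 <= r -> cnorm r%:C = r.
Proof. by move=> r0; apply: (@complexI R); rewrite -cnormE ger0_norm // lecR. Qed.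

Lemma cnorm_lt1 x : (`|x| < 1) = (cnorm x < 1).
Proof. by rewrite cnormE -(ltcR (cnorm x) 1). Qed.

Lemma cnorm_sum n (f : 'I_n -> C) : cnorm (\sum_i f i) <= \sum_i cnorm (f i).
Proof.
elim: n f => [|n IH] f; first by rewrite !big_ord0 cnorm0.
rewrite !big_ord_recr /=; apply: (le_trans (cnormD _ _)).
by rewrite lerD2r; exact: IH.
Qed.

Lemma cnorm_prod n (f : 'I_n -> C) : cnorm (\prod_i f i) = \prod_i cnorm (f i).
Proof.
elim: n f => [|n IH] f; first by rewrite !big_ord0 cnorm1.
by rewrite !big_ord_recr /= cnormM IH.
Qed.

Lemma cnorm_parts x : cnorm x <= `|complex.Re x| + `|complex.Im x|.
Proof.
have := complexE x => {1}->; apply: (le_trans (cnormD _ _)).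
rewrite cnormM; have -> : cnorm 'i%C = 1.
  by apply: (@complexI R); rewrite -cnormE; have := @normCi C; rewrite complexiE.
have r (a : R) : cnorm a%:C = `|a|.
  have [a0|a0] := leP 0 a; first by rewrite cnorm_real // ger0_norm.
  by rewrite -cnormN -rmorphN /= cnorm_real ?oppr_ge0 ?ltW // ltr0_norm.
by rewrite mul1r !r.
Qed.

Lemma cnorm_Re x : `|complex.Re x| <= cnorm x.
Proof. by rewrite -lecR -cnormE; exact: normc_ge_Re. Qed.

Lemma cnorm_Im x : `|complex.Im x| <= cnorm x.
Proof.
have := cnorm_Re (x * 'i%C); rewrite ReiNIm normrN cnormM.
have -> : cnorm 'i%C = 1.
  by apply: (@complexI R); rewrite -cnormE; have := @normCi C; rewrite complexiE.
by rewrite mulr1.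
Qed.

Definition lim_to u (l : C) := forall e : R, 0 < e ->
  exists N : nat, forall n, (N <= n)%N -> cnorm (u n - l) <= e.

Lemma lim_toP u l : lim_to u l <-> u @ \oo --> l.
Proof.
split=> [h|].
  apply/cvgrPdist_le => e e0.
  have er : e = (complex.Re e)%:C by rewrite RRe_real // gtr0_real.
  have e0' : 0 < complex.Re e by rewrite -ltcR -er.
  have [N hN] := h _ e0'.
  exists N => // n /= Nn; rewrite cnormE er lecR cnorm_distC; exact: hN.
move=> /cvgrPdist_le h e e0.
have [|N _ hN] := h e%:C; first by rewrite ltcR.
by exists N => n Nn; have := hN n Nn; rewrite cnormE lecR cnorm_distC.
Qed.

Lemma lim_toE u l : lim_to u l -> limn u = l.
Proof. by move=> /lim_toP h; apply: cvg_lim h; exact: norm_hausdorff. Qed.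

Lemma lim_to_unique u l l' : lim_to u l -> lim_to u l' -> l = l'.
Proof. by move=> /lim_toE <- /lim_toE <-. Qed.

Lemma lim_to_const l : lim_to (fun=> l) l.
Proof. by move=> e e0; exists 0%N => n _; rewrite subrr cnorm0 ltW. Qed.

Lemma lim_to_ext u v l : (forall n, u n = v n) -> lim_to u l -> lim_to v l.
Proof. by move=> uv h e /h [N hN]; exists N => n /hN; rewrite uv. Qed.

Lemma lim_toD u v l l' : lim_to u l -> lim_to v l' -> lim_to (fun n => u n + v n) (l + l').
Proof.
move=> h1 h2 e e0; have e2 : 0 < e / 2 by rewrite divr_gt0.
have [N hN] := h1 _ e2; have [N' hN'] := h2 _ e2.
exists (maxn N N') => n; rewrite geq_max => /andP [n1 n2].
rewrite opprD addrACA; apply: (le_trans (cnormD _ _)); rewrite [leRHS]splitr.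
by apply: lerD; [exact: hN|exact: hN'].
Qed.

Lemma lim_toZ c u l : lim_to u l -> lim_to (fun n => c * u n) (c * l).
Proof.
move=> h e e0; have c1 : 0 < cnorm c + 1 by rewrite ltr_wpDl ?cnorm_ge0.
have [N hN] := h _ (divr_gt0 e0 c1); exists N => n /hN le1.
rewrite -mulrBr cnormM -[leRHS](divfK (lt0r_neq0 c1)) [leRHS]mulrC.
by apply: ler_pM => //; rewrite ?cnorm_ge0 // lerDl.
Qed.

Lemma lim_to_le u l M N0 : (forall n, (N0 <= n)%N -> cnorm (u n) <= M) ->
  lim_to u l -> cnorm l <= M.
Proof.
move=> hu hl; apply/ler_addgt0Pr => e e0; have [N hN] := hl e e0.
have -> : l = u (maxn N0 N) - (u (maxn N0 N) - l) by ring.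
apply: (le_trans (cnormD _ _)); rewrite cnormN; apply: lerD.
  by apply: hu; exact: leq_maxl.
by apply: hN; exact: leq_maxr.
Qed.

Lemma lim_to_near u v l : lim_to u l ->
  (forall e : R, 0 < e -> exists N, forall n, (N <= n)%N -> cnorm (u n - v n) <= e) ->
  lim_to v l.
Proof.
move=> hu h e e0; have e2 : 0 < e / 2 by rewrite divr_gt0.
have [N hN] := hu _ e2; have [N' hN'] := h _ e2.
exists (maxn N N') => n; rewrite geq_max => /andP [n1 n2].
have -> : v n - l = (u n - l) - (u n - v n) by ring.
apply: (le_trans (cnormD _ _)); rewrite cnormN [leRHS]splitr.
by apply: lerD; [exact: hN|exact: hN'].
Qed.

Definition summable_by u (M : R) := forall N : nat, \sum_(n < N) cnorm (u n) <= M.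

Lemma bounded_series_cvg (a : nat -> R) M : (forall N : nat, \sum_(n < N) `|a n| <= M) ->
  exists l : R, forall e : R, 0 < e ->
    exists N : nat, forall n, (N <= n)%N -> `|\sum_(i < n) a i - l| <= e.
Proof.
move=> h; have cv : cvgn (series a).
  apply: normed_cvg; apply: nondecreasing_is_cvgn.
    by apply/nondecreasing_seqP => n /=; rewrite /series /= !big_mkord big_ord_recr /= lerDl normr_ge0.
  by exists M; move=> _ [n _ <-] /=; rewrite /series /= big_mkord.
exists (limn (series a)) => e e0.
have /cvgrPdist_le /(_ e e0) [N _ hN] := cv.
exists N => n Nn; have := hN n Nn; rewrite /series /= big_mkord.
by rewrite distrC.
Qed.

Lemma summable_cvg u M : summable_by u M -> exists l, lim_to (psum u) l.
Proof.
move=> h.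
have [|l1 h1] := @bounded_series_cvg (fun n => complex.Re (u n)) M.
  by move=> N; apply: le_trans (h N); apply: ler_sum => n _; exact: cnorm_Re.
have [|l2 h2] := @bounded_series_cvg (fun n => complex.Im (u n)) M.
  by move=> N; apply: le_trans (h N); apply: ler_sum => n _; exact: cnorm_Im.
exists (l1 +i* l2)%C => e e0; have e2 : 0 < e / 2 by rewrite divr_gt0.
have [N hN] := h1 _ e2; have [N' hN'] := h2 _ e2.
exists (maxn N N') => n; rewrite geq_max => /andP [n1 n2].
apply: (le_trans (cnorm_parts _)); rewrite [leRHS]splitr /psum.
have e3 : complex.Re (\sum_(i < n) u i) = \sum_(i < n) complex.Re (u i).
  by elim/big_rec2: _ => // i a b _ <-; case: (u i) b => ? ? [? ?].
have e4 : complex.Im (\sum_(i < n) u i) = \sum_(i < n) complex.Im (u i).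
  by elim/big_rec2: _ => // i a b _ <-; case: (u i) b => ? ? [? ?].
apply: lerD.
  have -> : complex.Re (\sum_(i < n) u i - (l1 +i* l2)%C) = \sum_(i < n) complex.Re (u i) - l1.
    by rewrite -e3; case: (\sum_(i < n) u i).
  exact: hN.
have -> : complex.Im (\sum_(i < n) u i - (l1 +i* l2)%C) = \sum_(i < n) complex.Im (u i) - l2.
  by rewrite -e4; case: (\sum_(i < n) u i).
exact: hN'.
Qed.

End ComplexSeries.

Lemma sum_widen (V : nmodType) (g : nat -> V) K N : (K <= N)%N ->
  \sum_(m < K) g m = \sum_(m < N) if (m < K)%N then g m else 0.
Proof. by move=> KN; rewrite (big_ord_widen_cond N predT g KN) big_mkcond. Qed.

Lemma sum_square_widen (V : nmodType) (g : nat -> nat -> V) K L N : (K <= N)%N -> (L <= N)%N ->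
  \sum_(m < K) \sum_(n < L) g m n
  = \sum_(m < N) \sum_(n < N) if ((m < K) && (n < L))%N then g m n else 0.
Proof.
move=> KN LN; rewrite (sum_widen (fun m => \sum_(n < L) g m n) KN).
apply: eq_bigr => m _; rewrite (sum_widen _ LN).
by case: (m < K)%N => //=; rewrite big1.
Qed.

Section DoubleSeries.
Variable R : realType.
Local Notation C := (Cx R).
Variables (f : nat -> nat -> C) (M : R).
Hypothesis hM : forall N : nat, \sum_(m < N) \sum_(n < N) cnorm (f m n) <= M.

Let T N : R := \sum_(m < N) \sum_(n < N) cnorm (f m n).
Let sq N : C := \sum_(m < N) \sum_(n < N) f m n.

Let T_mono K N : (K <= N)%N -> T K <= T N.
Proof.
move=> KN; rewrite /T (sum_square_widen (fun m n => cnorm (f m n)) KN KN).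
by apply: ler_sum => m _; apply: ler_sum => n _; case: ifP; rewrite ?cnorm_ge0.
Qed.

Let T_cauchy (e : R) : 0 < e -> exists K : nat, forall N, (K <= N)%N -> T N - T K <= e.
Proof.
move=> e0; have cv : cvgn T.
  apply: nondecreasing_is_cvgn; first by move=> m n; exact: T_mono.
  by exists M; move=> _ [n _ <-]; exact: hM.
have /cvgrPdist_le /(_ (e / 2)) [|K _ hK] := cv; first by rewrite divr_gt0.
exists K => N KN; rewrite [leRHS]splitr.
have -> : T N - T K = (limn T - T K) - (limn T - T N) by ring.
apply: (le_trans (ler_norm _)); apply: (le_trans (ler_normB _ _)).
by apply: lerD; apply: hK => /=.
Qed.

Let square_dist (sel : nat -> nat -> bool) K N : (K <= N)%N ->
  (forall m n, (m < K)%N -> (n < K)%N -> sel m n) ->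
  cnorm (\sum_(m < N) \sum_(n < N) (if sel m n then f m n else 0) - sq K) <= T N - T K.
Proof.
move=> KN hsel; rewrite /sq (sum_square_widen _ KN KN) -sumrB.
apply: (le_trans (cnorm_sum _)).
rewrite /T (sum_square_widen (fun m n => cnorm (f m n)) KN KN) -sumrB.
apply: ler_sum => m _; rewrite -!sumrB.
apply: (le_trans (cnorm_sum _)); apply: ler_sum => n _.
case: (boolP ((m < K) && (n < K))%N) => [/andP [mK nK]|_].
  by rewrite hsel // !subrr cnorm0.
by rewrite !subr0; case: ifP => _; rewrite ?cnorm0 ?cnorm_ge0.
Qed.

Let diag N : C := \sum_(k < N.+1) f k (N - k)%N.

Let psum_diag n : psum diag n.+1
  = \sum_(m < n.+1) \sum_(l < n.+1) if (m + l <= n)%N then f m l else 0.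
Proof.
rewrite /psum /diag (sum_triangle (fun k i => f i (k - i)%N)).
apply: eq_bigr => -[m /=]; rewrite ltnS => mn _.
rewrite (sum_widen (fun l => f m (m + l - m)%N) (N := n.+1)) ?ltnS ?leq_subr //.
by apply: eq_bigr => l _; rewrite addKn ltnS leq_subRL.
Qed.

Lemma diag_summable : summable_by diag M.
Proof.
case=> [|n]; first by have := hM 0; rewrite !big_ord0.
apply: (le_trans _ (hM n.+1)).
apply: (@le_trans _ _ (\sum_(k < n.+1) \sum_(i < k.+1) cnorm (f i (k - i)%N))).
  by apply: ler_sum => k _; exact: cnorm_sum.
rewrite (sum_triangle (fun k i => cnorm (f i (k - i)%N))).
apply: ler_sum => -[m /=]; rewrite ltnS => mn _.
rewrite (sum_widen (fun l => cnorm (f m (m + l - m)%N)) (N := n.+1)) ?ltnS ?leq_subr //.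
by apply: ler_sum => l _; rewrite addKn; case: ifP; rewrite ?cnorm_ge0.
Qed.

Variable s : nat -> C.
Hypothesis hs : forall m, lim_to (psum (f m)) (s m).

Let lim_rows N : lim_to (fun J => \sum_(m < N) psum (f m) J) (psum s N).
Proof.
elim: N => [|N IH].
  rewrite /psum big_ord0; apply: lim_to_ext (lim_to_const 0) => J.
  by rewrite big_ord0.
rewrite /psum big_ord_recr /=.
apply: (@lim_to_ext _ (fun J => \sum_(m < N) psum (f m) J + psum (f N) J)).
  by move=> J; rewrite big_ord_recr.
exact: lim_toD.
Qed.

Lemma rows_diag_lim S : lim_to (psum diag) S -> lim_to (psum s) S.
Proof.
move=> hS; apply: (lim_to_near hS) => e e0.
have e2 : 0 < e / 2 by rewrite divr_gt0.
have [K hK] := T_cauchy e2.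
exists (K + K).+1 => -[//|n]; rewrite ltnS => Kn.
have Kn' : (K <= n.+1)%N by lia.
have -> : psum diag n.+1 - psum s n.+1 = (psum diag n.+1 - sq K) - (psum s n.+1 - sq K) by ring.
apply: (le_trans (cnormD _ _)); rewrite cnormN [leRHS]splitr; apply: lerD.
  rewrite psum_diag; apply: le_trans (hK _ Kn').
  apply: (@square_dist (fun m l => m + l <= n)%N) => // m l mK lK; lia.
have h := lim_toD (lim_rows n.+1) (lim_to_const (- sq K)).
apply: (lim_to_le (N0 := n.+1)) h => J nJ.
have KJ : (K <= J)%N by exact: leq_trans nJ.
apply: le_trans (hK _ KJ).
rewrite /psum (sum_square_widen _ nJ (leqnn J)).
have -> : \sum_(m < J) \sum_(l < J) (if (m < n.+1)%N && (l < J)%N then f m l else 0)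
   = \sum_(m < J) \sum_(l < J) (if (m < n.+1)%N then f m l else 0).
  by apply: eq_bigr => m _; apply: eq_bigr => l _; rewrite ltn_ord andbT.
by apply: (@square_dist (fun m _ => m < n.+1)%N) => // m l mK _; exact: leq_trans Kn'.
Qed.

End DoubleSeries.

Section Evaluation.
Variable R : realType.
Local Notation C := (Cx R).
Implicit Types (f g : fps C) (t : C) (r M : R).

Definition conv f r M := forall N : nat, \sum_(n < N) cnorm (f n) * r ^+ n <= M.

Definition hasval f t (v : C) := lim_to (psum (fun n => f n * t ^+ n)) v.

Lemma conv_summable f t M : conv f (cnorm t) M -> summable_by (fun n => f n * t ^+ n) M.
Proof.
move=> h N; apply: le_trans (h N); apply: ler_sum => n _.
by rewrite cnormM cnormX.
Qed.

Lemma conv_ge0 f r M : conv f r M -> 0 <= M.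
Proof. by move=> /(_ 0%N); rewrite big_ord0. Qed.

Lemma conv_le f r M M' : M <= M' -> conv f r M -> conv f r M'.
Proof. by move=> le1 h N; exact: le_trans (h N) le1. Qed.

Lemma conv_coef f r M n : 0 <= r -> conv f r M -> cnorm (f n) * r ^+ n <= M.
Proof.
move=> r0 h; apply: le_trans (h n.+1); rewrite big_ord_recr /= lerDr sumr_ge0 // => i _.
by rewrite mulr_ge0 ?cnorm_ge0 ?exprn_ge0.
Qed.

Lemma double_lim (F : nat -> nat -> C) M s :
  (forall N : nat, \sum_(m < N) \sum_(n < N) cnorm (F m n) <= M) ->
  (forall m, lim_to (psum (F m)) (s m)) ->
  exists S, lim_to (psum (fun N => \sum_(k < N.+1) F k (N - k)%N)) S /\ lim_to (psum s) S.
Proof.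
move=> hM hs; have [S hS] := summable_cvg (diag_summable hM).
by exists S; split=> //; exact: rows_diag_lim hM _ hs _ hS.
Qed.

Lemma cauchy_square_bound f g t M M' N :
  conv f (cnorm t) M -> conv g (cnorm t) M' ->
  \sum_(m < N) \sum_(n < N) cnorm (f m * t ^+ m * (g n * t ^+ n)) <= M * M'.
Proof.
move=> hf hg; have := conv_ge0 hf; have := conv_summable hf N; have := conv_summable hg N.
move=> h1 h2 M0; under eq_bigr do under eq_bigr do rewrite cnormM.
under eq_bigr do rewrite -mulr_sumr.
rewrite -mulr_suml; apply: ler_pM => //; apply: sumr_ge0 => i _; exact: cnorm_ge0.
Qed.

Lemma cauchy_diag f g t N :
  \sum_(k < N.+1) (f k * t ^+ k * (g (N - k)%N * t ^+ (N - k))) = (f * g) N * t ^+ N.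
Proof.
rewrite fps_coefM mulr_suml; apply: eq_bigr => -[k /=]; rewrite ltnS => kN _.
by rewrite -[in RHS](subnKC kN) exprD addKn; ring.
Qed.

Lemma conv_mul f g t M M' : conv f (cnorm t) M -> conv g (cnorm t) M' ->
  conv (f * g) (cnorm t) (M * M').
Proof.
move=> hf hg N.
have h := @diag_summable _ (fun m n => f m * t ^+ m * (g n * t ^+ n)) _
  (fun N => cauchy_square_bound N hf hg) N.
apply: le_trans h; apply: ler_sum => n _.
by rewrite (cauchy_diag f g t n) cnormM cnormX.
Qed.

Lemma hasval_mul f g t M M' v w : conv f (cnorm t) M -> conv g (cnorm t) M' ->
  hasval f t v -> hasval g t w -> hasval (f * g) t (v * w).
Proof.
move=> hf hg hv hw.
have [|S [h1 h2]] := @double_lim (fun m n => f m * t ^+ m * (g n * t ^+ n)) (M * M')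
   (fun m => f m * t ^+ m * w) (fun N => cauchy_square_bound N hf hg).
  move=> m; apply: (@lim_to_ext _ (fun n => f m * t ^+ m * psum (fun n => g n * t ^+ n) n)).
    by move=> n; rewrite /psum mulr_sumr.
  exact: lim_toZ.
have -> : v * w = S.
  apply: (lim_to_unique _ h2).
  apply: (@lim_to_ext _ (fun n => w * psum (fun n => f n * t ^+ n) n)).
    by move=> n; rewrite /psum mulr_sumr; apply: eq_bigr => i _; rewrite mulrC.
  by rewrite mulrC; exact: lim_toZ.
apply: lim_to_ext h1 => N; rewrite /psum; apply: eq_bigr => n _.
exact: cauchy_diag.
Qed.

Lemma hasval_tsum (G : nat -> fps C) t (B : nat -> R) M (v : nat -> C) :
  (forall k, conv (G k) (cnorm t) (B k)) ->
  (forall N : nat, \sum_(k < N) B k * cnorm t ^+ k <= M) ->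
  (forall k, hasval (G k) t (v k)) ->
  conv (tsum G) (cnorm t) M /\
  exists V, hasval (tsum G) t V /\ lim_to (psum (fun k => v k * t ^+ k)) V.
Proof.
move=> hG hB hv; pose F k n := G k n * t ^+ n * t ^+ k.
have t0 n : 0 <= cnorm t ^+ n by rewrite exprn_ge0 ?cnorm_ge0.
have hM (N : nat) : \sum_(m < N) \sum_(n < N) cnorm (F m n) <= M.
  apply: le_trans (hB N); apply: ler_sum => k _.
  under eq_bigr do rewrite /F cnormM cnormX.
  rewrite -mulr_suml; apply: ler_wpM2r => //; exact: conv_summable.
have dg N : \sum_(k < N.+1) F k (N - k)%N = tsum G N * t ^+ N.
  rewrite /tsum mulr_suml; apply: eq_bigr => -[k /=]; rewrite ltnS => kN _.
  by rewrite /F -mulrA -exprD subnK.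
split.
  move=> N; apply: le_trans (diag_summable hM N); apply: ler_sum => n _.
  by rewrite dg cnormM cnormX.
have [|S [h1 h2]] := @double_lim F M (fun k => v k * t ^+ k) hM.
  move=> k; apply: (@lim_to_ext _ (fun n => t ^+ k * psum (fun n => G k n * t ^+ n) n)).
    by move=> n; rewrite /psum mulr_sumr; apply: eq_bigr => i _; rewrite mulrC.
  by rewrite mulrC; exact: lim_toZ (hv k).
exists S; split=> //; apply: lim_to_ext h1 => N.
by rewrite /psum; apply: eq_bigr => n _; exact: dg.
Qed.

Lemma psum_finite (u : nat -> C) K : (forall n, (K <= n)%N -> u n = 0) ->
  lim_to (psum u) (\sum_(n < K) u n).
Proof.
move=> h e e0; exists K => n Kn; rewrite /psum -(subnKC Kn) big_split_ord /=.
rewrite [X in _ + X - _]big1 => [|i _]; last by rewrite h ?leq_addr.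
by rewrite addr0 subrr cnorm0 ltW.
Qed.

Lemma hasval_C c t : hasval (fpsC c) t c.
Proof.
have := @psum_finite (fun n => fpsC c n * t ^+ n) 1.
rewrite big_ord1 /fpsC mulr1n expr0 mulr1; apply.
by case=> // n _; rewrite mulr0n mul0r.
Qed.

Lemma conv_C c r : conv (fpsC c) r (cnorm c).
Proof.
case=> [|N]; first by rewrite big_ord0 cnorm_ge0.
rewrite big_ord_recl big1 => [|i _]; last by rewrite /fpsC mulr0n cnorm0 mul0r.
by rewrite addr0 expr0 mulr1.
Qed.

Lemma hasval_L c t : hasval (fpsL c) t (1 - c * t).
Proof.
have := @psum_finite (fun n => fpsL c n * t ^+ n) 2.
rewrite big_ord_recl big_ord1 /= mulr1n expr0 expr1 mulr1 mulNr; apply.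
by case=> // -[|n] // _; rewrite /= mulr0n mul0r.
Qed.

Lemma conv_L c r : 0 <= r -> conv (fpsL c) r (1 + cnorm c * r).
Proof.
move=> r0; have p1 : 0 <= cnorm c * r by rewrite mulr_ge0 ?cnorm_ge0.
case=> [|[|N]]; first by rewrite big_ord0 addr_ge0.
  by rewrite big_ord1 expr0 mulr1 cnorm1 lerDl.
rewrite 2!big_ord_recl big1 => [|i _]; last by rewrite /= mulr0n cnorm0 mul0r.
by rewrite /= addr0 mulr1n cnorm1 expr0 mulr1 expr1 cnormN.
Qed.

Lemma geometric_bound (x : R) (N : nat) : 0 <= x -> x < 1 -> \sum_(n < N) x ^+ n <= (1 - x)^-1.
Proof.
move=> x0 x1; have h : 0 < 1 - x by rewrite subr_gt0.
rewrite -[leRHS]mul1r ler_pdivlMr //.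
have -> : (\sum_(n < N) x ^+ n) * (1 - x) = 1 - x ^+ N.
  by have := subrX1 x N; rewrite -[x ^+ N - 1]opprB -[x - 1]opprB mulNr => /oppr_inj ->; rewrite mulrC.
by rewrite gerBl exprn_ge0.
Qed.

Lemma expr_small (x e : R) : 0 <= x -> x < 1 -> 0 < e -> exists n0 : nat, forall n, (n0 <= n)%N -> x ^+ n <= e.
Proof.
move=> x0 x1 e0; have := @cvg_expr R x; rewrite ger0_norm // => /(_ x1).
move=> /cvgrPdist_le /(_ e e0) [n0 _ h].
exists n0 => n /h /=; rewrite sub0r normrN ger0_norm ?exprn_ge0 //.
Qed.

Lemma ratio_bound (b : nat -> R) n0 N : (forall n, 0 <= b n) ->
  (forall n, (n0 <= n)%N -> b n.+1 <= b n / 2) ->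
  \sum_(n < N) b n <= \sum_(n < n0) b n + 2 * b n0.
Proof.
move=> b0 h; have key k : \sum_(n < n0 + k) b n + 2 * b (n0 + k)%N <= \sum_(n < n0) b n + 2 * b n0.
  elim: k => [|k IH]; first by rewrite addn0.
  apply: le_trans IH; rewrite addnS big_ord_recr /= -addrA lerD2l.
  have := h (n0 + k)%N (leq_addr _ _); lra.
apply: le_trans (key N); rewrite addnC big_split_ord /= -addrA lerDl.
by rewrite addr_ge0 ?mulr_ge0 // sumr_ge0.
Qed.

End Evaluation.

Section QAnalysis.
Variable R : realType.
Local Notation C := (Cx R).
Variable q : C.
Hypothesis q0 : q != 0.
Hypothesis q1 : cnorm q < 1.
Implicit Types (f g : fps C) (t x y al : C) (r X : R).
Local Notation P := (qprod q 1).

Lemma subr1_neq0 x : cnorm x < 1 -> 1 - x != 0.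
Proof.
move=> h; rewrite subr_eq0; apply: contraTneq h => <-.
by rewrite cnorm1 ltxx.
Qed.

Lemma cnorm_qX n : cnorm (q ^+ n) <= 1.
Proof. by rewrite cnormX exprn_ile1 ?cnorm_ge0 // ltW. Qed.

Lemma qpow_neq1 n : 1 - q ^+ n.+1 != 0.
Proof.
apply: subr1_neq0; rewrite cnormX exprS.
apply: le_lt_trans q1; rewrite ler_piMr ?cnorm_ge0 //.
by rewrite exprn_ile1 ?cnorm_ge0 // ltW.
Qed.

Lemma cnorm_mulq x n : cnorm (x * q ^+ n) <= cnorm x.
Proof. by rewrite cnormM ler_piMr ?cnorm_ge0 ?cnorm_qX. Qed.

Lemma qprod1_neq0 x : cnorm x < 1 -> forall n, P x n != 0.
Proof.
move=> h n; apply: qprod_neq0 => i _; apply: subr1_neq0.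
exact: le_lt_trans (cnorm_mulq _ _) h.
Qed.

Lemma prod_bound X (n : nat) : 0 <= X ->
  \prod_(i < n) (1 + X * cnorm q ^+ i) <= expR (X / (1 - cnorm q)).
Proof.
move=> X0; apply: (@le_trans _ _ (expR (\sum_(i < n) X * cnorm q ^+ i))).
  elim: n => [|n IH]; first by rewrite !big_ord0 expR0.
  rewrite !big_ord_recr /= expRD; apply: ler_pM => //.
  - by apply: prodr_ge0 => i _; rewrite addr_ge0 // mulr_ge0 // exprn_ge0 // cnorm_ge0.
  - by rewrite addr_ge0 // mulr_ge0 // exprn_ge0 // cnorm_ge0.
  exact: expR_ge1Dx.
rewrite ler_expR -mulr_sumr; apply: ler_wpM2l => //.
exact: geometric_bound (cnorm_ge0 _) q1.
Qed.

Lemma qprod_upper X : exists B : R, 0 < B /\ forall x n, cnorm x <= X -> cnorm (P x n) <= B.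
Proof.
exists (expR (Num.max 0 X / (1 - cnorm q))); split; first exact: expR_gt0.
move=> x n hx; have X0 : 0 <= Num.max 0 X by rewrite le_max lexx.
apply: le_trans (prod_bound n X0); rewrite /qprod cnorm_prod.
apply: ler_prod => i _; rewrite cnorm_ge0 /=.
apply: (le_trans (cnormD _ _)); rewrite cnormN cnorm1 lerD2l cnormM cnormX.
apply: ler_wpM2r; first by rewrite exprn_ge0 ?cnorm_ge0.
by rewrite le_max hx orbT.
Qed.

Lemma qprod_lower X : X < 1 -> exists c : R, 0 < c /\ forall x n, cnorm x <= X -> c <= cnorm (P x n).
Proof.
move=> X1; pose Y := Num.max 0 X.
have Y0 : 0 <= Y by rewrite le_max lexx.
have Y1 : 0 < 1 - Y by rewrite subr_gt0 gt_max ltr01.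
pose Z := Y / (1 - Y); have Z0 : 0 <= Z by rewrite divr_ge0 // ltW.
exists (expR (Z / (1 - cnorm q)))^-1; split; first by rewrite invr_gt0 expR_gt0.
move=> x n hx; have le1 := prod_bound n Z0.
have pos i : 0 < 1 + Z * cnorm q ^+ i.
  by rewrite ltr_pwDl // mulr_ge0 // exprn_ge0 // cnorm_ge0.
apply: (@le_trans _ _ (\prod_(i < n) (1 + Z * cnorm q ^+ i))^-1).
  rewrite lef_pV2 // posrE ?expR_gt0 //; apply: prodr_gt0 => i _; exact: pos.
rewrite -prodfV /qprod cnorm_prod; apply: ler_prod => i _.
rewrite invr_ge0 ltW ?pos //=.
rewrite -[leLHS]mul1r ler_pdivrMr ?pos //.
have p0 : 0 <= cnorm q ^+ i by rewrite exprn_ge0 ?cnorm_ge0.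
have p1 : cnorm q ^+ i <= 1 by rewrite exprn_ile1 ?cnorm_ge0 // ltW.
apply: (@le_trans _ _ ((1 - Y * cnorm q ^+ i) * (1 + Z * cnorm q ^+ i))).
  move: (cnorm q ^+ i) p0 p1 => p p0 p1.
  have e : Z - Y - Y * Z = 0 by rewrite /Z; field; rewrite lt0r_neq0.
  have -> : (1 - Y * p) * (1 + Z * p) = 1 + (Z - Y - Y * Z) * p + Y * Z * p * (1 - p) by ring.
  rewrite e mul0r addr0 lerDl; apply: mulr_ge0; rewrite ?subr_ge0 //.
  by apply: mulr_ge0 => //; exact: mulr_ge0.
apply: ler_wpM2r; first by rewrite ltW ?pos.
apply: (le_trans _ (cnormB _ _)); rewrite cnorm1 lerD2l lerN2 cnormM cnormX.
by apply: ler_wpM2r => //; rewrite /Y le_max hx orbT.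
Qed.

Lemma qprod_inv_upper X : X < 1 -> exists B : R, 0 < B /\
  forall x n, cnorm x <= X -> (cnorm (P x n))^-1 <= B.
Proof.
move=> /qprod_lower [c [c0 h]]; exists c^-1; split; first by rewrite invr_gt0.
by move=> x n /(h _ n) cx; rewrite lef_pV2 // posrE // (lt_le_trans c0).
Qed.

Lemma qE_conv r X : 0 <= r -> 0 <= X ->
  exists M, forall al, cnorm al * r <= X -> conv (qE q al) r M.
Proof.
move=> r0 X0; have h1 : 0 < 1 - cnorm q by rewrite subr_gt0.
pose y := X / (1 - cnorm q); have y0 : 0 <= y by rewrite divr_ge0 // ltW.
pose b n := \prod_(i < n) (y * cnorm q ^+ i).
have b0 n : 0 <= b n by apply: prodr_ge0 => i _; rewrite mulr_ge0 // exprn_ge0 // cnorm_ge0.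
have e0 : 0 < (2 * (y + 1))^-1 by rewrite invr_gt0 mulr_gt0 // ltr_wpDl.
have [n0 hn0] := expr_small (cnorm_ge0 q) q1 e0.
exists (\sum_(n < n0) b n + 2 * b n0) => al hal N.
apply: le_trans (ratio_bound N b0 _); last first.
  move=> n n0n; rewrite /b big_ord_recr /= -/(b n); apply: ler_wpM2l => //.
  have := hn0 n n0n; have yp : 0 < y + 1 by rewrite ltr_wpDl.
  move=> h; apply: (@le_trans _ _ ((y + 1) * (2 * (y + 1))^-1)).
    by apply: ler_pM => //; rewrite ?exprn_ge0 ?cnorm_ge0 // lerDl.
  by rewrite invfM mulrCA mulfV ?mulr1 // lt0r_neq0.
apply: ler_sum => -[n /= _] _; elim: n => [|n IH].
  by rewrite qE0 cnorm1 expr0 mulr1 /b big_ord0.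
rewrite /b big_ord_recr /= -/(b n).
have -> : qE q al n.+1 = - qE q al n * (q ^+ n * al / (1 - q ^+ n.+1)).
  rewrite /qE qfactS bin2S exprD !exprS.
  have := qpow_neq1 n; have := qfact_neq0 qpow_neq1 n; rewrite exprS => h2 h3.
  by field; rewrite h2 h3.
rewrite cnormM cnormN (exprS r) [r * _]mulrC mulrACA; apply: ler_pM => //.
- by rewrite mulr_ge0 ?cnorm_ge0 ?exprn_ge0.
- by rewrite mulr_ge0 ?cnorm_ge0.
rewrite !cnormM cnormV cnormX /y.
have h2 : 1 - cnorm q <= cnorm (1 - q ^+ n.+1).
  apply: (le_trans _ (cnormB _ _)); rewrite cnorm1 lerD2l lerN2 cnormX exprS.
  by rewrite ler_piMr ?cnorm_ge0 // exprn_ile1 ?cnorm_ge0 // ltW.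
have h3 := lt_le_trans h1 h2.
set I := (cnorm (1 - q ^+ n.+1))^-1; set Q := cnorm q ^+ n.
have -> : Q * cnorm al * I * r = cnorm al * r * I * Q by ring.
apply: ler_wpM2r; first by rewrite exprn_ge0 ?cnorm_ge0.
apply: ler_pM => //; rewrite ?mulr_ge0 ?invr_ge0 ?cnorm_ge0 //.
by rewrite lef_pV2 ?posrE.
Qed.

Lemma qI_conv r X : 0 <= r -> X < 1 ->
  exists M, forall al, cnorm al * r <= X -> conv (qI q al) r M.
Proof.
move=> r0 X1; have [B [B0 hB]] := qprod_inv_upper q1.
exists (B / (1 - X)) => al hal N.
have X0 : 0 <= X by apply: le_trans hal; rewrite mulr_ge0 ?cnorm_ge0.
apply: (@le_trans _ _ (\sum_(n < N) B * X ^+ n)); last first.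
  by rewrite -mulr_sumr; apply: ler_wpM2l; [exact: ltW|exact: geometric_bound].
apply: ler_sum => n _; rewrite /qI cnormM cnormV cnormX mulrAC -exprMn mulrC.
apply: ler_pM; rewrite ?invr_ge0 ?cnorm_ge0 ?exprn_ge0 ?mulr_ge0 ?cnorm_ge0 //.
  exact: hB.
by apply: lerXn2r; rewrite ?nnegrE // mulr_ge0 ?cnorm_ge0.
Qed.

Let e x : C := limn (psum (fun n => qE q 1 n * x ^+ n)).

Let e_val x : hasval (qE q 1) x (e x).
Proof.
have [M hM] := qE_conv (cnorm_ge0 x) (cnorm_ge0 x).
have [|l hl] := @summable_cvg _ (fun n => qE q 1 n * x ^+ n) M.
  by apply: conv_summable; apply: hM; rewrite cnorm1 mul1r.
by rewrite /hasval /e (lim_toE hl).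
Qed.

Let qE_e al t : hasval (qE q al) t (e (al * t)).
Proof.
apply: lim_to_ext (e_val (al * t)) => N; rewrite /psum; apply: eq_bigr => n _.
by rewrite /qE expr1n exprMn; ring.
Qed.

Let qE_conv1 al t : exists M, conv (qE q al) (cnorm t) M.
Proof.
have [M hM] := qE_conv (cnorm_ge0 t) (mulr_ge0 (cnorm_ge0 al) (cnorm_ge0 t)).
by exists M; apply: hM.
Qed.

Let e_rec x n : e x = P x n * e (x * q ^+ n).
Proof.
elim: n => [|n IH]; first by rewrite qprod0 mul1r mulr1.
rewrite {1}IH qprodSr -mulrA; congr (_ * _).
set y := x * q ^+ n; have [M hM] := qE_conv1 (q * 1) y.
have := hasval_mul (conv_L 1 (cnorm_ge0 y)) hM (hasval_L 1 y) (qE_e (q * 1) y).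
rewrite -(qE_rec qpow_neq1 1) => h.
rewrite (lim_to_unique (e_val y) h) [1 * y]mul1r.
rewrite [q * 1]mulr1 [q * y]mulrCA -exprS -/y; exact: erefl.
Qed.

Let e_lim x : lim_to (qpoch x q) (e x).
Proof.
have [M hM] := qE_conv1 1 1; have M0 := conv_ge0 hM.
have near1 y : cnorm y <= 1 -> cnorm (e y - 1) <= cnorm y * M.
  move=> hy; have h := lim_toD (e_val y) (lim_to_const (-1)).
  apply: (lim_to_le (N0 := 1)) h => -[//|n] _.
  rewrite /psum big_ord_recl expr0 mulr1 qE0 addrAC subrr add0r.
  apply: (le_trans (cnorm_sum _)).
  apply: (@le_trans _ _ (cnorm y * \sum_(i < n) cnorm (qE q 1 i.+1))).
    rewrite mulr_sumr; apply: ler_sum => i _; rewrite lift0 cnormM cnormX mulrC exprS.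
    rewrite -mulrA; apply: ler_wpM2l; first exact: cnorm_ge0.
    by rewrite ler_piMl ?cnorm_ge0 // exprn_ile1 ?cnorm_ge0.
  apply: ler_wpM2l; first exact: cnorm_ge0.
  apply: le_trans (hM n.+1); rewrite big_ord_recl -[leLHS]add0r; apply: lerD.
    by rewrite mulr_ge0 ?cnorm_ge0 ?exprn_ge0 ?cnorm_ge0.
  by apply: ler_sum => i _; rewrite lift0 cnorm1 expr1n mulr1.
have [B [B0 hB]] := qprod_upper (cnorm x).
move=> d d0; have BM : 0 < B * (M + 1) by rewrite mulr_gt0 // ltr_wpDl.
pose d1 := Num.min 1 (d / (B * (M + 1))).
have d10 : 0 < d1 by rewrite lt_min ltr01 divr_gt0.
have x1 : 0 < cnorm x + 1 by rewrite ltr_wpDl ?cnorm_ge0.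
have [N hN] := expr_small (cnorm_ge0 q) q1 (divr_gt0 d10 x1).
exists N => n /hN; rewrite ler_pdivlMr // => hn.
have hy : cnorm (x * q ^+ n) <= d1.
  rewrite cnormM cnormX mulrC; apply: le_trans hn; apply: ler_wpM2l.
    by rewrite exprn_ge0 ?cnorm_ge0.
  by rewrite lerDl.
have -> : qpoch x q n - e x = - (P x n * (e (x * q ^+ n) - 1)).
  by rewrite (e_rec x n) -[qpoch x q n]/(P x n); ring.
rewrite cnormN cnormM.
apply: (@le_trans _ _ (B * (d1 * M))).
  apply: ler_pM; rewrite ?cnorm_ge0 //; first exact: hB.
  apply: le_trans (near1 _ _) _; first by apply: le_trans hy _; rewrite ge_min lexx.
  exact: ler_wpM2r.
have : d1 <= d / (B * (M + 1)) by rewrite ge_min lexx orbT.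
rewrite ler_pdivlMr // => h; apply: le_trans h.
rewrite mulrCA; apply: ler_wpM2l; first exact: ltW.
by apply: ler_wpM2l; [exact: ltW|rewrite lerDl].
Qed.

Lemma qE_val al t : hasval (qE q al) t (qpochInf (al * t) q).
Proof. by rewrite /qpochInf (lim_toE (e_lim (al * t))). Qed.

Lemma qpochInf_split x n : qpochInf x q = qpoch x q n * qpochInf (x * q ^+ n) q.
Proof. by rewrite /qpochInf !(lim_toE (e_lim _)) (e_rec x n). Qed.

Lemma qI_mul_qE al t : cnorm (al * t) < 1 ->
  exists v, hasval (qI q al) t v /\ qpochInf (al * t) q * v = 1.
Proof.
rewrite cnormM => h1; have [M hM] := qI_conv (cnorm_ge0 t) h1.
have hc := hM al (lexx _).
have [v hv] := summable_cvg (conv_summable hc).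
exists v; split=> //; have [M' hM'] := qE_conv1 al t.
have := hasval_mul hM' hc (qE_val al t) hv; rewrite qEI; last exact: qpow_neq1.
by move=> h; apply: (lim_to_unique h); rewrite -fpsC1; exact: hasval_C.
Qed.

Lemma qpochInf_neq0 x : cnorm x < 1 -> qpochInf x q != 0.
Proof.
move=> h; have [|v [_]] := @qI_mul_qE x 1; first by rewrite mulr1.
by rewrite mulr1 => e1; apply: contra_eq_neq e1 => ->; rewrite mul0r eq_sym oner_eq0.
Qed.

Lemma qI_val al t : cnorm (al * t) < 1 -> hasval (qI q al) t (qpochInf (al * t) q)^-1.
Proof.
move=> h; have [v [hv e1]] := qI_mul_qE h.
by have <- : v = (qpochInf (al * t) q)^-1 by rewrite -[RHS]mulr1 -e1 mulKf ?qpochInf_neq0.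
Qed.

Lemma qX_val al n t : hasval (fpsP (qX q al n)) t (qpoch (al * t) q n)
  /\ conv (fpsP (qX q al n)) (cnorm t) (\prod_(i < n) (1 + (cnorm al * cnorm t) * cnorm q ^+ i)).
Proof.
elim: n => [|n [IH1 IH2]].
  rewrite qX0 big_ord0 fpsP1 -fpsC1 /qpoch big_ord0; split; first exact: hasval_C.
  by have := conv_C 1 (cnorm t); rewrite cnorm1.
rewrite /qX big_ord_recr /= -/(qX q al n) fpsPM -fpsL_poly.
have h := conv_L (al * q ^+ n) (cnorm_ge0 t).
split.
  have := hasval_mul IH2 h IH1 (hasval_L _ _).
  by rewrite /qpoch big_ord_recr /=; congr hasval; congr (_ * (1 - _)); ring.
rewrite big_ord_recr /=; have := conv_mul IH2 h.
by congr conv; congr (_ * (1 + _)); rewrite cnormM cnormX; ring.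
Qed.

End QAnalysis.

Lemma qprod_shift1 (F : fieldType) (q x : F) k :
  qprod q 1 (q * x) k * (1 - x) = qprod q 1 x k * (1 - x * q ^+ k).
Proof.
elim: k => [|k IH]; first by rewrite !qprod0 expr0 mulr1.
by rewrite !qprodSr mulrAC IH exprS; ring.
Qed.

Lemma vwp_quotient (F : fieldType) (q s : F) k :
  (forall i, 1 - s ^+ 2 * q ^+ (i + i) != 0) ->
  qprod q 1 (q * s) k * qprod q 1 (- (q * s)) k / (qprod q 1 s k * qprod q 1 (- s) k)
  = (1 - s ^+ 2 * q ^+ (k + k)) / (1 - s ^+ 2).
Proof.
move=> h.
have hf i x : s ^+ 2 = x ^+ 2 -> 1 - x * q ^+ i != 0.
  move=> ex; apply: contraNneq (h i) => e.
  have -> : 1 - s ^+ 2 * q ^+ (i + i) = (1 - x * q ^+ i) * (1 + x * q ^+ i).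
    by rewrite ex exprD; ring.
  by rewrite e mul0r.
have hP x : s ^+ 2 = x ^+ 2 -> qprod q 1 x k != 0.
  by move=> ex; apply: qprod_neq0 => i _; exact: hf.
have h0 x : s ^+ 2 = x ^+ 2 -> 1 - x != 0 by move=> /(hf 0%N); rewrite expr0 mulr1.
have e2 : s ^+ 2 = (- s) ^+ 2 by rewrite sqrrN.
have e1 := qprod_shift1 q s k; have := qprod_shift1 q (- s) k; rewrite mulrN => e3.
have n1 := hP _ (erefl _); have n2 := hP _ e2.
have n3 := h0 _ (erefl _); have n4 := h0 _ e2.
have n5 : 1 - s ^+ 2 != 0 by have := h 0%N; rewrite expr0 mulr1.
apply/eqP; rewrite eqr_div ?mulf_neq0 //; apply/eqP.
rewrite exprD; set x := q ^+ k in e1 e3 *.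
transitivity ((qprod q 1 (q * s) k * (1 - s)) * (qprod q 1 (- (q * s)) k * (1 - - s))).
  by ring.
by rewrite e1 e3; ring.
Qed.

Section PoissonValue.
Variable R : realType.
Local Notation C := (Cx R).
Variable q t : C.
Hypothesis q0 : q != 0.
Hypothesis q1 : cnorm q < 1.
Implicit Types (u v a b : C) (X Y Z : R).
Local Notation P := (qprod q 1).

Lemma vwpS_conv Y : Y < 1 -> exists M, forall x, cnorm x * cnorm t <= Y ->
  forall k, conv (vwpS q x k) (cnorm t) M.
Proof.
move=> Y1; have [M hM] := qI_conv q1 (cnorm_ge0 t) Y1.
exists (M * 2) => x hx k.
have hxk n : cnorm (x * q ^+ n) * cnorm t <= Y.
  by apply: le_trans hx; apply: ler_wpM2r (cnorm_mulq q1 _ _); exact: cnorm_ge0.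
have M0 := conv_ge0 (hM x hx).
case: k => [|k] /=; first by apply: conv_le (hM x hx); rewrite ler_peMr // ler1n.
apply: (conv_le _ (conv_mul (hM _ (hxk k)) (conv_L _ (cnorm_ge0 t)))).
apply: ler_wpM2l => //; have := le_lt_trans (hxk (k + k.+1)%N) Y1.
lra.
Qed.

Lemma poisson_term_conv X Y : 0 <= X -> Y < 1 ->
  exists B, 0 <= B /\ forall u v a b a' b',
  [&& cnorm (b * u) <= X, cnorm (b / u) <= X, cnorm (b' * v) <= X & cnorm (b' / v) <= X] ->
  [&& cnorm (b * v) <= X, cnorm (b / v) <= X, cnorm (b' * u) <= X & cnorm (b' / u) <= X] ->
  [&& cnorm (b / a') <= X, cnorm (a * b) <= Y & cnorm (b * b') * cnorm t <= Y] ->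
  forall k, conv (poisson_term q u v a b a' b' k) (cnorm t) (B * cnorm (a' / b) ^+ k).
Proof.
move=> X0 Y1; have r0 := cnorm_ge0 t.
have [BP [BP0 hBP]] := qprod_upper q1 X.
have [BI [BI0 hBI]] := qprod_inv_upper q1 Y1.
have [BQ [BQ0 hBQ]] := qprod_inv_upper q1 q1.
have [ME hME] := qE_conv q1 r0 (mulr_ge0 X0 r0).
have [MV hMV] := vwpS_conv Y1.
pose EX := expR (X * cnorm t / (1 - cnorm q)).
have ME0 : 0 <= ME by apply: conv_ge0 (hME 0 _); rewrite cnorm0 mul0r mulr_ge0.
have MV0 : 0 <= Num.max 0 MV by rewrite le_max lexx.
exists (BP * BP * BP * BP * (BQ * BI) * (ME * ME * ME * ME) * (EX * Num.max 0 MV)); split.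
  by rewrite !mulr_ge0 ?expR_ge0 // ltW.
move=> u v a b a' b' /and4P[h1 h2 h3 h4] /and4P[h5 h6 h7 h8] /and3P[h9 h10 h11] k.
have hE x : cnorm x <= X -> conv (qE q (x * q ^+ k)) (cnorm t) ME.
  move=> hx; apply: hME; apply: ler_wpM2r => //.
  exact: le_trans (cnorm_mulq q1 _ _) hx.
have hX : conv (fpsP (qX q (b / a') k)) (cnorm t) EX.
  apply: conv_le (qX_val q (b / a') k t).2.
  apply: le_trans (prod_bound q1 k (mulr_ge0 (cnorm_ge0 _) r0)) _.
  by rewrite ler_expR; apply: ler_wpM2r; [rewrite invr_ge0 subr_ge0 ltW|exact: ler_wpM2r].
have hV : conv (vwpS q (b * b') k) (cnorm t) (Num.max 0 MV).
  by apply: conv_le (hMV _ h11 k); rewrite le_max lexx orbT.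
have hK := conv_C (poisson_coef q u v a b a' b' k) (cnorm t).
have := conv_mul (conv_mul hK (conv_mul (conv_mul (conv_mul (hE _ h5) (hE _ h6)) (hE _ h7)) (hE _ h8)))
  (conv_mul hX hV).
apply: conv_le; rewrite -/(EX) [leRHS]mulrAC; apply: ler_wpM2r; first by rewrite mulr_ge0 ?expR_ge0.
rewrite [leRHS]mulrAC; apply: ler_wpM2r; first by rewrite !mulr_ge0.
rewrite /poisson_coef [leLHS]cnormM [cnorm (_ ^+ k) in leLHS]cnormX; apply: ler_wpM2r; first by rewrite exprn_ge0 ?cnorm_ge0.
rewrite !cnormM cnormV cnormM invfM; have c0 := @cnorm_ge0 R.
by do !apply: ler_pM; rewrite ?mulr_ge0 ?invr_ge0 ?c0 //; (exact: hBP || exact: hBI || exact: hBQ).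
Qed.

Definition vwp_val (x : C) k : C :=
  if k is k'.+1 then (qpochInf (x * q ^+ k' * t) q)^-1 * (1 - x * q ^+ (k' + k'.+1) * t)
  else (qpochInf (x * t) q)^-1.

Lemma vwpS_val x k : cnorm (x * t) < 1 -> hasval (vwpS q x k) t (vwp_val x k).
Proof.
move=> hx.
have hxk n : cnorm (x * q ^+ n * t) < 1.
  by rewrite mulrAC; exact: le_lt_trans (cnorm_mulq q1 _ _) hx.
case: k => [|k] /=; first exact: qI_val.
have [M hM] : exists M, conv (qI q (x * q ^+ k)) (cnorm t) M.
  have := hxk k; rewrite cnormM => h; have [M hM] := qI_conv q1 (cnorm_ge0 t) h.
  by exists M; exact: hM.
exact: hasval_mul hM (conv_L _ (cnorm_ge0 t)) (qI_val q1 (hxk k)) (hasval_L _ _).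
Qed.

Definition poisson_val u v a b a' b' k : C :=
  poisson_coef q u v a b a' b' k
  * (qpochInf (b * v * q ^+ k * t) q * qpochInf (b / v * q ^+ k * t) q
     * qpochInf (b' * u * q ^+ k * t) q * qpochInf (b' / u * q ^+ k * t) q)
  * (qpoch (b / a' * t) q k * vwp_val (b * b') k).

Lemma poisson_term_val u v a b a' b' k : cnorm (b * b' * t) < 1 ->
  hasval (poisson_term q u v a b a' b' k) t (poisson_val u v a b a' b' k).
Proof.
move=> h1; have [hX cX] := qX_val q (b / a') k t.
have hE x := qE_val q1 x t.
have cE x : exists M, conv (qE q x) (cnorm t) M.
  have [M hM] := qE_conv q1 (cnorm_ge0 t) (mulr_ge0 (cnorm_ge0 x) (cnorm_ge0 t)).
  by exists M; exact: hM.
have [M1 c1] := cE (b * v * q ^+ k); have [M2 c2] := cE (b / v * q ^+ k).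
have [M3 c3] := cE (b' * u * q ^+ k); have [M4 c4] := cE (b' / u * q ^+ k).
have c12 := conv_mul c1 c2; have c123 := conv_mul c12 c3; have c1234 := conv_mul c123 c4.
have v12 := hasval_mul c1 c2 (hE _) (hE _); have v123 := hasval_mul c12 c3 v12 (hE _).
have v1234 := hasval_mul c123 c4 v123 (hE _).
have cC := conv_C (poisson_coef q u v a b a' b' k) (cnorm t).
have [MV cV] : exists M, conv (vwpS q (b * b') k) (cnorm t) M.
  move: h1; rewrite cnormM => h1; have [M hM] := vwpS_conv h1.
  by exists M; exact: hM.
apply: (hasval_mul (conv_mul cC c1234) (conv_mul cX cV)).
  by apply: (hasval_mul cC c1234) => //; exact: hasval_C.
by apply: (hasval_mul cX cV) => //; exact: vwpS_val.
Qed.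

Lemma W87_termS (A b c d e f z : C) k : (forall i, 1 - A * q ^+ (i + i) != 0) ->
  W87_term A b c d e f q z k.+1
  = P (A * q) k * (1 - A * q ^+ (k.+1 + k.+1))
    * (P b k.+1 * P c k.+1 * P d k.+1 * P e k.+1 * P f k.+1)
    / (P q k.+1 * (P (A * q / b) k.+1 * P (A * q / c) k.+1 * P (A * q / d) k.+1
        * P (A * q / e) k.+1 * P (A * q / f) k.+1)) * z ^+ k.+1.
Proof.
move=> h; rewrite /W87_term; set s := sqrtC A.
have es : s ^+ 2 = A by exact: sqrtCK.
have := @vwp_quotient C q s k.+1; rewrite es => /(_ h) e1.
have e2 : P A k.+1 = (1 - A) * P (A * q) k by exact: qprodS.
have n1 : 1 - A != 0 by have := h 0%N; rewrite expr0 mulr1.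
change (qpoch (R := R)) with (fun x q n => @qprod C q 1 x n); cbv beta.
move: e1 e2.
set N2 := P (q * s) k.+1; set N3 := P (- (q * s)) k.+1; set S1 := P s k.+1; set S2 := P (- s) k.+1.
set L := 1 - A * q ^+ _; set NA := P A k.+1; set K := P (A * q) k => e1 e2.
transitivity (NA * (N2 * N3 / (S1 * S2)) * (P b k.+1 * P c k.+1 * P d k.+1 * P e k.+1 * P f k.+1)
    / (P q k.+1 * (P (A * q / b) k.+1 * P (A * q / c) k.+1 * P (A * q / d) k.+1
        * P (A * q / e) k.+1 * P (A * q / f) k.+1)) * z ^+ k.+1).
  congr (_ * _); clear e1 e2; move: NA N2 N3 S1 S2 => NA N2 N3 S1 S2.
  move: (P b _) (P c _) (P d _) (P e _) (P f _) (P q _) (P (A * q / b) _) (P (A * q / c) _)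
    (P (A * q / d) _) (P (A * q / e) _) (P (A * q / f) _) => *.
  by rewrite !invfM; ring.
by rewrite e1 e2 [_ * K * _](_ : _ = K * L) //; field.
Qed.

Lemma W87_term0 (A b c d e f z : C) : W87_term A b c d e f q z 0 = 1.
Proof. by rewrite /W87_term /qpoch !big_ord0 expr0 !mulr1 invr1 ?mul1r. Qed.

Lemma poisson_val_W87 u v a b a' b' k :
  [&& u != 0, v != 0, b != 0, a' != 0 & b' != 0] -> a * b = a' * b' ->
  [&& cnorm (b * v * t) < 1, cnorm (b / v * t) < 1, cnorm (b' * u * t) < 1 & cnorm (b' / u * t) < 1] ->
  cnorm (b * b' * t) < 1 -> b * b' * t != q ->
  poisson_val u v a b a' b' k * t ^+ k
  = qpochInf (b * v * t) q * qpochInf (b / v * t) q * qpochInf (b' * u * t) q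
      * qpochInf (b' / u * t) q / qpochInf (b * b' * t) q
    * W87_term (b * b' * t / q) (b * u) (b / u) (b' * v) (b' / v) (b * t / a') q (a' * t / b) k.
Proof.
case/and5P=> u0 v0 b0 a0 b'0 eab /and4P[h1 h2 h3 h4] h5 h6.
have sp x : cnorm (x * t) < 1 -> qpochInf (x * q ^+ k * t) q = qpochInf (x * t) q / P (x * t) k.
  move=> hx; rewrite (qpochInf_split q1 (x * t) k) -[qpoch _ _ _]/(P (x * t) k).
  by rewrite [RHS]mulrC mulKf ?qprod1_neq0 // [x * _ * t]mulrAC.
rewrite /poisson_val !sp //; case: k {sp} => [|k].
  rewrite W87_term0 /poisson_coef !qprod0 /qpoch big_ord0 /vwp_val !expr0 !divr1.
  by rewrite !mulr1 !divr1 !mul1r.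
have [->|t0] := eqVneq t 0.
  by rewrite /W87_term !mulr0 !mul0r expr0n /= !mulr0.
have hA i : 1 - b * b' * t / q * q ^+ (i + i) != 0.
  case: i => [|i]; first by rewrite expr0 mulr1 subr_eq0 eq_sym -(inj_eq (mulIf q0)) divfK // mul1r.
  rewrite addSn (exprS q) mulrA divfK //; apply: subr1_neq0.
  exact: le_lt_trans (cnorm_mulq q1 _ _) h5.
rewrite W87_termS // /poisson_coef divfK //.
have -> : b * b' * t / (b * u) = b' / u * t by field; rewrite u0 b0.
have -> : b * b' * t / (b / u) = b' * u * t by field; rewrite u0 b0.
have -> : b * b' * t / (b' * v) = b / v * t by field; rewrite v0 b'0.
have -> : b * b' * t / (b' / v) = b * v * t by field; rewrite v0 b'0.
have -> : b * b' * t / (b * t / a') = a * b by rewrite eab; field; rewrite a0 b0 t0.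
have -> : b * b' * t / q * q ^+ (k.+1 + k.+1) = b * b' * t * q ^+ (k + k.+1).
  by rewrite addSn (exprS q) mulrA divfK.
have -> : a' * t / b = a' / b * t by rewrite mulrAC.
rewrite [(_ * t) ^+ _]exprMn.
have -> : vwp_val (b * b') k.+1
    = P (b * b' * t) k / qpochInf (b * b' * t) q * (1 - b * b' * t * q ^+ (k + k.+1)).
  rewrite /vwp_val [b * b' * q ^+ (k + k.+1) * t]mulrAC; congr (_ * _).
  rewrite (qpochInf_split q1 (b * b' * t) k) -[qpoch _ _ _]/(P (b * b' * t) k) mulrAC.
  by rewrite invfM mulrA mulfV ?qprod1_neq0 // mul1r.
have -> : b / a' * t = b * t / a' by rewrite mulrAC.
rewrite -[qpoch (b * t / a') q k.+1]/(P (b * t / a') k.+1).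
move: (qpochInf (b * v * t) q) (qpochInf (b / v * t) q) (qpochInf (b' * u * t) q)
  (qpochInf (b' / u * t) q) (qpochInf (b * b' * t) q) => I1 I2 I3 I4 I5.
move: (P (b * b' * t) k) (1 - b * b' * t * q ^+ (k + k.+1)) (P (b * t / a') k.+1) => X1 X2 X3.
move: (P (b * v * t) _) (P (b / v * t) _) (P (b' * u * t) _) (P (b' / u * t) _) => Y1 Y2 Y3 Y4.
move: (P (b * u) _) (P (b / u) _) (P (b' * v) _) (P (b' / v) _) (P q _) (P (a * b) _) => Z1 Z2 Z3 Z4 Z5 Z6.
by move: ((a' / b) ^+ k.+1) (t ^+ k.+1) => z1 z2; rewrite !invfM; ring.
Qed.

Definition poisson_closed u v b a' b' : C :=
  qpochInf (b * v * t) q * qpochInf (b / v * t) q * qpochInf (b' * u * t) q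
      * qpochInf (b' / u * t) q / qpochInf (b * b' * t) q
    * W87 (b * b' * t / q) (b * u) (b / u) (b' * v) (b' / v) (b * t / a') q (a' * t / b).

(* Uniformity in the parameters is needed because this is applied to the
   j-th summand of the outer series, with parameters scaled by q^j. *)
Lemma poisson_sum X Y Z : 0 <= X -> Y < 1 -> Z < 1 ->
  exists M, 0 <= M /\ forall u v a b a' b',
  [&& u != 0, v != 0, b != 0, a' != 0 & b' != 0] -> a * b = a' * b' ->
  [&& cnorm (b * u) <= X, cnorm (b / u) <= X, cnorm (b' * v) <= X & cnorm (b' / v) <= X] ->
  [&& cnorm (b * v) <= X, cnorm (b / v) <= X, cnorm (b' * u) <= X & cnorm (b' / u) <= X] ->
  [&& cnorm (b / a') <= X, cnorm (a * b) <= Y & cnorm (b * b' * t) <= Y] ->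
  [&& cnorm (b * v * t) < 1, cnorm (b / v * t) < 1, cnorm (b' * u * t) < 1 & cnorm (b' / u * t) < 1] ->
  cnorm (a' * t / b) <= Z -> b * b' * t != q ->
  conv (tsum (poisson_term q u v a b a' b')) (cnorm t) M
  /\ hasval (tsum (poisson_term q u v a b a' b')) t (poisson_closed u v b a' b').
Proof.
move=> X0 Y1 Z1; have [B [B0 hB]] := poisson_term_conv X0 Y1.
have Z0 : 0 < 1 - Z by rewrite subr_gt0.
exists (B / (1 - Z)); split; first by rewrite divr_ge0 // ltW.
move=> u v a b a' b' nz eab g1 g2 g3 g4 g5 g6.
have lt5 : cnorm (b * b' * t) < 1 by case/and3P: g3 => _ _ /le_lt_trans; apply.
have g3' : [&& cnorm (b / a') <= X, cnorm (a * b) <= Y & cnorm (b * b') * cnorm t <= Y].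
  by rewrite -cnormM.
have [|hc [V [hV hs]]] := hasval_tsum (M := B / (1 - Z)) (hB _ _ _ _ _ _ g1 g2 g3')
  _ (fun k => poisson_term_val u v a a' k lt5).
  move=> N; have zz : cnorm (a' * t / b) = cnorm (a' / b) * cnorm t by rewrite -cnormM mulrAC.
  under eq_bigr do rewrite -mulrA -exprMn -zz.
  rewrite -mulr_sumr; apply: ler_wpM2l => //.
  apply: (le_trans (geometric_bound N (cnorm_ge0 _) (le_lt_trans g5 Z1))).
  by rewrite lef_pV2 ?posrE ?subr_gt0 ?(le_lt_trans g5 Z1) // lerD2l lerN2.
split=> //.
have ew k := poisson_val_W87 k nz eab g4 lt5 g6.
set pre := qpochInf (b * v * t) q * _ * _ * _ / _ in ew.
have pre0 : pre != 0.
  by case/and4P: g4 => *; rewrite /pre !mulf_neq0 ?invr_eq0 ?qpochInf_neq0.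
have hs' := lim_toZ pre^-1 hs.
suff -> : poisson_closed u v b a' b' = V by [].
rewrite /poisson_closed -/pre /W87 /seriesVal.
rewrite (lim_toE (lim_to_ext _ hs')) ?mulVKf // => N.
rewrite /psum mulr_sumr; apply: eq_bigr => k _.
by rewrite ew mulKf.
Qed.

End PoissonValue.

Section AskeyWilsonBound.
Variable R : realType.
Local Notation C := (Cx R).
Variable q : C.
Hypothesis q0 : q != 0.
Hypothesis q1 : cnorm q < 1.
Implicit Types (a b c d u v p s x y z t : C) (r : R).
Local Notation P := (qprod q 1).

Lemma phi21_conv r x y c z : 0 <= r -> cnorm c < 1 -> cnorm z * r < 1 ->
  exists M, conv (phi21 q x y c z) r M.
Proof.
move=> r0 c1 zr; have [Bx [Bx0 hx]] := qprod_upper q1 (cnorm x).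
have [By [By0 hy]] := qprod_upper q1 (cnorm y).
have [Bc [Bc0 hc]] := qprod_inv_upper q1 c1; have [Bq [Bq0 hq]] := qprod_inv_upper q1 q1.
exists (Bx * By * (Bq * Bc) * (1 - cnorm z * r)^-1) => N.
apply: (@le_trans _ _ (\sum_(n < N) Bx * By * (Bq * Bc) * (cnorm z * r) ^+ n)); last first.
  rewrite -mulr_sumr; apply: ler_wpM2l; first by rewrite !mulr_ge0 // ltW.
  by apply: geometric_bound => //; rewrite mulr_ge0 ?cnorm_ge0.
apply: ler_sum => n _.
have -> : phi21 q x y c z n = P x n * P y n / (P q n * P c n) * z ^+ n by rewrite /phi21 mulrAC.
rewrite cnormM cnormX exprMn -mulrA.
apply: ler_wpM2r; first by rewrite mulr_ge0 ?exprn_ge0 ?cnorm_ge0.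
rewrite !cnormM cnormV cnormM invfM.
have c0 := @cnorm_ge0 R.
by do !apply: ler_pM; rewrite ?mulr_ge0 ?invr_ge0 ?c0 //; (exact: hx || exact: hy || exact: hc || exact: hq).
Qed.

Lemma aw_conv_bound u a b c d r : 0 <= r -> r < 1 -> cnorm u = 1 ->
  cnorm (a * b) < 1 -> cnorm (c * d) < 1 ->
  exists M, 0 <= M /\ forall j, cnorm (aw_conv q u a b c d j) * r ^+ j <= M.
Proof.
move=> r0 r1 u1 ab1 cd1.
have er : cnorm (r%:C : C) = r by exact: cnorm_real.
have u1' : cnorm u^-1 = 1 by rewrite cnormV u1 invr1.
have [|M1 h1] := @phi21_conv r (a * u) (b * u) (a * b) u^-1 r0 ab1; first by rewrite u1' mul1r.
have [|M2 h2] := @phi21_conv r (c / u) (d / u) (c * d) u r0 cd1; first by rewrite u1 mul1r.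
move: h1 h2; rewrite -er => h1 h2; have h := conv_mul h1 h2.
exists (M1 * M2); split; first exact: conv_ge0 h.
move=> j; exact: conv_coef (cnorm_ge0 _) h.
Qed.

Lemma aw_weight_bound p s : cnorm p < 1 -> cnorm s < 1 ->
  exists B, 0 <= B /\ forall j, cnorm (aw_weight q p s j) <= B.
Proof.
move=> p1 s1; have ps1 : cnorm (p * s) < 1.
  by rewrite cnormM; apply: le_lt_trans p1; rewrite ler_piMr ?cnorm_ge0 // ltW.
have [B1 [B10 h1]] := qprod_upper q1 1; have [B2 [B20 h2]] := qprod_inv_upper q1 ps1.
have B0 : 0 <= B1 * B1 * B1 * B2 by rewrite !mulr_ge0 // ltW.
exists (1 + B1 * B1 * B1 * B2); split; first by rewrite addr_ge0.
case=> [|j]; first by rewrite /aw_weight !qprod0 !mulr1 divr1 cnorm1 lerDl.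
apply: (@le_trans _ _ (B1 * B1 * B1 * B2)); last by rewrite lerDr.
rewrite /aw_weight !cnormM cnormV.
have -> : p * s * q ^+ j.+1 / q = p * s * q ^+ j by rewrite exprS mulrCA mulrC mulKf.
have c0 := @cnorm_ge0 R.
do !apply: ler_pM; rewrite ?mulr_ge0 ?invr_ge0 ?c0 //.
- by apply: h1; exact: ltW.
- by apply: h1; exact: ltW.
- by apply: h1; exact: ltW.
by apply: h2; exact: cnorm_mulq.
Qed.

Lemma aw_kernel_bound t u v a b c d a' b' c' d' p s : cnorm t < 1 ->
  cnorm u = 1 -> cnorm v = 1 -> cnorm p < 1 -> cnorm s < 1 ->
  cnorm (a * b) < 1 -> cnorm (c * d) < 1 -> cnorm (a' * b') < 1 -> cnorm (c' * d') < 1 ->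
  exists M, forall N : nat, \sum_(j < N) cnorm (aw_weight q p s j * aw_conv q u a b c d j
    * aw_conv q v a' b' c' d' j) * cnorm t ^+ j <= M.
Proof.
move=> t1 u1 v1 p1 s1 h1 h2 h3 h4; have t0 := cnorm_ge0 t.
pose r := (1 + cnorm t) / 2; have r0 : 0 < r by rewrite divr_gt0 // ltr_pwDl.
have r1 : r < 1 by rewrite /r; lra.
have rr : cnorm t < r * r by rewrite /r; nra.
have [M [M0 hM]] := aw_conv_bound (ltW r0) r1 u1 h1 h2.
have [M' [M'0 hM']] := aw_conv_bound (ltW r0) r1 v1 h3 h4.
have [B [B0 hB]] := aw_weight_bound p1 s1.
have rr0 : 0 < r * r by rewrite mulr_gt0.
pose x := cnorm t / (r * r).
have x0 : 0 <= x by rewrite divr_ge0 // ltW.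
have x1 : x < 1 by rewrite /x ltr_pdivrMr // mul1r.
exists (B * M * M' / (1 - x)) => N.
apply: (@le_trans _ _ (\sum_(j < N) B * M * M' * x ^+ j)); last first.
  rewrite -mulr_sumr; apply: ler_wpM2l; first by rewrite !mulr_ge0.
  exact: geometric_bound.
apply: ler_sum => j _.
have -> : cnorm t ^+ j = r ^+ j * r ^+ j * x ^+ j.
  by rewrite -!exprMn /x mulrC divfK // lt0r_neq0.
rewrite mulrA; apply: ler_wpM2r; first by rewrite exprn_ge0.
rewrite [cnorm (_ * aw_conv q v _ _ _ _ _)]cnormM [cnorm (aw_weight _ _ _ _ * _)]cnormM.
have c0 := @cnorm_ge0 R; have r0' := ltW r0.
have pr := exprn_ge0 j r0'.
rewrite mulrACA; apply: ler_pM; [by rewrite !mulr_ge0|by rewrite mulr_ge0| |exact: hM'].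
by rewrite -[leLHS]mulrA; apply: ler_pM; [exact: c0|by rewrite mulr_ge0|exact: hB|exact: hM].
Qed.

End AskeyWilsonBound.

Section KernelValue.
Variable R : realType.
Local Notation C := (Cx R).
Variable q : C.
Hypothesis q0 : q != 0.
Hypothesis q1 : cnorm q < 1.
Implicit Types (a b c d u v p s x y z t : C).

Lemma cnorm_mul_le x y : cnorm y <= 1 -> cnorm (x * y) <= cnorm x.
Proof. by move=> h; rewrite cnormM ler_piMr ?cnorm_ge0. Qed.

Lemma cnorm_mul_le1 x y : cnorm x <= 1 -> cnorm y <= 1 -> cnorm (x * y) <= 1.
Proof. by move=> hx /(cnorm_mul_le x) /le_trans; apply. Qed.

Lemma cnorm_mul_lt1 x y : cnorm x < 1 -> cnorm y <= 1 -> cnorm (x * y) < 1.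
Proof. by move=> hx /(cnorm_mul_le x) /le_lt_trans; apply. Qed.

Lemma kernel_value t u v s w w' a b a' b' :
  [&& u != 0, v != 0, s != 0, w != 0 & w' != 0] ->
  [&& a != 0, b != 0, a' != 0 & b' != 0] -> a * b = a' * b' ->
  cnorm t < 1 -> cnorm u = 1 -> cnorm v = 1 ->
  [&& cnorm a < 1, cnorm b < 1, cnorm a' < 1 & cnorm b' < 1] ->
  [&& cnorm (s * w) < 1, cnorm (s / w) < 1, cnorm (s * w') < 1 & cnorm (s / w') < 1] ->
  cnorm (a' * t / b) < 1 ->
  [&& b * b' * t != q, s ^+ 2 * t / (u * v) != q & b * b' * s ^+ 2 * t != q] ->
  lim_to (psum (fun j => aw_weight q (a * b) (s ^+ 2) j * aw_conv q u a b (s * w) (s / w) j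
      * aw_conv q v a' b' (s * w') (s / w') j
      * poisson_closed q t w w' (b * s * q ^+ j) (a' * s * q ^+ j) (b' * s * q ^+ j) * t ^+ j))
   (poisson_closed q t u v b a' b' * poisson_closed q t w w' (s / u) (s * v) (s / v)
     / (qpochInf (u / v * t) q * qpochInf (v / u * t) q * qpochInf ((u * v)^-1 * t) q)).
Proof.
move=> nz1 nz2 eab t1 u1 v1 n1 n2 z1 /and3P[nq1 nq2 nq3].
case/and5P: (nz1) => u0 v0 s0 w0 w'0; case/and4P: (nz2) => a0 b0 a'0 b'0.
case/and4P: n1 => na nb na' nb'; case/and4P: n2 => nc nd nc' nd'.
have es : s * w * (s / w) = s ^+ 2 by field.
have es' : s * w' * (s / w') = s ^+ 2 by field.
have ui : cnorm u^-1 <= 1 by rewrite cnormV u1 invr1.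
have vi : cnorm v^-1 <= 1 by rewrite cnormV v1 invr1.
have u1' : cnorm u <= 1 by rewrite u1.
have v1' : cnorm v <= 1 by rewrite v1.
have s2 : cnorm (s ^+ 2) < 1 by rewrite -es; apply: cnorm_mul_lt1 => //; exact: ltW.
have ab1 : cnorm (a * b) < 1 by apply: cnorm_mul_lt1 => //; exact: ltW.
have bb1 : cnorm (b * b') < 1 by apply: cnorm_mul_lt1 => //; exact: ltW.
have qj j := cnorm_qX q1 j.
pose X := 1 + cnorm (b / a').
have X1 : 1 <= X by rewrite lerDl cnorm_ge0.
have X0 : 0 <= X := le_trans ler01 X1.
pose Y := Num.max (cnorm (a * b)) (Num.max (cnorm (b * b')) (cnorm (s ^+ 2))).
have Y1 : Y < 1 by rewrite !gt_max ab1 bb1 s2.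
have Yab : cnorm (a * b) <= Y by rewrite le_max lexx.
have Ybb : cnorm (b * b') <= Y by rewrite !le_max lexx !orbT.
have Ys : cnorm (s ^+ 2) <= Y by rewrite !le_max lexx !orbT.
pose Z := Num.max (cnorm (a' * t / b)) (cnorm t).
have Z1 : Z < 1 by rewrite gt_max z1 t1.
have Za : cnorm (a' * t / b) <= Z by rewrite le_max lexx.
have Zt : cnorm t <= Z by rewrite le_max lexx orbT.
have [M [M0 hM]] := poisson_sum t q0 q1 X0 Y1 Z1.
have leX x : cnorm x < 1 -> cnorm x <= X by move=> /ltW /le_trans; apply.
have lt1M x y : cnorm x < 1 -> cnorm y < 1 -> cnorm (x * y) < 1.
  by move=> hx /ltW; exact: cnorm_mul_lt1.
have [||||||||hc1 hv1] := hM u v a b a' b'.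
- by rewrite u0 v0 b0 a'0 b'0.
- exact: eab.
- by rewrite !leX ?cnorm_mul_lt1.
- by rewrite !leX ?cnorm_mul_lt1.
- by rewrite Yab lerDr ler01 /=; apply: le_trans Ybb; apply: cnorm_mul_le; exact: ltW.
- by rewrite !cnorm_mul_lt1 ?cnorm_mul_lt1 // ltW.
- exact: Za.
- exact: nq1.
have lr x y : cnorm x < 1 -> cnorm y <= 1 -> cnorm (x * y) <= X.
  by move=> hx hy; rewrite leX ?cnorm_mul_lt1.
have t1' := ltW t1.
have lr3 x y : cnorm x < 1 -> cnorm y <= 1 -> cnorm (x * y * t) < 1.
  by move=> hx hy; rewrite !cnorm_mul_lt1.
have f1 x y z : x / y * z = x * z / y by rewrite mulrAC.
have nzd x y : x != 0 -> y != 0 -> x / y != 0 by move=> *; rewrite mulf_neq0 ?invr_eq0.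
have [||||||||hc2 hv2] := hM w w' (s * u) (s / u) (s * v) (s / v).
- by rewrite w0 w'0 !nzd // mulf_neq0.
- by field; rewrite u0 v0.
- by rewrite (f1 s u w) (f1 s u w^-1) (f1 s v w') (f1 s v w'^-1) !lr.
- by rewrite (f1 s u w') (f1 s u w'^-1) (f1 s v w) (f1 s v w^-1) !lr.
- have -> : s / u / (s * v) = u^-1 / v by field; rewrite u0 v0 s0.
  have -> : s * u * (s / u) = s ^+ 2 by field.
  have -> : s / u * (s / v) * t = s ^+ 2 * (u^-1 * v^-1 * t) by rewrite expr2; ring.
  rewrite Ys (le_trans _ X1) ?cnorm_mul_le1 //=.
  by apply: le_trans Ys; apply: cnorm_mul_le; rewrite !cnorm_mul_le1 // ltW.
- by rewrite (f1 s u w') (f1 s u w'^-1) (f1 s v w) (f1 s v w^-1) !lr3.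
- have -> : s * v * t / (s / u) = t * (u * v) by field; rewrite u0 s0.
  by apply: le_trans Zt; apply: cnorm_mul_le; rewrite cnorm_mul_le1.
- by have -> : s / u * (s / v) * t = s ^+ 2 * t / (u * v) by field; rewrite u0 v0.
have hj j := hM w w' (a * s * q ^+ j) (b * s * q ^+ j) (a' * s * q ^+ j) (b' * s * q ^+ j).
have {}hj j : conv (tsum (poisson_term q w w' (a * s * q ^+ j) (b * s * q ^+ j)
      (a' * s * q ^+ j) (b' * s * q ^+ j))) (cnorm t) M
  /\ hasval (tsum (poisson_term q w w' (a * s * q ^+ j) (b * s * q ^+ j)
      (a' * s * q ^+ j) (b' * s * q ^+ j))) t
      (poisson_closed q t w w' (b * s * q ^+ j) (a' * s * q ^+ j) (b' * s * q ^+ j)).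
  have qj0 : q ^+ j != 0 by rewrite expf_neq0.
  have g1 x y : x * s * q ^+ j * y = x * (s * y) * q ^+ j by ring.
  have g2 x : x * s * q ^+ j * t = x * s * t * q ^+ j by ring.
  have bnd x y : cnorm x < 1 -> cnorm (s * y) < 1 -> cnorm (x * s * q ^+ j * y) < 1.
    by move=> hx hy; rewrite g1; apply: cnorm_mul_lt1 => //; exact: lt1M.
  have g3 x y : x * s * q ^+ j * (y * s * q ^+ j) = x * y * (s ^+ 2 * (q ^+ j * q ^+ j)).
    by rewrite expr2; ring.
  have sq : cnorm (s ^+ 2 * (q ^+ j * q ^+ j)) < 1 by rewrite cnorm_mul_lt1 ?cnorm_mul_le1.
  apply: hj.
  - by rewrite w0 w'0 !mulf_neq0.
  - by rewrite !g3 eab.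
  - by rewrite !leX ?bnd.
  - by rewrite !leX ?bnd.
  - rewrite !g3; have -> : b * s * q ^+ j / (a' * s * q ^+ j) = b / a' by field; rewrite a'0 s0 qj0.
    rewrite lerDr ler01 /=; apply/andP; split.
      by apply: le_trans Yab; apply: cnorm_mul_le; exact: ltW.
    by rewrite -mulrA; apply: le_trans Ybb; apply: cnorm_mul_le; exact: ltW (lt1M _ _ sq t1).
  - by do 3?[apply/andP; split]; rewrite cnorm_mul_lt1 ?bnd.
  - by have -> : a' * s * q ^+ j * t / (b * s * q ^+ j) = a' * t / b by field; rewrite b0 s0 qj0.
  rewrite g3; case: (j) => [|i]; first by rewrite expr0 !mulr1.
  have -> : b * b' * (s ^+ 2 * (q ^+ i.+1 * q ^+ i.+1)) * t
    = q * (b * b' * (s ^+ 2 * (q ^+ i * q ^+ i.+1) * t)) by rewrite (exprS q i); ring.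
  rewrite -[X in _ != X]mulr1 (inj_eq (mulfI q0)).
  have h : cnorm (b * b' * (s ^+ 2 * (q ^+ i * q ^+ i.+1) * t)) < 1.
    apply: (lt1M _ _ bb1); apply: cnorm_mul_lt1 => //; apply: cnorm_mul_lt1 => //.
    exact: cnorm_mul_le1.
  by apply: contraTneq h => ->; rewrite cnorm1 ltxx.
pose K j := aw_weight q (a * b) (s ^+ 2) j * aw_conv q u a b (s * w) (s / w) j
  * aw_conv q v a' b' (s * w') (s / w') j.
have [MK hK] : exists MK, forall N : nat, \sum_(j < N) cnorm (K j) * cnorm t ^+ j <= MK.
  by apply: aw_kernel_bound; rewrite ?es ?es' -?eab.
have [|||hcT [V [hT hV]]] := @hasval_tsum _ (fun j => fpsC (K j) * tsum (poisson_term q w w'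
      (a * s * q ^+ j) (b * s * q ^+ j) (a' * s * q ^+ j) (b' * s * q ^+ j))) t
  (fun j => cnorm (K j) * M) (MK * M)
  (fun j => K j * poisson_closed q t w w' (b * s * q ^+ j) (a' * s * q ^+ j) (b' * s * q ^+ j)).
- by move=> j; exact: conv_mul (conv_C _ _) (hj j).1.
- move=> N; under eq_bigr do rewrite mulrAC.
  by rewrite -mulr_suml; apply: ler_wpM2r.
- by move=> j; exact: hasval_mul (conv_C _ _) (hj j).1 (hasval_C _ _) (hj j).2.
have nn x : cnorm x < 1 -> forall i, 1 - x * q ^+ i != 0.
  by move=> hx i; apply: subr1_neq0; exact: cnorm_mul_lt1.
have sq x : cnorm x < 1 -> cnorm (x ^+ 2) < 1 by move=> h; rewrite expr2 lt1M.
have nP := qprod1_neq0 q1.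
have fid := formal_identity (qpow_neq1 q1) q0 u0 v0 s0 w0 w'0 a0 b0 a'0 b'0 eab
  (nP _ ab1) (nP _ s2) (nP _ (lt1M _ _ ab1 s2)) (nn _ (sq _ nb)).
have {}fid := fid _ _.
have hu : cnorm ((s / u) ^+ 2) < 1 by rewrite expr_div_n cnorm_mul_lt1 // cnormV cnormX u1 expr1n invr1.
have hbs : cnorm ((b * s) ^+ 2) < 1 by rewrite exprMn lt1M // sq.
have {}fid := fid (nn _ hu) (nn _ hbs).
have cE x : exists M, conv (qE q x) (cnorm t) M.
  have [ME hME] := qE_conv q1 (cnorm_ge0 t) (mulr_ge0 (cnorm_ge0 x) (cnorm_ge0 t)).
  by exists ME; exact: hME.
have [E1 c1] := cE (u / v); have [E2 c2] := cE (v / u); have [E3 c3] := cE (u * v)^-1.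
have c12 := conv_mul c1 c2; have c123 := conv_mul c12 c3.
have v12 := hasval_mul c1 c2 (qE_val q1 _ _) (qE_val q1 _ _).
have v123 := hasval_mul c12 c3 v12 (qE_val q1 _ _).
have vL := hasval_mul c123 hcT v123 hT.
have vR := hasval_mul hc1 hc2 hv1 hv2.
rewrite -fid in vR.
have eV := lim_to_unique vR vL.
have ne x : cnorm x <= 1 -> qpochInf (x * t) q != 0.
  by move=> hx; apply: qpochInf_neq0 => //; rewrite mulrC cnorm_mul_lt1.
rewrite eV [X in lim_to _ X]mulrC mulKf; last by rewrite !mulf_neq0 // ne // ?invfM cnorm_mul_le1.
exact: hV.
Qed.

End KernelValue.

Section UnitCircle.
Variable R : realType.
Implicit Types x y : R.

Lemma eID x y : eI (x + y) = eI x * eI y.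
Proof.
rewrite /eI cosD sinD rmorphB rmorphD /= !rmorphM /=.
have e : ('i : Cx R) * 'i = -1 by rewrite -expr2 sqrCi.
move: (cos x)%:C (sin x)%:C (cos y)%:C (sin y)%:C => c s c' s'.
transitivity (c * c' + 'i * 'i * (s * s') + 'i * (s * c' + c * s')); last by ring.
by rewrite e mulN1r.
Qed.

Lemma eI0 : eI 0 = 1 :> Cx R.
Proof. by rewrite /eI cos0 sin0 mulr0 addr0. Qed.

Lemma eI_neq0 x : eI x != 0.
Proof.
apply/eqP => h; have := eI0; rewrite -(subrr x) eID h mul0r => /esym/eqP.
by rewrite oner_eq0.
Qed.

Lemma eIN x : eI (- x) = (eI x)^-1.
Proof.
apply: (mulfI (eI_neq0 x)); rewrite -eID subrr eI0 mulfV ?eI_neq0 //.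
Qed.

Lemma cnorm_eI x : cnorm (eI x) = 1.
Proof.
apply/eqP; rewrite -(@eqrXn2 _ 2) ?cnorm_ge0 // expr1n; apply/eqP.
apply: (@complexI R); rewrite rmorphXn /= -cnormE /eI.
rewrite normC2_rect ?complex_real //.
by rewrite -!rmorphXn -rmorphD /= cos2Dsin2.
Qed.

End UnitCircle.

Lemma AW_conv (R : realType) (q a b c d : Cx R) (th : R) n : q != 0 -> cnorm q < 1 ->
  [&& a != 0, b != 0, c != 0 & d != 0] ->
  [&& cnorm a < 1, cnorm b < 1, cnorm c < 1 & cnorm d < 1] ->
  AW n th a b c d q = qprod q 1 q n * qprod q 1 (a * b) n * qprod q 1 (c * d) n
    * aw_conv q (eI th) a b c d n.
Proof.
move=> q0 q1 /and4P[a0 b0 c0 d0] /and4P[na nb nc nd].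
have nP x y : cnorm x < 1 -> cnorm y < 1 -> forall i, qprod q 1 (x * y) i != 0.
  by move=> hx hy; apply: qprod1_neq0 => //; apply: cnorm_mul_lt1 => //; exact: ltW.
rewrite /AW eIN; apply: askey_wilson_phi21 => //; [exact: qpow_neq1|exact: eI_neq0|..];
  exact: nP.
Qed.

Lemma lim_to_eq (R : realType) (f g : nat -> Cx R) (x y : Cx R) :
  lim_to f x -> (forall n, f n = g n) -> x = y -> lim_to g y.
Proof. by move=> h fg <-; exact: lim_to_ext h. Qed.

Theorem theorem3p3 (R : realType) (q0 : R) (t a b c d a' b' c' d' : Cx R)
    (th ph : R)
    (hq0 : 0 < q0) (hq1 : q0 < 1) (ht : `|t| < 1)
    (ha : `|a| < 1) (hb : `|b| < 1) (hc : `|c| < 1) (hd : `|d| < 1)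
    (ha' : `|a'| < 1) (hb' : `|b'| < 1) (hc' : `|c'| < 1) (hd' : `|d'| < 1)
    (hb0 : b != 0) (hab : `|a' * t / b| < 1)
    (hab' : a * b = a' * b') (hcd' : c * d = c' * d')
    (* well-definedness of the displayed expressions (see NOTES.md) *)
    (hc0 : c != 0) (hd0 : d != 0) (ha'0 : a' != 0) (hb'0 : b' != 0)
    (hc'0 : c' != 0) (hd'0 : d' != 0)
    (hW1 : b * b' * t != q0%:C) (hW2 : c * d * t * eI (- (th + ph)) != q0%:C)
    (hH0 : b * b' * c * d * t != q0%:C) :
  let q : Cx R := q0%:C in
  let H (j : nat) : Cx R :=
    qpochInf (b * c' * q ^+ j * t) q * qpochInf (b' * c * q ^+ j * t) q
      * qpochInf (b * d' * q ^+ j * t) q * qpochInf (b' * d * q ^+ j * t) q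
    / (qpochInf (b * b' * c * d * q ^+ (2 * j) * t) q
       * (qpoch q q j * qpoch (a * b) q j * qpoch (c * d) q j
          * qpoch (a * b * c * d * q ^+ j / q) q j))
    * W87 (b * b' * c * d * q ^+ (2 * j) / q * t)
          (b * c * q ^+ j) (b * d * q ^+ j) (b' * c' * q ^+ j) (b' * d' * q ^+ j)
          (b * t / a') q (a' * t / b) in
  psum (fun j => H j * AW j th a b c d q * AW j ph a' b' c' d' q * t ^+ j) @ \oo
  --> (qpochInf (b * t * eI ph) q * qpochInf (b * t * eI (- ph)) q
        * qpochInf (c * t * eI (- ph)) q * qpochInf (d * t * eI (- ph)) q
        * qpochInf (b' * t * eI th) q * qpochInf (b' * t * eI (- th)) q
        * qpochInf (c' * t * eI (- th)) q * qpochInf (d' * t * eI (- th)) q)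
      / (qpochInf (b * b' * t) q * qpochInf (t * eI (th - ph)) q
         * qpochInf (t * eI (ph - th)) q * qpochInf (t * eI (- (th + ph))) q
         * qpochInf (c * d * t * eI (- (th + ph))) q)
      * W87 (b * b' * t / q) (b * eI th) (b * eI (- th)) (b' * eI ph) (b' * eI (- ph))
            (b * t / a') q (a' * t / b)
      * W87 (c * d * t * eI (- (th + ph)) / q) (c * eI (- th)) (d * eI (- th))
            (c' * eI (- ph)) (d' * eI (- ph)) (t * eI (- (th + ph))) q
            (t * eI (th + ph)).
Proof.
move=> q H.
have q1 : cnorm q < 1 by rewrite cnorm_real // ltW.
have qn0 : q != 0 by rewrite fmorph_eq0 lt0r_neq0.
have cdu : eI (- (th + ph)) = (eI th * eI ph)^-1 by rewrite eIN eID.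
move: (hW2); rewrite cdu => hW2'.
rewrite !eID !eIN; have := cnorm_eI th; have := cnorm_eI ph.
have := eI_neq0 th; have := eI_neq0 ph.
rewrite !cnorm_lt1 in ht ha hb hc hd ha' hb' hc' hd' hab.
have a0 : a != 0.
  by apply: contra_neq (mulf_neq0 ha'0 hb'0) => a0; rewrite -hab' a0 mul0r.
have AW1 j := AW_conv th j qn0 q1 (introT and4P (And4 a0 hb0 hc0 hd0))
  (introT and4P (And4 ha hb hc hd)).
have AW2 j := AW_conv ph j qn0 q1 (introT and4P (And4 ha'0 hb'0 hc'0 hd'0))
  (introT and4P (And4 ha' hb' hc' hd')).
move: AW1 AW2; move: (eI th) (eI ph) hW2' => u v hW2' AW1 AW2 v0 u0 v1 u1.
pose s := sqrtC (c * d); have es : s ^+ 2 = c * d := sqrtCK _.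
have s0 : s != 0 by rewrite sqrtC_eq0 mulf_neq0.
pose w := c / s; pose w' := c' / s.
have w0 : w != 0 by rewrite mulf_neq0 ?invr_eq0.
have w'0 : w' != 0 by rewrite mulf_neq0 ?invr_eq0.
have sw : s * w = c by rewrite mulrCA mulfV // mulr1.
have sw' : s * w' = c' by rewrite mulrCA mulfV // mulr1.
have wd : s / w = d by apply: (mulfI hc0); rewrite -es -{1}sw; field.
have wd' : s / w' = d' by apply: (mulfI hc'0); rewrite -hcd' -es -{1}sw'; field.
have := @kernel_value R q qn0 q1 t u v s w w' a b a' b'.
rewrite sw sw' wd wd' es u0 v0 s0 w0 w'0 a0 hb0 ha'0 hb'0 ha hb hc hd ha' hb' hc' hd' => hk.
have nq : [&& b * b' * t != q, c * d * t / (u * v) != q & b * b' * (c * d) * t != q].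
  by rewrite hW1 hW2' mulrA hH0.
apply/lim_toP; apply: (lim_to_eq (hk isT isT hab' ht u1 v1 isT isT hab nq)) => [N|].
  rewrite /psum; apply: eq_bigr => j _; congr (_ * _).
  have nP x : cnorm x < 1 -> qprod q 1 x j != 0 by move=> h; exact: qprod1_neq0.
  have Pq0 : qprod q 1 q j != 0 by exact: nP.
  have Pab : qprod q 1 (a * b) j != 0 by apply/nP/cnorm_mul_lt1 => //; exact: ltW.
  have Pcd : qprod q 1 (c * d) j != 0 by apply/nP/cnorm_mul_lt1 => //; exact: ltW.
  have qj0 : q ^+ j != 0 by rewrite expf_neq0.
  rewrite AW1 AW2.
  rewrite -hab' -hcd' /H /aw_weight /poisson_closed.
  have e1 x y : x * s * q ^+ j * y = x * (s * y) * q ^+ j by ring.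
  rewrite !(e1 _ w) !(e1 _ w') !(e1 _ w^-1) !(e1 _ w'^-1) sw sw' wd wd'.
  have -> : b * s * q ^+ j * (b' * s * q ^+ j) * t = b * b' * c * d * q ^+ (2 * j) * t.
    have -> : b * b' * c * d = b * b' * s ^+ 2 by rewrite es !mulrA.
    by rewrite mul2n -addnn (exprD q) expr2; ring.
  have -> : b * s * q ^+ j * t / (a' * s * q ^+ j) = b * t / a' by field; rewrite ha'0 s0 qj0.
  have -> : a' * s * q ^+ j * t / (b * s * q ^+ j) = a' * t / b by field; rewrite hb0 s0 qj0.
  have -> : b * b' * c * d * q ^+ (2 * j) / q * t = b * b' * c * d * q ^+ (2 * j) * t / q by rewrite mulrAC.
  have -> : a * b * (c * d) = a * b * c * d by rewrite mulrA.
  move: (W87 _ _ _ _ _ _ _ _) => W.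
  move: (qpochInf _ _) => I1; move: (qpochInf _ _) => I2; move: (qpochInf _ _) => I3.
  move: (qpochInf _ _) => I4; move: (qpochInf _ _) => I5.
  change (qpoch (R := R)) with (fun x q n => @qprod (Cx R) q 1 x n); cbv beta.
  move: (qprod q 1 (a * b * c * d * q ^+ j / q) j) => P4.
  move: (qprod q 1 q j) (qprod q 1 (a * b) j) (qprod q 1 (c * d) j) Pq0 Pab Pcd.
  move: (aw_conv q u a b c d j) (aw_conv q v a' b' c' d' j) => A A' P1 P2 P3 n1 n2 n3.
  transitivity ((P1 * P2 * P3 / (P1 * P2 * P3)) * (I1 * I3 * I2 * I4 / I5 / P4 * W * (A * A'))
    * (P1 * P2 * P3)); last by rewrite !invfM; ring.
  by rewrite mulfV ?mulf_neq0 //; ring.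
rewrite /poisson_closed.
have e1 x y : s / x * y = s * y / x by rewrite mulrAC.
rewrite !(e1 _ w) !(e1 _ w') !(e1 _ w^-1) !(e1 _ w'^-1) sw sw' wd wd'.
have -> : s / u * (s / v) * t = c * d * t / (u * v) by rewrite -es; field; rewrite u0 v0.
have -> : s / u * t / (s * v) = t / (u * v) by field; rewrite u0 v0 s0.
have -> : s * v * t / (s / u) = t * (u * v) by field; rewrite u0 s0.
rewrite (mulrAC b v t) (mulrAC b v^-1 t) (mulrAC b' u t) (mulrAC b' u^-1 t).
rewrite (mulrAC c' u^-1 t) (mulrAC d' u^-1 t) (mulrAC c v^-1 t) (mulrAC d v^-1 t).
rewrite (mulrC (u / v) t) (mulrC (v / u) t) (mulrC (u * v)^-1 t).
move: (W87 _ _ _ _ _ _ _ _) => W1; move: (W87 _ _ _ _ _ _ _ _) => W2.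
by rewrite !invfM; do ?[move: (qpochInf _ _) => ?]; ring.
Qed.
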